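(* (Simultaneous Horace Differential Lemma.) Let $X$ be an integral projective variety with a very ample line bundle $\mathcal{R}$. Let $H$ and $H'$ be integral effective Cartier divisors of $X$ such that $H\neq H'$ and $E:=H\cap H'$ is integral. Let $\widetilde{S}$ be a set of $r$ general points of $E$ and $\widetilde{Z}$ a set of $r$ general points of $H$. Let $W$ be a zero-dimensional subscheme of $X$ contained in the regular locus of $X$ and such that $W\cap\widetilde{S}=W\cap\widetilde{Z}=\emptyset$. Then for $i=0,1$ \[ h^i(X,\mathcal{I}_{W\cup(2\widetilde{Z},H)}\otimes\mathcal{R})\le h^i(X,\mathcal{I}_{\operatorname{Res}_{H'}(W)\cup(2\widetilde{S},E)}\otimes\mathcal{R}(-H'))+h^i(H',\mathcal{I}_{\operatorname{Tr}_{H'}(W)\cup\widetilde{S},H'}\otimes\mathcal{R}_{|H'}). \]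
   Context: Varieties are defined over an algebraically closed field of characteristic $0$. For a variety $V$ and a regular point $p\in V$, $(2p,V)$ is the closed subscheme of $V$ with ideal sheaf $(\mathcal{I}_{p,V})^2$; for a finite set $S$ of regular points of $V$, $(2S,V):=\bigcup_{p\in S}(2p,V)$ (regarded as a subscheme of any ambient variety containing $V$). General means: in a suitable nonempty Zariski open subset of the parameter space. For an effective Cartier divisor $D$ of $X$ and a zero-dimensional scheme $W\subset X$, $\operatorname{Res}_D(W)$ is the closed subscheme of $X$ with ideal sheaf $\mathcal{I}_W:\mathcal{I}_D$, and $\operatorname{Tr}_D(W):=W\cap D$ (scheme-theoretic intersection). $\mathcal{R}(-H'):=\mathcal{R}\otimes\mathcal{O}_X(-H')$. *)

(* Defs.v *)
From HB Require Import structures.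
From mathcomp Require Import all_boot all_order all_algebra.
From mathcomp Require Import boolp classical_sets mpoly.

Set Implicit Arguments.
Unset Strict Implicit.
Unset Printing Implicit Defensive.

Import GRing.Theory.
Local Open Scope classical_set_scope.
Local Open Scope ring_scope.

(* A pair (X, R) with R very ample is a closed subscheme X of some P^n with
   R = O_X(1).  A closed subscheme of P^n = Proj S, S = k[x_0, ..., x_n], is
   given by a homogeneous ideal of S, not necessarily saturated; two ideals
   define the same subscheme iff they have the same saturation.  Sums,
   intersections, products and colons of homogeneous ideals induce the same
   operations on the ideal sheaves. *)

Section CommutativeAlgebra.
Variable R : comNzRingType.
Implicit Types A I J : set R.

(* A is a subring of R and I a subset of A. *)
Definition is_ideal A I : Prop :=
  [/\ I `<=` A, I 0, forall x y, I x -> I y -> I (x + y)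
    & forall a x, A a -> I x -> I (a * x)].

Definition is_prime A I : Prop :=
  [/\ is_ideal A I, ~ I 1
    & forall a b, A a -> A b -> I (a * b) -> I a \/ I b].

Definition prime_chain A I (d : nat) : Prop :=
  exists c : nat -> set R,
    (forall i, (i <= d)%N -> is_prime A (c i) /\ I `<=` c i) /\
    (forall i, (i < d)%N -> c i `<=` c i.+1 /\ c i <> c i.+1).

(* The quotient ring A / I has Krull dimension d. *)
Definition krull_dim A I (d : nat) : Prop :=
  prime_chain A I d /\ ~ prime_chain A I d.+1.

Definition idsum I J : set R :=
  [set x | exists a b, [/\ I a, J b & x = a + b]].

Definition idmul I J : set R :=
  [set x | exists (m : nat) (a b : 'I_m -> R),
     (forall i, I (a i) /\ J (b i)) /\ x = \sum_(i < m) a i * b i].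

Definition colon I J : set R := [set f | forall g, J g -> I (f * g)].

End CommutativeAlgebra.

Section ProjectiveSchemes.
Variables (k : closedFieldType) (n : nat).
Local Notation S := {mpoly k[n.+1]}.
Local Notation K := {fraction {mpoly k[n.+1]}}.
Implicit Types I J : set S.

Definition homog_ideal I : Prop :=
  is_ideal setT I /\ forall f d, I f -> I (pihomog mdeg d f).

Definition saturation I : set S :=
  [set f | exists m : nat, forall i : 'I_n.+1, I ('X_i ^+ m * f)].

Definition closed_sub IY IZ : Prop := saturation IY `<=` saturation IZ.

Definition same_scheme I J : Prop := saturation I = saturation J.

(* The empty scheme, whose saturated ideal is S, is not integral. *)
Definition integral_scheme I : Prop := is_prime setT (saturation I).

(* Closed points are given by nonzero vectors v of homogeneous coordinates. *)
Definition point_of I (v : 'I_n.+1 -> k) : Prop :=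
  (exists i, v i != 0) /\ forall f, I f -> f.@[v] = 0.

Definition same_point (v w : 'I_n.+1 -> k) : Prop :=
  exists c : k, c != 0 /\ forall i, v i = c * w i.

(* The homogeneous ideal of the point [v]: the polynomials vanishing on the
   whole line through v. *)
Definition point_ideal (v : 'I_n.+1 -> k) : set S :=
  [set f | forall t : k, f.@[fun i => t * v i] = 0].

(* The stalk at [v] of the ideal sheaf on P^n defined by J, as a subset of the
   fraction field of S. *)
Definition stalk J (v : 'I_n.+1 -> k) : set K :=
  [set x | exists (e : nat) (a b : S),
     [/\ J a, a \is e.-homog, b \is e.-homog, b.@[v] != 0
       & x = tofrac a / tofrac b]].

(* The local ring of P^n at [v].  For a point [v] of Y, the local ring of Y is
   the quotient of local_ring v by stalk IY v. *)
Definition local_ring (v : 'I_n.+1 -> k) : set K := stalk setT v.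

(* The local ring of Y at [v] is regular: its maximal ideal is generated by
   as many elements as its dimension. *)
Definition regular_at IY (v : 'I_n.+1 -> k) : Prop :=
  exists d : nat, krull_dim (local_ring v) (stalk IY v) d /\
  exists g : 'I_d -> K,
    (forall i, stalk (point_ideal v) v (g i)) /\
    (forall x, stalk (point_ideal v) v x ->
       exists (a : 'I_d -> K) (u : K),
         [/\ forall i, local_ring v (a i), stalk IY v u
           & x = \sum_(i < d) a i * g i + u]).

Definition cartier_divisor IX ID : Prop :=
  closed_sub IX ID /\
  forall v, point_of IX v ->
    exists g : K,
      [/\ local_ring v g,
          forall a, local_ring v a -> stalk IX v (g * a) -> stalk IX v a
        & stalk ID v = idsum [set g * a | a in local_ring v] (stalk IX v)].

(* The empty scheme is allowed. *)
Definition zero_dimensional I : Prop :=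
  forall v, point_of I v -> krull_dim (local_ring v) (stalk I v) 0.

(* Families of r points are given by the rows of r x (n+1) matrices. *)
Definition points_on r I (P : 'M[k]_(r, n.+1)) : Prop :=
  forall i, point_of I (P i).

Definition distinct_points r (P : 'M[k]_(r, n.+1)) : Prop :=
  forall i j, i != j -> ~ same_point (P i) (P j).

Definition disjoint_from r I (P : 'M[k]_(r, n.+1)) : Prop :=
  forall i, ~ point_of I (P i).

Definition simple_points r (P : 'M[k]_(r, n.+1)) : set S :=
  [set f | forall i, point_ideal (P i) f].

(* The union of the first infinitesimal neighbourhoods (2p, V); the ideal of
   (2p, V) in P^n is I_p^2 + I_V. *)
Definition double_points r IV (P : 'M[k]_(r, n.+1)) : set S :=
  [set f | forall i,
     idsum (idmul (point_ideal (P i)) (point_ideal (P i))) IV f].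

(* Zariski open subsets of (P^n)^m, as subsets of the space of m x (n+1)
   matrices stable under rescaling of the rows. *)
Definition zariski_open m (U : set 'M[k]_(m, n.+1)) : Prop :=
  (forall (c : 'rV[k]_m) M, (forall i, c 0 i != 0) -> U M ->
     U (diag_mx c *m M)) /\
  exists F : set {mpoly k[m * n.+1]},
    forall M, U M <-> exists f, F f /\ f.@[mxvec M 0] != 0.

(* Q holds for general (P1, P2) in the parameter space V1^r x V2^r. *)
Definition for_general r I1 I2
    (Q : 'M[k]_(r, n.+1) -> 'M[k]_(r, n.+1) -> Prop) : Prop :=
  exists U : set 'M[k]_(r + r, n.+1),
    [/\ zariski_open U,
        exists P1 P2, [/\ points_on I1 P1, points_on I2 P2 & U (col_mx P1 P2)]
      & forall P1 P2, points_on I1 P1 -> points_on I2 P2 ->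
          U (col_mx P1 P2) -> Q P1 P2].

(* Cohomology of the ideal sheaf I_{Z,Y} (1), where Z and Y are the subschemes
   of P^n defined by J and I, is Cech cohomology for the affine open cover of Y
   by the sets x_i != 0.  I_{Z,Y} is the sheaf associated with (J + I) / I.
   For an effective Cartier divisor D of Y with ideal ID, O_Y(-D) is the
   invertible ideal sheaf of D; hence the tensor product of I_{Z,Y} with
   O_Y(-D)(1) is the sheaf associated with the product ideal idmul J ID,
   twisted by 1. *)
Section Cech.
Variables I J : set S.

(* The sections of the sheaf J(1) on the open set x_(s 0) ... x_(s p) != 0. *)
Definition sections_on p (s : {ffun 'I_p.+1 -> 'I_n.+1}) J' : set K :=
  [set x | exists (e : nat) (a : S),
     [/\ J' a, a \is (1 + e * p.+1).-homog
       & x = tofrac a / tofrac (\prod_(j < p.+1) 'X_(s j)) ^+ e]].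

Definition cochain p : Type := {ffun {ffun 'I_p.+1 -> 'I_n.+1} -> K}.

Definition cech_diff p (c : cochain p) : cochain p.+1 :=
  [ffun s : {ffun 'I_p.+2 -> 'I_n.+1} =>
     \sum_(j < p.+2) (-1) ^+ j * c [ffun l => s (lift j l)]].

(* Cochains of the quotient sheaf (J + I) / I are represented by cochains of
   J + I, taken modulo those of I. *)
Definition cech_cocycle p : set (cochain p) :=
  [set c : cochain p | (forall s, sections_on s (idsum J I) (c s)) /\
                       (forall s, sections_on s I (cech_diff c s))].

Definition cech_coboundary p : set (cochain p) :=
  match p return set (cochain p) with
  | 0%N => [set c : cochain 0 | forall s, sections_on s I (c s)]
  | q.+1 => [set c : cochain q.+1 | exists b : cochain q,
               (forall s, sections_on s (idsum J I) (b s)) /\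
               (forall s, sections_on s I (c s - cech_diff b s))]
  end.

Definition lin_comb p m (a : 'I_m -> k) (v : 'I_m -> cochain p) : cochain p :=
  [ffun s => \sum_(i < m) tofrac (a i)%:MP * v i s].

(* The k-vector space of cocycles modulo coboundaries has dimension m. *)
Definition cech_has_dim p (m : nat) : Prop :=
  exists v : 'I_m -> cochain p,
    [/\ forall i, cech_cocycle (v i),
        forall z : cochain p, cech_cocycle z ->
          exists a, cech_coboundary (z - lin_comb a v)
      & forall a, cech_coboundary (lin_comb a v) -> forall i, a i = 0].

(* h^p(Y, I_{Z,Y} (1)), where None stands for an infinite dimension. *)
Definition h_ideal p : option nat :=
  if pselect (exists m, cech_has_dim p m) is left ex
  then Some (projT1 (cid ex)) else None.

End Cech.
End ProjectiveSchemes.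

Definition dim_add (a b : option nat) : option nat :=
  if (a, b) is (Some x, Some y) then Some (x + y)%N else None.

Definition dim_le (a b : option nat) : Prop :=
  match a, b with
  | _, None => True
  | None, Some _ => False
  | Some x, Some y => (x <= y)%N
  end.

(* Main.v *)
(* Let m be the dimension of the affine cone over E.  Let A be the sheaf of
   sections of I_W that vanish on H', and T the ideal sheaf of W in H' obtained
   by restriction, so that 0 -> A -> I_W -> T -> 0 is exact.  The inclusions of
   I_(W + 2Z), of I_(Res W + 2S)(-H') and of I_(Tr W + S) in I_W, A and T have
   skyscraper quotients of length <= r (m + 1), >= r m and >= r.  Comparing the
   cohomology sequences, both inequalities follow once the rank of H^0(I_W) on
   the double points 2Z is at least the rank of H^0(A) on the double points 2S,
   after division by the equation of H', plus the rank of H^0(I_W) on S.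

   The rank on 2Z is lower semicontinuous in Z, so it is enough to find one good
   Z in H^r, not necessarily of distinct points.  Through every point of S draw a
   formal arc in H, transverse to E, parametrized by t: the truncated exponential
   of a vector field theta tangent to H.  A section b of A is u g there, with u an
   equation of H', so its jets along the arcs are divisible by t, and the quotients
   specialize at t = 0 to the jets of g at S.  The relevant minor is therefore a
   power of t times a unit, and a minor that does not vanish on the arcs does not
   vanish at some point of H^r. *)
From HB Require Import structures.
Require Import Defs.
From mathcomp Require Import all_boot all_order all_algebra.
From mathcomp Require Import boolp classical_sets mpoly.
From mathcomp Require Import fraction ring_quotient ring zify.

Set Implicit Arguments.
Unset Strict Implicit.
Unset Printing Implicit Defensive.

Import Order.TTheory GRing.Theory.
Local Open Scope classical_set_scope.
Local Open Scope ring_scope.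

(** * Dimensions of subquotients *)

(** The count rests on two facts at a general point of $E$: the cone over $H$ has tangent space of
    dimension $m+1$ there, and an equation of $H'$ cuts it down to dimension $m$. Both come from
    counting derivations. Some $y$ in the ideal of $H'$ is outside that of $H$, so the function
    field of the cone over $H$ has one more independent derivation than a transcendence basis for
    the cone over $E$ has elements, while an equation of $H'$ cuts tangent spaces by at most one.
    Characteristic $0$ enters here through separability, then in the denominators $n!$ of the arcs,
    and in Euler's formula, which recovers a value from a gradient and so bounds the length at a
    point of $\widetilde{Z}$ by $m+1$ instead of $m+2$.

    The arcs lie on $H$ only modulo a power $t^M$. They are traded for points one factor at a time:
    with the other arcs frozen, the minor is a polynomial in $t$ whose coefficients are functions on
    the cone over $H$, and one of the first $M$ coefficients is not identically zero. *)

Section Subquotient.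
Variables (k : fieldType) (V : lmodType k).
Implicit Types (Z B C : set V).

Definition subsp B : Prop :=
  B 0 /\ forall a x y, B x -> B y -> B (a *: x + y).

Definition indep B m (v : 'I_m -> V) : Prop :=
  forall a : 'I_m -> k, B (\sum_i a i *: v i) -> forall i, a i = 0.

(* No inclusion of B in Z is required: this is the dimension of Z / (Z & B). *)
Definition has_qdim Z B (m : nat) : Prop :=
  exists v : 'I_m -> V,
    [/\ forall i, Z (v i),
        forall z, Z z -> exists a : 'I_m -> k, B (z - \sum_i a i *: v i)
      & indep B v].

Lemma subsp_add B x y : subsp B -> B x -> B y -> B (x + y).
Proof. by move=> [_ h] Bx By; have := h 1 _ _ Bx By; rewrite scale1r. Qed.

Lemma subsp_scale B a x : subsp B -> B x -> B (a *: x).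
Proof. by move=> [h0 h] Bx; have := h a _ _ Bx h0; rewrite addr0. Qed.

Lemma subsp_opp B x : subsp B -> B x -> B (- x).
Proof. by move=> sB Bx; rewrite -scaleN1r; apply: subsp_scale. Qed.

Lemma subsp_sub B x y : subsp B -> B x -> B y -> B (x - y).
Proof. by move=> sB Bx By; apply: subsp_add => //; apply: subsp_opp. Qed.

Lemma subsp_sum B m (F : 'I_m -> V) :
  subsp B -> (forall i, B (F i)) -> B (\sum_i F i).
Proof.
by move=> sB h; apply: big_ind => //; [case: sB | move=> *; apply: subsp_add].
Qed.

Lemma subsp_lc B m (a : 'I_m -> k) (v : 'I_m -> V) :
  subsp B -> (forall i, B (v i)) -> B (\sum_i a i *: v i).
Proof. by move=> sB h; apply: subsp_sum => // i; apply: subsp_scale. Qed.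

Lemma subspI B C : subsp B -> subsp C -> subsp (B `&` C).
Proof.
move=> [b0 b] [c0 c]; split=> // a x y [? ?] [? ?].
by split; [apply: b | apply: c].
Qed.

Definition subspD B C : set V := [set x | exists b c, [/\ B b, C c & x = b + c]].

Lemma subsp_subspD B C : subsp B -> subsp C -> subsp (subspD B C).
Proof.
move=> sB sC; split.
  by exists 0, 0; case: sB => ? _; case: sC => ? _; rewrite addr0.
move=> a x y [b [c [Bb Cc ->]]] [b' [c' [Bb' Cc' ->]]].
exists (a *: b + b'), (a *: c + c'); split.
- by case: sB => _; apply.
- by case: sC => _; apply.
- by rewrite scalerDr addrACA.
Qed.

(** If [n < m], the coefficient matrix has a nonzero left kernel vector, and the corresponding
    combination of the [v i] falls into [B]. *)
Lemma steinitz B m n (v : 'I_m -> V) (w : 'I_n -> V) :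
  subsp B -> (forall i, exists a : 'I_n -> k, B (v i - \sum_j a j *: w j)) ->
  indep B v -> (m <= n)%N.
Proof.
move=> sB span vI; rewrite leqNgt; apply/negP => lt_nm.
have [A AP] := choice span.
pose M : 'M[k]_(m, n) := \matrix_(i, j) A i j.
have : kermx M != 0.
  rewrite -mxrank_eq0 mxrank_ker subn_eq0 -ltnNge.
  exact: leq_ltn_trans (rank_leq_col M) lt_nm.
case/rowV0Pn => u /sub_kermxP uM u0.
have Bu : B (\sum_i u 0 i *: v i).
  have -> : \sum_i u 0 i *: v i
          = \sum_i u 0 i *: (v i - \sum_j A i j *: w j).
    rewrite -[LHS]subr0; symmetry; under eq_bigr do rewrite scalerBr.
    rewrite sumrB; congr (_ - _).
    under eq_bigr do rewrite scaler_sumr; rewrite exchange_big big1 // => j _.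
    under eq_bigr do rewrite scalerA; rewrite -scaler_suml.
    have := congr1 (fun X : 'rV_n => X 0 j) uM; rewrite !mxE => h.
    suff -> : \sum_i u 0 i * A i j = 0 by rewrite scale0r.
    by rewrite -[RHS]h; apply: eq_bigr => i _; rewrite mxE.
  exact: subsp_lc.
by case/eqP: u0; apply/rowP => i; rewrite mxE (vI _ Bu).
Qed.

Lemma indepS B C m (v : 'I_m -> V) : B `<=` C -> indep C v -> indep B v.
Proof. by move=> BC vI a Ba; apply: vI; apply: BC. Qed.

Lemma qdim_uniq Z B m n : subsp B -> has_qdim Z B m -> has_qdim Z B n -> m = n.
Proof.
move=> sB [v [vZ vS vI]] [w [wZ wS wI]]; apply/eqP; rewrite eqn_leq.
apply/andP; split.
- by apply: (steinitz sB _ vI) => i; apply: wS.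
- by apply: (steinitz sB _ wI) => i; apply: vS.
Qed.

Lemma qdim_indep Z B m n (v : 'I_m -> V) : subsp B ->
  (forall i, Z (v i)) -> indep B v -> has_qdim Z B n -> (m <= n)%N.
Proof.
move=> sB vZ vI [w [wZ wS wI]].
by apply: (steinitz sB _ vI) => i; apply: wS.
Qed.

Lemma indep_extend B m (v : 'I_m -> V) z : subsp B -> indep B v ->
  (forall a : 'I_m -> k, ~ B (z - \sum_i a i *: v i)) ->
  indep B (fun i : 'I_m.+1 => if unlift ord_max i is Some j then v j else z).
Proof.
move=> sB vI nz a; rewrite big_ord_recr /= unlift_none.
under eq_bigr => i _.
  rewrite (_ : widen_ord _ _ = lift ord_max i); last first.
    by apply/val_inj; rewrite /= /bump leqNgt ltn_ord.
  rewrite liftK; over.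
move=> Ba; have a0 : a ord_max = 0.
  apply/eqP; apply/negP => /negP an0.
  apply: (nz (fun i => - ((a ord_max)^-1 * a (lift ord_max i)))).
  have := subsp_scale (a ord_max)^-1 sB Ba.
  rewrite scalerDr scalerA mulVf // scale1r addrC scaler_sumr -sumrN.
  congr (B (_ + _)); apply: eq_bigr => i _.
  by rewrite scalerA scaleNr opprK.
move: Ba; rewrite a0 scale0r addr0 => /vI h i.
by case: (unliftP ord_max i) => [j ->|->].
Qed.

(** A longest independent family spans. This is the basic source of finiteness below. *)
Lemma qdim_exists Z B N : subsp B ->
  (forall m (v : 'I_m -> V), (forall i, Z (v i)) -> indep B v -> (m <= N)%N) ->
  exists2 m, (m <= N)%N & has_qdim Z B m.
Proof.
move=> sB bnd.
pose P m := `[< exists v : 'I_m -> V, (forall i, Z (v i)) /\ indep B v >].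
have exP : exists m, P m.
  by exists 0%N; apply/asboolP; exists (fun=> 0); split=> [[]|? ? []].
have bP m : P m -> (m <= N)%N by move=> /asboolP [v [? ?]]; apply: (bnd m v).
case: (ex_maxnP exP bP) => m /asboolP [v [vZ vI]] mmax.
exists m; first exact: (bnd m v).
exists v; split=> // z Zz; apply: contrapT => nz.
have : P m.+1.
  apply/asboolP; eexists; split; last first.
    apply: (indep_extend sB vI) => a Ba; apply: nz; exists a; exact: Ba.
  by move=> i /=; case: (unlift ord_max i).
by move=> /mmax; rewrite ltnn.
Qed.

Lemma qdim_sub Z Z' B n : subsp B -> Z' `<=` Z -> has_qdim Z B n ->
  exists2 m, (m <= n)%N & has_qdim Z' B m.
Proof.
move=> sB sZ qZ; apply: qdim_exists => // m v vZ vI.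
by apply: (qdim_indep sB _ vI qZ) => i; apply: sZ.
Qed.

Lemma qdim_subr Z B C n : subsp B -> subsp C -> B `<=` C -> has_qdim Z B n ->
  exists2 m, (m <= n)%N & has_qdim Z C m.
Proof.
move=> sB sC BC qZ; apply: qdim_exists => // m v vZ vI.
by apply: (qdim_indep sB vZ _ qZ); apply: indepS vI.
Qed.

Lemma qdim_chain Z C B m n : subsp C -> subsp B ->
  B `<=` C -> C `<=` Z -> has_qdim Z C m -> has_qdim C B n ->
  has_qdim Z B (m + n).
Proof.
move=> sC sB BC CZ [v [vZ vS vI]] [w [wZ wS wI]].
exists (fun i => match split i with inl i => v i | inr j => w j end); split.
- by move=> i; case: split => j //; apply: CZ.
- move=> z Zz; have [a Ca] := vS _ Zz; have [b Bb] := wS _ Ca.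
  exists (fun i => match split i with inl i => a i | inr j => b j end).
  rewrite big_split_ord /= opprD addrA; move: Bb; congr (B (_ - _ - _)).
  + by apply: eq_bigr => i _; rewrite (unsplitK (inl i)).
  + by apply: eq_bigr => i _; rewrite (unsplitK (inr i)).
- move=> a; rewrite big_split_ord /=.
  under eq_bigr do rewrite (unsplitK (inl _)).
  under [X in _ + X]eq_bigr do rewrite (unsplitK (inr _)).
  move=> Ba; have a0 : forall i, a (lshift n i) = 0.
    apply: vI; have := BC _ Ba => Ca.
    rewrite -[X in C X](addrK (\sum_i a (rshift m i) *: w i)).
    by apply: subsp_sub => //; apply: subsp_lc.
  move: Ba; under eq_bigr do rewrite a0 scale0r.
  rewrite big1 // add0r => /wI b0 i.
  by case: (splitP i) => j jE; [rewrite -(a0 j) | rewrite -(b0 j)];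
     congr a; apply/val_inj.
Qed.

(** Finiteness of both layers is part of the conclusion, so additivity can be read from the whole
    down to the pieces of an exact sequence. *)
Lemma qdim_split Z C B n : subsp C -> subsp B ->
  B `<=` C -> C `<=` Z -> has_qdim Z B n ->
  exists m1 m2, [/\ n = (m1 + m2)%N, has_qdim Z C m1 & has_qdim C B m2].
Proof.
move=> sC sB BC CZ qZ.
have [m1 _ q1] := qdim_subr sB sC BC qZ.
have [m2 _ q2] := qdim_sub sB CZ qZ.
exists m1, m2; split=> //; apply: (qdim_uniq sB qZ).
exact: qdim_chain q1 q2.
Qed.

Lemma eq_qdim Z Z' B n : subsp B ->
  (forall z, Z z -> exists2 z', Z' z' & B (z - z')) ->
  (forall z', Z' z' -> exists2 z, Z z & B (z - z')) ->
  has_qdim Z B n -> has_qdim Z' B n.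
Proof.
move=> sB h1 h2 [v [vZ vS vI]].
have /choice[w wP] : forall i, exists w, Z' w /\ B (v i - w).
  by move=> i; have [z' ? ?] := h1 _ (vZ i); exists z'.
have Blc (a : 'I_n -> k) : B (\sum_i a i *: v i - \sum_i a i *: w i).
  rewrite -sumrB; under eq_bigr do rewrite -scalerBr.
  by apply: subsp_lc => // i; apply: (wP i).2.
exists w; split=> [i|z' Z'z'|a Ba]; first exact: (wP i).1.
- have [z Zz Bz] := h2 _ Z'z'; have [a Ba] := vS _ Zz; exists a.
  have := subsp_sub sB (subsp_add sB Ba (Blc a)) Bz.
  by congr (B _); rewrite addrA subrK opprB [LHS]addrC [LHS]addrA subrK.
- by apply: vI; rewrite -[X in B X](subrK (\sum_i a i *: w i)); apply: subsp_add.
Qed.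
End Subquotient.

(** The isomorphism of subquotients is a linear relation [G] and not a function, so that connecting
    homomorphisms, which depend on lifts, need no normalisation. *)
Lemma qdim_corr (k : fieldType) (V V' : lmodType k) (Z B : set V)
    (Z' B' : set V') (G : V -> V' -> Prop) n :
  subsp B -> subsp B' ->
  G 0 0 ->
  (forall a x x' y y', G x x' -> G y y' -> G (a *: x + y) (a *: x' + y')) ->
  (forall z, Z z -> exists2 z', Z' z' & G z z') ->
  (forall z', Z' z' -> exists2 z, Z z & G z z') ->
  (forall z z', G z z' -> B z <-> B' z') ->
  has_qdim Z B n -> has_qdim Z' B' n.
Proof.
move=> sB sB' G0 Glin h1 h2 GB [v [vZ vS vI]].
have /choice[w wP] : forall i, exists w, Z' w /\ G (v i) w.
  by move=> i; have [z' ? ?] := h1 _ (vZ i); exists z'.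
have Glc (a : 'I_n -> k) : G (\sum_i a i *: v i) (\sum_i a i *: w i).
  by apply: (big_rec2 G) => // i x x' _; apply: Glin; apply: (wP i).2.
exists w; split=> [i|z' Z'z'|a Ba]; first exact: (wP i).1.
- have [z Zz Gz] := h2 _ Z'z'; have [a Ba] := vS _ Zz; exists a.
  suff /GB <- : G (z - \sum_i a i *: v i) (z' - \sum_i a i *: w i) by [].
  have := Glin (-1) _ _ _ _ (Glc a) Gz.
  by rewrite !scaleN1r ![- _ + _]addrC.
- by apply: vI; apply: (GB _ _ (Glc a)).2.
Qed.

(** * Simple ring extensions: homomorphisms and derivations *)

Section SimpleExtension.
Variable L : fieldType.
Implicit Types (A : set L) (p q r : {poly L}).

Definition subring A : Prop :=
  [/\ A 1, forall x y, A x -> A y -> A (x - y)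
    & forall x y, A x -> A y -> A (x * y)].

Definition poly_in A p : Prop := forall i, A p`_i.

Definition adjoin A (w : L) : set L := [set x | exists2 p, poly_in A p & x = p.[w]].

Definition transcendental A (w : L) : Prop :=
  forall p, poly_in A p -> p.[w] = 0 -> p = 0.

Variables (A : set L) (w : L).
Hypothesis sA : subring A.

Lemma subring0 : A 0.
Proof. by case: sA => A1 AB _; rewrite -(subrr 1); apply: AB. Qed.

Lemma subringN x : A x -> A (- x).
Proof. by case: sA => _ AB _ Ax; rewrite -sub0r; apply: AB => //; apply: subring0. Qed.

Lemma subringD x y : A x -> A y -> A (x + y).
Proof.
by case: sA => _ AB _ Ax Ay; rewrite -[y]opprK; apply: AB => //; apply: subringN.
Qed.

Lemma subring_sum (I : Type) (s : seq I) (P : pred I) (F : I -> L) :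
  (forall i, P i -> A (F i)) -> A (\sum_(i <- s | P i) F i).
Proof. by move=> h; apply: big_ind => //; [apply: subring0 | apply: subringD]. Qed.

Lemma poly_inC c : A c -> poly_in A c%:P.
Proof. by move=> Ac i; rewrite coefC; case: eqP => // _; apply: subring0. Qed.

Lemma poly_inB p q : poly_in A p -> poly_in A q -> poly_in A (p - q).
Proof. by case: sA => _ AB _ hp hq i; rewrite coefB; apply: AB. Qed.

Lemma poly_inD p q : poly_in A p -> poly_in A q -> poly_in A (p + q).
Proof. by move=> hp hq i; rewrite coefD; apply: subringD. Qed.

Lemma poly_inM p q : poly_in A p -> poly_in A q -> poly_in A (p * q).
Proof.
by case: sA => _ _ AM hp hq i; rewrite coefM; apply: subring_sum => j _; apply: AM.
Qed.

Lemma poly_inXn n : poly_in A 'X^n.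
Proof. by move=> i; rewrite coefXn; case: eqP => _; [case: sA | apply: subring0]. Qed.

Lemma poly_inX : poly_in A 'X.
Proof. exact: (poly_inXn 1). Qed.

Lemma poly_inZ c p : A c -> poly_in A p -> poly_in A (c *: p).
Proof. by move=> Ac hp; rewrite -mul_polyC; apply: poly_inM => //; apply: poly_inC. Qed.

Lemma adjoin_subring : subring (adjoin A w).
Proof.
split.
- by exists 1; [apply: (poly_inXn 0) | rewrite hornerC].
- by move=> _ _ [p hp ->] [q hq ->]; exists (p - q); [apply: poly_inB | rewrite hornerD hornerN].
- by move=> _ _ [p hp ->] [q hq ->]; exists (p * q); [apply: poly_inM | rewrite hornerM].
Qed.

Lemma sub_adjoin : A `<=` adjoin A w.
Proof. by move=> x Ax; exists x%:P; [apply: poly_inC | rewrite hornerC]. Qed.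

Lemma mem_adjoin : adjoin A w w.
Proof. by exists 'X; [apply: poly_inX | rewrite hornerX]. Qed.

(** The subring [A] need not be a field; multiplying by a power of the leading coefficient keeps all
    coefficients in [A]. *)
Lemma pseudo_division r p : r != 0 -> poly_in A r -> poly_in A p ->
  exists n q s, [/\ poly_in A q, poly_in A s,
    lead_coef r ^+ n *: p = q * r + s & (size s < size r)%N].
Proof.
move=> r0 hr; have [n] := ubnP (size p); elim: n p => // n IH p lt_pn hp.
have [A1 _ AM] := sA.
have [lt_pr|le_rp] := ltnP (size p) (size r).
  exists 0%N, 0, p; rewrite scale1r mul0r add0r; split=> //.
  exact/poly_inC/subring0.
pose d := (size p - size r)%N.
pose p1 := lead_coef r *: p - (lead_coef p *: 'X^d) * r.
have hX : poly_in A (lead_coef p *: 'X^d) by apply: poly_inZ; [apply: hp | apply: poly_inXn].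
have hp1 : poly_in A p1.
  by apply: poly_inB; [apply: poly_inZ => //; apply: hr | apply: poly_inM].
have lt_p1p : (size p1 < size p)%N.
  have p_gt0 : (0 < size p)%N by apply: leq_trans le_rp; rewrite lt0n size_poly_eq0.
  rewrite -(prednK p_gt0) ltnS; apply/leq_sizeP => j.
  rewrite leq_eqVlt => /predU1P[<-|lt_j].
    rewrite coefB coefZ -scalerAl coefZ mulrC coefXnM.
    have -> : ((size p).-1 < d)%N = false.
      by rewrite /d; move: r0; rewrite -size_poly_gt0; lia.
    have -> : ((size p).-1 - d)%N = (size r).-1.
      by rewrite /d; move: r0; rewrite -size_poly_gt0; lia.
    by rewrite -!lead_coefE mulrC subrr.
  rewrite coefB coefZ -scalerAl coefZ coefXnM.
  have -> : p`_j = 0 by apply: nth_default; rewrite -(prednK p_gt0).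
  case: ltnP => _; rewrite ?mulr0 ?subr0 // nth_default ?mulr0 ?subr0 //.
  by rewrite /d; move: lt_j le_rp; move: (size p) (size r) => a b; lia.
have [|m [q [s [hq hs E lt_s]]]] := IH p1 _ hp1.
  by rewrite -ltnS; apply: leq_ltn_trans lt_pn; apply: lt_p1p.
have Ac : A (lead_coef r ^+ m).
  by elim: m {E} => // m IHm; rewrite exprS; apply: AM => //; apply: hr.
exists m.+1, (q + lead_coef r ^+ m *: (lead_coef p *: 'X^d)), s; split=> //.
- by apply: poly_inD => //; apply: poly_inZ.
- rewrite mulrDl -addrA addrCA -E /p1 scalerBr exprSr.
  set u := _ *: 'X^d; set c := _ ^+ m.
  by rewrite -[c *: u * r]scalerAl [c *: (_ *: p)]scalerA addrC subrK.
Qed.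

(** A nonzero relation of least degree plays the role of a minimal polynomial; it need not be
    monic. *)
Lemma algebraic_min_poly : ~ transcendental A w ->
  exists r, [/\ r != 0, poly_in A r, r.[w] = 0
    & forall q, poly_in A q -> q.[w] = 0 -> (size q < size r)%N -> q = 0].
Proof.
move=> /existsNP[p /not_implyP[hp /not_implyP[pw /eqP p0]]].
pose P n := `[< exists r, [/\ r != 0, poly_in A r, r.[w] = 0 & size r = n] >].
have exP : exists n, P n by exists (size p); apply/asboolP; exists p.
case: (ex_minnP exP) => n /asboolP[r [r0 hr rw <-]] rmin.
exists r; split=> // q hq qw lt_qr; apply/eqP; apply: contraTT lt_qr => q0.
by rewrite -leqNgt; apply: rmin; apply/asboolP; exists q.
Qed.

Lemma min_poly_multiple r p : r != 0 -> poly_in A r -> r.[w] = 0 ->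
  (forall q, poly_in A q -> q.[w] = 0 -> (size q < size r)%N -> q = 0) ->
  poly_in A p -> p.[w] = 0 ->
  exists n q, poly_in A q /\ lead_coef r ^+ n *: p = q * r.
Proof.
move=> r0 hr rw rmin hp pw.
have [n [q [s [hq hs E lt_s]]]] := pseudo_division r0 hr hp.
exists n, q; split=> //; rewrite E (rmin s) ?addr0 //.
have := congr1 (horner^~ w) E.
by rewrite /= hornerZ hornerD hornerM pw rw !mulr0 add0r => <-.
Qed.

End SimpleExtension.

Section ExtendHom.
Variables (L : fieldType) (k : closedFieldType).

Definition ring_hom_on (A : set L) (phi : L -> k) : Prop :=
  [/\ phi 1 = 1, forall x y, A x -> A y -> phi (x - y) = phi x - phi y
    & forall x y, A x -> A y -> phi (x * y) = phi x * phi y].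

Variables (A : set L) (w : L) (phi : L -> k).
Hypotheses (sA : subring A) (hphi : ring_hom_on A phi).

Lemma ring_hom_on0 : phi 0 = 0.
Proof.
have [_ hB _] := hphi; have A0 := subring0 sA.
by rewrite -(subrr 0) hB // subrr.
Qed.

Lemma ring_hom_onD x y : A x -> A y -> phi (x + y) = phi x + phi y.
Proof.
have [_ hB _] := hphi => Ax Ay; have A0 := subring0 sA.
have An := subringN sA Ay.
by rewrite -[y in LHS]opprK hB // -[- y]sub0r hB // ring_hom_on0 sub0r opprK.
Qed.

Lemma ring_hom_on_sum (I : Type) (s : seq I) (F : I -> L) :
  (forall i, A (F i)) -> phi (\sum_(i <- s) F i) = \sum_(i <- s) phi (F i).
Proof.
move=> AF; elim: s => [|i s IH]; first by rewrite !big_nil ring_hom_on0.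
by rewrite !big_cons ring_hom_onD ?IH //; apply: subring_sum.
Qed.

Lemma coef_hom p i : (map_poly phi p)`_i = phi p`_i.
Proof. by rewrite coef_map_id0 // ring_hom_on0. Qed.

Lemma map_hom_polyC c : map_poly phi c%:P = (phi c)%:P.
Proof. by apply/polyP => i; rewrite coef_hom !coefC; case: eqP; rewrite ?ring_hom_on0. Qed.

Lemma map_hom_poly_sub p q : poly_in A p -> poly_in A q ->
  map_poly phi (p - q) = map_poly phi p - map_poly phi q.
Proof.
move=> hp hq; apply/polyP => i; have [_ hB _] := hphi.
by rewrite coefB !coef_hom coefB hB.
Qed.

Lemma map_hom_poly_mul p q : poly_in A p -> poly_in A q ->
  map_poly phi (p * q) = map_poly phi p * map_poly phi q.
Proof.
move=> hp hq; apply/polyP => i; have [_ _ hM] := hphi; have [_ _ AM] := sA.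
rewrite coef_hom !coefM ring_hom_on_sum; last by move=> j; apply: AM.
by apply: eq_bigr => j _; rewrite hM // !coef_hom.
Qed.

(** The value at [p.[w]] is that of the image of [p] at [xi]; the hypothesis makes it independent of
    [p]. *)
Lemma hom_extend_at (xi : k) :
  (forall p, poly_in A p -> p.[w] = 0 -> (map_poly phi p).[xi] = 0) ->
  exists psi, [/\ ring_hom_on (adjoin A w) psi, forall x, A x -> psi x = phi x
    & forall p, poly_in A p -> psi p.[w] = (map_poly phi p).[xi]].
Proof.
move=> h0; pose F x (y : k) := exists2 p, poly_in A p & x = p.[w] /\ y = (map_poly phi p).[xi].
pose psi x := if pselect (exists y, F x y) is left ex then projT1 (cid ex) else 0.
have psiE p : poly_in A p -> psi p.[w] = (map_poly phi p).[xi].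
  move=> hp; rewrite /psi; case: pselect => [ex|[]]; last by exists (map_poly phi p).[xi], p.
  case: cid => y Fy /=; case: Fy => q hq [E ->]; apply/eqP; rewrite eq_sym -subr_eq0.
  rewrite -hornerN -hornerD -map_hom_poly_sub // h0 //; first exact: poly_inB.
  by rewrite hornerD hornerN E subrr.
have [phi1 hB hM] := hphi.
have psiA x : A x -> psi x = phi x.
  move=> Ax; rewrite -[x in LHS](hornerC x w) psiE; last exact: poly_inC.
  by rewrite map_hom_polyC hornerC.
exists psi; split=> //; split.
- by rewrite psiA //; case: sA.
- move=> _ _ [p hp ->] [q hq ->]; rewrite -hornerN -hornerD !psiE ?map_hom_poly_sub //.
  + by rewrite hornerD hornerN.
  + exact: poly_inB.
- move=> _ _ [p hp ->] [q hq ->]; rewrite -hornerM !psiE ?map_hom_poly_mul //.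
  + by rewrite hornerM.
  + exact: poly_inM.
Qed.

End ExtendHom.

(* The value at b survives when phi does not kill a nonzero multiple of b that
   lies in A, nor the leading coefficient of the minimal polynomial of w. *)
Lemma hom_extend (L : fieldType) (k : closedFieldType) (A : set L) w b :
  subring A -> adjoin A w b -> b != 0 ->
  exists a, [/\ A a, a != 0 & forall phi : L -> k,
    ring_hom_on A phi -> phi a != 0 -> exists psi, [/\ ring_hom_on (adjoin A w) psi,
      forall x, A x -> psi x = phi x & psi b != 0]].
Proof.
move=> sA [p hp ->] pw0; have [A1 AB AM] := sA.
(* Transcendental case: any [xi] outside the roots of the image of [p] serves, and [a] only has to
   keep this image nonzero. *)
case: (pselect (transcendental A w)) => [tr|/algebraic_min_poly].
  have p0 : p != 0 by apply: contraNneq pw0 => ->; rewrite horner0.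
  exists (lead_coef p); split; [exact: hp | by rewrite lead_coef_eq0 | move=> phi hphi lp].
  have q0 : map_poly phi p != 0.
    by apply: contraNneq lp => q0; rewrite lead_coefE -(coef_hom sA hphi) q0 coef0.
  have [xi xiP] := closed_nonrootP _ q0.
  have [psi [h1 h2 h3]] : exists psi, [/\ ring_hom_on (adjoin A w) psi,
    forall x, A x -> psi x = phi x
    & forall p, poly_in A p -> psi p.[w] = (map_poly phi p).[xi]].
    apply: (hom_extend_at sA hphi) => q hq /(tr q hq) ->.
    by rewrite (map_hom_polyC sA hphi) (ring_hom_on0 sA hphi) horner0.
  by exists psi; split=> //; rewrite h3.
case=> r [r0 hr rw rmin].
(* [Q n]: some multiple of [p.[w]] in [adjoin A w] is the value at [w] of a nonzero polynomial of
   size [n]. Size $1$ means a nonzero multiple lying in [A]. *)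
pose Q n := `[< exists t, [/\ t != 0, poly_in A t, size t = n &
                 exists2 y, adjoin A w y & t.[w] = p.[w] * y] >].
have small : exists2 n, (n < size r)%N & Q n.
  have [n [q [s [hq hs E lt_s]]]] := pseudo_division sA r0 hr hp.
  have := congr1 (horner^~ w) E; rewrite /= hornerZ hornerD hornerM rw mulr0 add0r => Ew.
  exists (size s) => //; apply/asboolP; exists s; split=> //.
    apply: contraNneq pw0 => s0; move: Ew; rewrite s0 horner0 => /eqP.
    by rewrite mulf_eq0 expf_eq0 lead_coef_eq0 (negPf r0) andbF.
  exists (lead_coef r ^+ n); last by rewrite -Ew mulrC.
  apply: sub_adjoin => //; elim: n {E Ew} => // n IHn.
  by rewrite exprS; apply: AM => //; apply: hr.
have exQ : exists n, Q n by case: small => n _; exists n.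
case: (ex_minnP exQ) => m /asboolP[t [t0 ht tm [y By ty]]] mmin.
have [lt1m|le_m1] := ltnP 1 m; last first.
  have [a ta] : exists a, t = a%:P by exists t`_0; apply: size1_polyC; rewrite tm.
  have a0 : a != 0 by apply: contraNneq t0 => a0; rewrite ta a0.
  have Aa : A a by have := ht 0%N; rewrite ta coefC.
  (* Since [phi] does not kill [lead_coef r], the image of [r] keeps its degree and has a root, and
     every relation of [w] still holds at that root. *)
  exists (lead_coef r * a); split.
  - by apply: AM => //; apply: hr.
  - by rewrite mulf_neq0 // lead_coef_eq0.
  move=> phi hphi; have [phi1 hB hM] := hphi; rewrite hM //; last exact: hr.
  rewrite mulf_eq0 negb_or => /andP[lr pa].
  have szr : size (map_poly phi r) = size r.
    by rewrite [LHS]size_poly_eq //.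
  have [xi /eqP xiP] : exists xi, root (map_poly phi r) xi.
    apply/closed_rootP; rewrite szr; apply/negP => /eqP/eqP/size_poly1P[c c0 rc].
    by case/eqP: c0; move: rw; rewrite rc hornerC.
  have [psi [h1 h2 h3]] : exists psi, [/\ ring_hom_on (adjoin A w) psi,
    forall x, A x -> psi x = phi x
    & forall p, poly_in A p -> psi p.[w] = (map_poly phi p).[xi]].
    apply: (hom_extend_at sA hphi) => q hq qw.
    have [n [u [hu E]]] := min_poly_multiple sA r0 hr rw rmin hq qw.
    have := congr1 (fun p => (map_poly phi p).[xi]) E.
    have hl : A (lead_coef r) by apply: hr.
    have hln j : A (lead_coef r ^+ j) /\ phi (lead_coef r ^+ j) = phi (lead_coef r) ^+ j.
      elim: j => [|j [Aj Ej]]; first by rewrite !expr0.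
      rewrite !exprS; split; first exact: AM.
      by rewrite hM // Ej.
    rewrite -mul_polyC !(map_hom_poly_mul sA hphi) //; last by apply: poly_inC => //; case: (hln n).
    rewrite !hornerM (map_hom_polyC sA hphi) hornerC xiP mulr0 (hln n).2 => /eqP.
    by rewrite mulf_eq0 expf_eq0 (negPf lr) andbF => /eqP.
  exists psi; split=> //; have [_ _ hM'] := h1.
  have Ba : adjoin A w p.[w] by exists p.
  apply: contraNneq pa; move: ty; rewrite ta hornerC -h2 // => -> pz.
  by rewrite hM' // pz mul0r.
(* A minimal [t] of positive degree would divide [r] up to a constant of [A], as the remainder again
   satisfies [Q]; the quotient then kills [w] and is shorter than [r]. *)
exfalso; have t0' : t.[w] != 0.
  apply: contraNneq t0 => tw; apply/eqP/rmin => //; rewrite tm.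
  by case: small => n lt_nr /mmin le_mn; apply: leq_ltn_trans lt_nr.
have [n [q [s [hq hs E lt_s]]]] := pseudo_division sA t0 ht hr.
have s0 : s = 0.
  apply/eqP; apply: contraTT lt_s => s0; rewrite -leqNgt tm; apply: mmin.
  apply/asboolP; exists s; split=> //; exists (- (q.[w] * y)).
    have [_ _ M'] := adjoin_subring w sA; apply: subringN; first exact: adjoin_subring.
    by apply: M' => //; exists q.
  have := congr1 (horner^~ w) E; rewrite /= hornerZ hornerD hornerM rw mulr0 => /esym/eqP.
  by rewrite addrC addr_eq0 => /eqP ->; rewrite ty mulrN mulrCA.
rewrite s0 addr0 in E.
have lt0 : lead_coef t ^+ n != 0 by rewrite expf_neq0 // lead_coef_eq0.
have q0 : q != 0.
  by apply: contraNneq r0 => q0; have := E; rewrite q0 mul0r => /eqP; rewrite scaler_eq0 (negPf lt0).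
have szq : (size q < size r)%N.
  have := congr1 (fun p : {poly L} => size p) E; rewrite /= size_scale // size_mul // tm => ->.
  by move: q0 lt1m; rewrite -size_poly_gt0; move: (size q) => x; lia.
case/eqP: q0; apply: rmin => //; have := congr1 (horner^~ w) E.
rewrite /= hornerZ hornerM rw mulr0 => /esym/eqP.
by rewrite mulf_eq0 (negPf t0') orbF => /eqP.
Qed.

Section ExtendDerivation.
Variables (L : fieldType).

Definition derivation_on (A : set L) (d : L -> L) : Prop :=
  (forall x y, A x -> A y -> d (x + y) = d x + d y) /\
  (forall x y, A x -> A y -> d (x * y) = d x * y + x * d y).

Variables (A : set L) (w : L) (d : L -> L).
Hypotheses (sA : subring A) (hd : derivation_on A d).

Lemma derivation_on0 : d 0 = 0.
Proof.
have A0 := subring0 sA; have [dD _] := hd.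
by have /eqP := dD 0 0 A0 A0; rewrite addr0 eq_sym -subr_eq0 addrK => /eqP.
Qed.

Lemma derivation_on_sum (I : Type) (s : seq I) (F : I -> L) :
  (forall i, A (F i)) -> d (\sum_(i <- s) F i) = \sum_(i <- s) d (F i).
Proof.
have [dD _] := hd => AF; elim: s => [|i s IH]; first by rewrite !big_nil derivation_on0.
by rewrite !big_cons dD ?IH //; apply: subring_sum.
Qed.

Lemma coef_der p i : (map_poly d p)`_i = d p`_i.
Proof. by rewrite coef_map_id0 // derivation_on0. Qed.

Lemma map_der_polyC c : map_poly d c%:P = (d c)%:P.
Proof. by apply/polyP => i; rewrite coef_der !coefC; case: eqP; rewrite ?derivation_on0. Qed.

Lemma map_der_poly_add p q : poly_in A p -> poly_in A q ->
  map_poly d (p + q) = map_poly d p + map_poly d q.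
Proof.
by move=> hp hq; apply/polyP => i; have [dD _] := hd; rewrite coefD !coef_der coefD dD.
Qed.

Lemma map_der_poly_mul p q : poly_in A p -> poly_in A q ->
  map_poly d (p * q) = map_poly d p * q + p * map_poly d q.
Proof.
move=> hp hq; apply/polyP => i; have [_ dM] := hd; have [_ _ AM] := sA.
rewrite coef_der coefD !coefM derivation_on_sum; last by move=> j; apply: AM.
by rewrite -big_split; apply: eq_bigr => j _; rewrite dM // !coef_der.
Qed.

Definition der_at (xi : L) (p : {poly L}) : L :=
  (map_poly d p).[w] + p^`().[w] * xi.

Lemma der_atD xi p q : poly_in A p -> poly_in A q ->
  der_at xi (p + q) = der_at xi p + der_at xi q.
Proof.
move=> hp hq; rewrite /der_at map_der_poly_add // derivD !hornerD mulrDl.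
by rewrite addrACA.
Qed.

Lemma der_atM xi p q : poly_in A p -> poly_in A q ->
  der_at xi (p * q) = der_at xi p * q.[w] + p.[w] * der_at xi q.
Proof.
move=> hp hq; rewrite /der_at map_der_poly_mul // derivM !(hornerD, hornerM).
ring.
Qed.

Lemma der_extend_at xi :
  (forall p, poly_in A p -> p.[w] = 0 -> der_at xi p = 0) ->
  exists d', [/\ derivation_on (adjoin A w) d', forall x, A x -> d' x = d x
    & d' w = xi].
Proof.
move=> h0; pose F x y := exists2 p, poly_in A p & x = p.[w] /\ y = der_at xi p.
pose d' x := if pselect (exists y, F x y) is left ex then projT1 (cid ex) else 0.
have d'E p : poly_in A p -> d' p.[w] = der_at xi p.
  move=> hp; rewrite /d'; case: pselect => [ex|[]]; last by exists (der_at xi p), p.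
  case: cid => y Fy /=; case: Fy => q hq [E ->].
  have -> : der_at xi p = der_at xi q + der_at xi (p - q).
    rewrite -der_atD ?[q + _]addrC ?subrK //; exact: poly_inB.
  rewrite [der_at xi (p - q)]h0 ?addr0 //; first exact: poly_inB.
  by rewrite hornerD hornerN E subrr.
exists d'; split; first split.
- move=> _ _ [p hp ->] [q hq ->]; rewrite -hornerD !d'E ?der_atD //.
  exact: poly_inD.
- move=> _ _ [p hp ->] [q hq ->]; rewrite -hornerM !d'E ?der_atM //.
  exact: poly_inM.
- move=> x Ax; rewrite -[x in LHS](hornerC x w) d'E; last exact: poly_inC.
  by rewrite /der_at map_der_polyC derivC hornerC horner0 mul0r addr0.
- rewrite -[w in LHS]hornerX d'E; last exact: poly_inX.
  rewrite /der_at derivX hornerC mul1r (_ : map_poly d 'X = 0) ?horner0 ?add0r //.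
  apply/polyP => i; rewrite coef_der coefX coef0; have [_ dM] := hd.
  have [A1 _ _] := sA.
  case: eqP => _ /=; last exact: derivation_on0.
  by have /eqP := dM 1 1 A1 A1; rewrite !mulr1 mul1r eq_sym -subr_eq0 addrK => /eqP.
Qed.

Hypothesis char0 : forall n, n.+1%:R != 0 :> L.

(** On a transcendental element the value is free, and $0$ is taken. On an algebraic one it is
    forced by differentiating the minimal relation, whose derivative does not vanish at [w] in
    characteristic $0$. *)
Lemma der_extend : exists d', [/\ derivation_on (adjoin A w) d'
  & forall x, A x -> d' x = d x].
Proof.
have [tr|/algebraic_min_poly[r [r0 hr rw rmin]]] := pselect (transcendental A w).
  case: (der_extend_at (xi := 0)) => [p hp /(tr p hp) ->|d' [? ? _]]; last by exists d'.
  by rewrite /der_at -polyC0 map_der_polyC derivC !hornerC derivation_on0 mul0r addr0.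
have r'0 : r^`().[w] != 0.
  have szr : (1 < size r)%N.
    rewrite ltnNge; apply/negP => /size1_polyC rC; case/eqP: r0.
    by move: rw; rewrite rC hornerC => ->.
  apply/eqP => r'w; have r'0 : r^`() = 0.
    apply: rmin => //; last by rewrite lt_size_deriv.
    by move=> i; rewrite coef_deriv -mulr_natr; case: (sA) => A1 _ AM; apply: AM => //;
      elim: (i.+1) => [|n IHn]; [rewrite mulr0n; apply: subring0 | rewrite mulrS; apply: subringD].
  have := congr1 (fun p : {poly L} => p`_((size r).-2)) r'0.
  rewrite /= coef_deriv coef0 prednK; last by rewrite -subn1 subn_gt0.
  rewrite -mulr_natr => /eqP; rewrite mulf_eq0 -lead_coefE lead_coef_eq0 (negPf r0) /=.
  by rewrite -subn1; case: (size r - 1)%N (subn_gt0 1 (size r)) => [|n _]; [rewrite szr | rewrite (negPf (char0 n))].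
pose xi := - ((map_poly d r).[w] / r^`().[w]).
have rxi : der_at xi r = 0 by rewrite /der_at /xi mulrN mulrCA mulfV // mulr1 subrr.
case: (der_extend_at (xi := xi)) => [p hp pw|d' [? ? _]]; last by exists d'.
have [n [q [hq E]]] := min_poly_multiple sA r0 hr rw rmin hp pw.
have := congr1 (der_at xi) E; rewrite -mul_polyC.
have An : A (lead_coef r ^+ n).
  have [A1 _ AM] := sA.
  by elim: n {E} => // n IHn; rewrite exprS; apply: AM => //; apply: hr.
rewrite !der_atM //; last exact: poly_inC.
rewrite pw rw rxi !mulr0 add0r addr0 hornerC => /eqP.
by rewrite mulf_eq0 expf_eq0 lead_coef_eq0 (negPf r0) andbF => /eqP.
Qed.
End ExtendDerivation.

Section Generated.
Variables (L : fieldType).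
Implicit Type A : set L.

(** The list is adjoined from its end, so that the [gen A (drop a ws)] are the intermediate
    rings. *)
Definition gen A (ws : seq L) : set L := foldr (fun w B => adjoin B w) A ws.

Lemma gen_subring A ws : subring A -> subring (gen A ws).
Proof. by move=> sA; elim: ws => //= w ws IH; apply: adjoin_subring. Qed.

Lemma sub_gen A ws : subring A -> A `<=` gen A ws.
Proof.
move=> sA; elim: ws => //= w ws IH x /IH; apply: sub_adjoin.
exact: gen_subring.
Qed.

Lemma mem_gen A ws w : subring A -> w \in ws -> gen A ws w.
Proof.
move=> sA; elim: ws => //= w' ws IH; rewrite inE => /predU1P[->|/IH h].
  by apply: mem_adjoin; apply: gen_subring.
by apply: sub_adjoin => //; apply: gen_subring.
Qed.

Lemma gen_cat A ws ws' : gen A (ws' ++ ws) = gen (gen A ws) ws'.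
Proof. by rewrite /gen foldr_cat. Qed.

Lemma der_extend_gen A ws d : (forall n, n.+1%:R != 0 :> L) ->
  subring A -> derivation_on A d ->
  exists d', derivation_on (gen A ws) d' /\ forall x, A x -> d' x = d x.
Proof.
move=> c0 sA hd; elim: ws => [|w ws [d1 [h1 e1]]]; first by exists d.
have [d2 [h2 e2]] := der_extend w (gen_subring ws sA) h1 c0.
exists d2; split=> // x Ax; rewrite e2 ?e1 //; exact: sub_gen.
Qed.

(** The induction trades the element to be kept nonzero for one in the ring with one generator
    fewer, until it lies in [A], where [phi] is injective. *)
Lemma hom_extend_gen (k : closedFieldType) A (phi : L -> k) ws b :
  subring A -> ring_hom_on A phi -> (forall a, A a -> a != 0 -> phi a != 0) ->
  gen A ws b -> b != 0 ->
  exists psi, [/\ ring_hom_on (gen A ws) psi, forall x, A x -> psi x = phi x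
    & psi b != 0].
Proof.
move=> sA hphi phi0; elim: ws b => [|w ws IH] b /=.
  by move=> Ab b0; exists phi; split=> //; apply: phi0.
move=> Bb b0; have sB := gen_subring ws sA.
have [a [Ba a0 aP]] := hom_extend k sB Bb b0.
have [phi1 [h1 e1 n1]] := IH a Ba a0.
have [psi [h2 e2 n2]] := aP phi1 h1 n1.
exists psi; split=> // x Ax; rewrite e2 ?e1 //; exact: sub_gen.
Qed.
End Generated.

(** * Residue fields of primes and the Nullstellensatz *)

Section PrimeQuotient.
Variables (R : comNzRingType) (I : prime_idealr R).

(** An alias that receives an integral domain structure with a classical inverse, so that its
    fraction field can be formed. *)
Definition prime_quot : Type := {ideal_quot I}.
HB.instance Definition _ := GRing.ComNzRing.on prime_quot.

Definition prime_quot_unit : {pred prime_quot} :=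
  fun x => `[< exists y, y * x = 1 >].

Definition prime_quot_inv (x : prime_quot) : prime_quot :=
  if pselect (exists y, y * x = 1) is left ex then projT1 (cid ex) else x.

Lemma prime_quot_mulVx : {in prime_quot_unit, left_inverse 1 prime_quot_inv *%R}.
Proof.
move=> x /asboolP h; rewrite /prime_quot_inv; case: pselect => // ex.
by case: cid.
Qed.

Lemma prime_quot_unitPl x y : y * x = 1 -> prime_quot_unit x.
Proof. by move=> h; apply/asboolP; exists y. Qed.

Lemma prime_quot_invr_out : {in [predC prime_quot_unit], prime_quot_inv =1 id}.
Proof.
move=> x; rewrite inE => /asboolP h; rewrite /prime_quot_inv.
by case: pselect.
Qed.

HB.instance Definition _ := GRing.ComNzRing_hasMulInverse.Build prime_quot
  prime_quot_mulVx prime_quot_unitPl prime_quot_invr_out.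

HB.instance Definition _ := GRing.ComUnitRing_isIntegral.Build prime_quot
  (@Quotient.rquot_IdomainAxiom R I).

Definition prime_quot_pi (x : R) : prime_quot := \pi_({ideal_quot I})%qT x.

Lemma prime_quot_pi_zmod : zmod_morphism prime_quot_pi.
Proof. by move=> x y; rewrite /prime_quot_pi raddfB. Qed.

Lemma prime_quot_pi_monoid : monoid_morphism prime_quot_pi.
Proof. by split=> [|x y]; rewrite /prime_quot_pi ?rmorph1 ?rmorphM. Qed.

HB.instance Definition _ :=
  GRing.isZmodMorphism.Build R prime_quot prime_quot_pi prime_quot_pi_zmod.
HB.instance Definition _ :=
  GRing.isMonoidMorphism.Build R prime_quot prime_quot_pi prime_quot_pi_monoid.

Lemma prime_quot_pi_eq0 x : (prime_quot_pi x == 0) = (x \in I).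
Proof.
by rewrite -(rmorph0 prime_quot_pi) /prime_quot_pi -Quotient.idealrBE subr0.
Qed.
End PrimeQuotient.

Section Ideals.
Variable R : comNzRingType.
Implicit Type I : set R.

Lemma ideal0 I : is_ideal setT I -> I 0. Proof. by case. Qed.

Lemma idealM I a x : is_ideal setT I -> I x -> I (a * x).
Proof. by case=> _ _ _ h Ix; apply: h. Qed.

Lemma idealMl I a x : is_ideal setT I -> I x -> I (x * a).
Proof. by move=> hI Ix; rewrite mulrC; apply: idealM. Qed.

Lemma idealD I x y : is_ideal setT I -> I x -> I y -> I (x + y).
Proof. by case=> _ _ h _; apply: h. Qed.

Lemma idealN I x : is_ideal setT I -> I x -> I (- x).
Proof. by move=> hI Ix; rewrite -mulN1r; apply: idealM. Qed.

Lemma idealB I x y : is_ideal setT I -> I x -> I y -> I (x - y).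
Proof. by move=> hI Ix Iy; apply: idealD => //; apply: idealN. Qed.

Lemma ideal_sum I (T : Type) (s : seq T) (Q : pred T) (F : T -> R) :
  is_ideal setT I -> (forall i, Q i -> I (F i)) -> I (\sum_(i <- s | Q i) F i).
Proof. by move=> hI h; apply: big_ind => //; [case: hI | move=> *; apply: idealD]. Qed.

Lemma is_idealP I : I 0 -> (forall x y, I x -> I y -> I (x + y)) ->
  (forall a x, I x -> I (a * x)) -> is_ideal setT I.
Proof. by split=> // a x _; auto. Qed.

Lemma is_ideal_idsum I J : is_ideal setT I -> is_ideal setT J ->
  is_ideal setT (idsum I J).
Proof.
move=> hI hJ; apply: is_idealP.
- by exists 0, 0; rewrite addr0; split=> //; apply: ideal0.
- move=> _ _ [a [b [Ia Jb ->]]] [a' [b' [Ia' Jb' ->]]].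
  by exists (a + a'), (b + b'); split; [apply: idealD | apply: idealD | rewrite addrACA].
- move=> c _ [a [b [Ia Jb ->]]]; exists (c * a), (c * b).
  by split; [apply: idealM | apply: idealM | rewrite mulrDr].
Qed.

Lemma is_ideal_setI I J : is_ideal setT I -> is_ideal setT J ->
  is_ideal setT (I `&` J).
Proof.
move=> hI hJ; apply: is_idealP.
- by split; apply: ideal0.
- by move=> x y [? ?] [? ?]; split; apply: idealD.
- by move=> a x [? ?]; split; apply: idealM.
Qed.

Lemma is_ideal_colon I J : is_ideal setT I -> is_ideal setT (colon I J).
Proof.
move=> hI; apply: is_idealP.
- by move=> g _; rewrite mul0r; apply: ideal0.
- by move=> x y hx hy g Jg; rewrite mulrDl; apply: idealD; [|apply: hx|apply: hy].
- by move=> a x hx g Jg; rewrite -mulrA; apply: idealM => //; apply: hx.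
Qed.

Lemma is_ideal_idmul I J : is_ideal setT I -> is_ideal setT (idmul I J).
Proof.
move=> hI; apply: is_idealP.
- by exists 0%N, (fun=> 0), (fun=> 0); split=> [[]|] //; rewrite big_ord0.
- move=> _ _ [m [a [b [h ->]]]] [m' [a' [b' [h' ->]]]].
  exists (m + m')%N, (fun i => match split i with inl i => a i | inr i => a' i end),
    (fun i => match split i with inl i => b i | inr i => b' i end).
  split; first by move=> i; case: split.
  rewrite big_split_ord; congr (_ + _); apply: eq_bigr => i _ /=.
    by rewrite (unsplitK (inl i)).
  by rewrite (unsplitK (inr i)).
- move=> c _ [m [a [b [h ->]]]]; exists m, (fun i => c * a i), b.
  split=> [i|]; first by have [? ?] := h i; split=> //; apply: idealM.
  by rewrite mulr_sumr; apply: eq_bigr => i _; rewrite mulrA.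
Qed.

Lemma idmul_mul I J a b : I a -> J b -> idmul I J (a * b).
Proof.
by move=> Ia Jb; exists 1%N, (fun=> a), (fun=> b); split=> //; rewrite big_ord1.
Qed.

Lemma idmul_sub I J K : is_ideal setT K ->
  (forall a b, I a -> J b -> K (a * b)) -> idmul I J `<=` K.
Proof.
by move=> hK h _ [m [a [b [hab ->]]]]; apply: ideal_sum => // i _; have [? ?] := hab i; apply: h.
Qed.

Lemma idsum_sub I J K : is_ideal setT K -> I `<=` K -> J `<=` K -> idsum I J `<=` K.
Proof. by move=> hK IK JK _ [a [b [/IK ? /JK ? ->]]]; apply: idealD. Qed.

Lemma idsuml I J : is_ideal setT J -> I `<=` idsum I J.
Proof. by move=> hJ x Ix; exists x, 0; rewrite addr0; split=> //; apply: ideal0. Qed.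

Lemma idsumr I J : is_ideal setT I -> J `<=` idsum I J.
Proof. by move=> hI x Jx; exists 0, x; rewrite add0r; split=> //; apply: ideal0. Qed.

Lemma prime_is_ideal I : is_prime setT I -> is_ideal setT I. Proof. by case. Qed.

Lemma primeM I a b : is_prime setT I -> I (a * b) -> I a \/ I b.
Proof. by case=> _ _ h; apply: h. Qed.

Lemma residue_field P : is_prime setT P ->
  exists (L : fieldType) (pi : {rmorphism R -> L}), forall x, pi x = 0 <-> P x.
Proof.
move=> pP; have hP := prime_is_ideal pP.
pose I : pred R := fun x => `[< P x >].
have inI x : x \in I <-> P x by split=> [/asboolP|?] //; apply/asboolP.
have cI : idealr_closed I.
  split; first by apply/inI; apply: ideal0.
    by apply/negP => /inI P1; case: pP => _ /(_ P1).
  move=> a x y /inI Px /inI Py; apply/inI.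
  by apply: idealD => //; apply: idealM.
have prI : prime_idealr_closed I.
  by move=> u v /inI /(primeM pP)[h|h]; apply/orP; [left|right]; apply/inI.
pose m := isIdealr.Build R I cI; pose m' := isPrimeIdealrClosed.Build R I prI.
pose J : prime_idealr R := HB.pack I m m'.
exists {fraction (prime_quot J)}, (@FracField.tofrac (prime_quot J) \o @prime_quot_pi R J).
move=> x /=; rewrite (rwP eqP) tofrac_eq0 prime_quot_pi_eq0.
exact: inI.
Qed.

(* Zorn: an ideal maximal among those containing J and avoiding the powers of
   f is prime. *)
Lemma prime_avoiding J f : is_ideal setT J -> (forall m, ~ J (f ^+ m)) ->
  exists P : set R, [/\ is_prime setT P, J `<=` P & ~ P f].
Proof.
move=> hJ hf.
pose T := {I : set R | [/\ is_ideal setT I, J `<=` I & forall m, ~ I (f ^+ m)]}.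
pose r (x y : T) : bool := `[< sval x `<=` sval y >].
have [|x y z /asboolP xy /asboolP yz|[x hx] [y hy] /asboolP xy /asboolP yx|C Ctot|] := @Zorn T r.
- by move=> x; apply/asboolP.
- by apply/asboolP => a /xy /yz.
- by apply: eq_exist; apply/seteqP.
- have [C0|/existsNP[x0 /contrapT Cx0]] := pselect (forall x, ~ C x).
    exists (exist _ J (And3 hJ (fun _ => id) hf)) => s /C0 //.
  pose U := [set a | exists2 x : T, C x & sval x a].
  have hU : [/\ is_ideal setT U, J `<=` U & forall m, ~ U (f ^+ m)].
    split.
    + apply: is_idealP.
      * by exists x0 => //; case: (svalP x0) => h _ _; apply: ideal0.
      * move=> a b [x Cx xa] [y Cy yb].
        have [/asboolP xy|/asboolP yx] := Ctot _ _ Cx Cy.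
          by exists y => //; case: (svalP y) => h _ _; apply: idealD => //; apply: xy.
        by exists x => //; case: (svalP x) => h _ _; apply: idealD => //; apply: yx.
      * by move=> a b [x Cx xb]; exists x => //; case: (svalP x) => h _ _; apply: idealM.
    + by move=> a Ja; exists x0 => //; case: (svalP x0) => _ h _; apply: h.
    + by move=> m [x _]; case: (svalP x) => _ _; apply.
  by exists (exist _ U hU) => s Cs; apply/asboolP => a sa; exists s.
case=> P [hP JP Pf] Pmax; exists P; split=> //; last by have := Pf 1%N; rewrite expr1.
split=> //; first by have := Pf 0%N; rewrite expr0.
(* Maximality: adjoining [a] to [P] brings in a power of [f]. *)
have big a : ~ P a -> exists m, idsum P [set c * a | c in setT] (f ^+ m).
  move=> Pa; apply: contrapT => /forallNP h.
  have ha : is_ideal setT [set c * a | c in setT].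
    apply: is_idealP; first by exists 0; rewrite ?mul0r.
      by move=> _ _ [x _ <-] [y _ <-]; exists (x + y); rewrite ?mulrDl.
    by move=> c _ [x _ <-]; exists (c * x); rewrite ?mulrA.
  have hI := is_ideal_idsum hP ha.
  pose t : T := exist _ _ (And3 hI (subset_trans JP (idsuml ha)) h).
  have /Pmax [E] : r (exist _ P (And3 hP JP Pf)) t by apply/asboolP; apply: idsuml.
  by apply: Pa; rewrite -E; apply: idsumr => //; exists 1; rewrite ?mul1r.
move=> a b _ _ Pab; apply: contrapT => /not_orP[/big[m [p [_ [Pp [c _ <-] Em]]]]].
move=> /big[n [q [_ [Pq [d _ <-] En]]]].
apply: (Pf (m + n)%N); rewrite exprD Em En mulrDl.
apply: idealD => //; first exact: idealMl.
rewrite mulrDr; apply: idealD => //; first exact: idealM.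
by rewrite mulrACA; apply: idealM.
Qed.
End Ideals.

Section Nullstellensatz.
Variables (k : closedFieldType) (N : nat).
Local Notation S := {mpoly k[N]}.

(** In the residue field of [P], the identity of $k$ extends to a homomorphism on the algebra
    generated by the images of the variables that does not kill the image of [f]. Its values at
    these images are the coordinates of the zero. *)
Lemma prime_zero (P : set S) (f : S) : is_prime setT P -> ~ P f ->
  exists2 v : 'I_N -> k, (forall g, P g -> g.@[v] = 0) & f.@[v] != 0.
Proof.
move=> pP Pf; have [L [pi piP]] := residue_field pP.
have pC (c : k) : pi c%:MP = 0 -> c = 0.
  move=> /piP Pc; apply/eqP; apply: contrapT => /negP c0; case: pP => hP P1 _; apply: P1.
  have := idealM c^-1%:MP hP Pc; by rewrite -mpolyCM mulVf.
pose A : set L := [set pi c%:MP | c in [set: k]].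
have sA : subring A.
  split; first by exists 1; rewrite ?rmorph1.
    by move=> _ _ [a _ <-] [b _ <-]; exists (a - b) => //; rewrite mpolyCB rmorphB.
  by move=> _ _ [a _ <-] [b _ <-]; exists (a * b) => //; rewrite mpolyCM rmorphM.
have /choice[phi phiP] : forall x : L, exists c : k, A x -> pi c%:MP = x.
  move=> x; case: (pselect (A x)) => [[c _ <-]|nA]; first by exists c.
  by exists 0.
have piI (a b : k) : pi a%:MP = pi b%:MP -> a = b.
  by move=> E; apply/eqP; rewrite -subr_eq0; apply/eqP/pC; rewrite mpolyCB rmorphB E subrr.
have phiC c : phi (pi c%:MP) = c by apply: piI; apply: phiP; exists c.
have hphi : ring_hom_on A phi.
  split.
  - by have := phiC 1; rewrite rmorph1.
  - by move=> _ _ [a _ <-] [b _ <-]; rewrite -rmorphB -mpolyCB !phiC.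
  - by move=> _ _ [a _ <-] [b _ <-]; rewrite -rmorphM -mpolyCM !phiC.
have phi0 a : A a -> a != 0 -> phi a != 0.
  move=> [c _ <-]; rewrite phiC; apply: contraNneq => ->; by rewrite rmorph0.
pose ws := [seq pi 'X_i | i <- enum 'I_N].
have sB := gen_subring ws sA; have [B1 BB BM] := sB.
have BX i : gen A ws (pi 'X_i).
  by apply: mem_gen => //; apply: map_f; rewrite mem_enum.
have Bm (m : 'X_{1..N}) : gen A ws (pi 'X_[m]).
  rewrite mpolyXE_id rmorph_prod; apply: (big_ind (gen A ws)) => [|x y|i _]; [exact: B1 | exact: BM |].
  by rewrite rmorphXn; elim: (m i) => // j IHj; rewrite exprS; apply: BM.
have Bpi g : gen A ws (pi g).
  elim/mpolyind: g => [|c m g _ _ IH]; first by rewrite rmorph0; apply: subring0.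
  rewrite rmorphD; apply: subringD => //; rewrite -mul_mpolyC rmorphM; apply: BM => //.
  by apply: sub_gen => //; exists c.
have nf : pi f != 0 by apply/eqP => /piP.
have [psi [hpsi epsi npsi]] := hom_extend_gen sA hphi phi0 (Bpi f) nf.
have [p1 pB pM] := hpsi.
pose v i := psi (pi 'X_i).
have ev g : g.@[v] = psi (pi g).
  elim/mpolyind: g => [|c m g _ _ IH].
    by rewrite meval0 rmorph0 (ring_hom_on0 sB hpsi).
  rewrite mevalD rmorphD (ring_hom_onD sB hpsi); [|exact: Bpi..].
  rewrite IH; congr (_ + _); rewrite mevalZ -mul_mpolyC rmorphM pM; [|exact: Bpi..].
  congr (_ * _); first by rewrite epsi ?phiC //; exists c.
  have key (s : seq 'I_N) : gen A ws (pi (\prod_(i <- s) 'X_i ^+ m i)) /\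
      psi (pi (\prod_(i <- s) 'X_i ^+ m i)) = \prod_(i <- s) v i ^+ m i.
    elim: s => [|i s [IH1 IH2]]; first by rewrite !big_nil rmorph1.
    have [h1 h2] : gen A ws (pi ('X_i ^+ m i)) /\ psi (pi ('X_i ^+ m i)) = v i ^+ m i.
      elim: (m i) => [|j [h1 h2]]; first by rewrite !expr0 rmorph1.
      by rewrite !exprS rmorphM; split; [apply: BM | rewrite pM // h2].
    by rewrite !big_cons rmorphM; split; [apply: BM | rewrite pM // h2 IH2].
  by rewrite mevalX [in RHS]mpolyXE_id; case: (key (index_enum _)).
exists v; last by rewrite ev.
by move=> g /piP Pg; rewrite ev Pg (ring_hom_on0 sB hpsi).
Qed.

Lemma nullstellensatz (J : set S) (f : S) : is_ideal setT J ->
  (forall v : 'I_N -> k, (forall g, J g -> g.@[v] = 0) -> f.@[v] = 0) ->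
  exists m, J (f ^+ m).
Proof.
move=> hJ hv; apply: contrapT => /forallNP h.
have [P [pP JP Pf]] := prime_avoiding hJ h.
have [v Pv /eqP fv] := prime_zero pP Pf.
by apply: fv; apply: hv => g /JP /Pv.
Qed.
End Nullstellensatz.

(** * Hilbert's basis theorem *)

Section HilbertBasis.
Variables (k : fieldType) (N : nat).
Local Notation S := {mpoly k[N]}.

Lemma dickson (M : set 'X_{1..N}) :
  exists2 s : seq 'X_{1..N}, (forall m, m \in s -> M m)
    & forall m, M m -> exists2 m', m' \in s & (m' <= m)%MM.
Proof.
(* Induction on the number of coordinates on which the elements of M may differ. *)
suff gen j : forall (M : set 'X_{1..N}) (F : {set 'I_N}), (#|~: F| <= j)%N ->
    (forall m m', M m -> M m' -> forall i, i \in F -> m i = m' i) ->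
    exists2 s : seq 'X_{1..N}, (forall m, m \in s -> M m)
    & forall m, M m -> exists2 m', m' \in s & (m' <= m)%MM.
  apply: (gen N M finset.set0) => [|m m' _ _ i]; last by rewrite inE.
  by rewrite -[leqRHS]card_ord max_card.
elim: j => [|j IH] {}M F cF eqF.
  have [M0|/existsNP[m0 /contrapT Mm0]] := pselect (forall m, ~ M m).
    by exists [::] => // m /M0.
  exists [:: m0] => [m|m Mm]; first by rewrite inE => /eqP ->.
  exists m0; rewrite ?inE ?eqxx //; apply/mnm_lepP => i.
  rewrite (eqF _ _ Mm0 Mm) //; move: cF; rewrite leqn0 cards_eq0 => /eqP/setP/(_ i).
  by rewrite !inE => /negbFE.
have [M0|/existsNP[m0 /contrapT Mm0]] := pselect (forall m, ~ M m).
  by exists [::] => // m /M0.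
have sub (ic : 'I_N * nat) : exists s : seq 'X_{1..N}, (forall m, m \in s -> M m) /\
    (ic.1 \notin F -> forall m, M m -> m ic.1 = ic.2 -> exists2 m', m' \in s & (m' <= m)%MM).
  case: ic => i c /=; have [iF|niF] := boolP (i \in F); first by exists [::].
  have [||s sM sP] := IH (M `&` [set m | m i = c]) (i |: F).
  - have := cardsD1 i (~: F); rewrite inE niF /= => E.
    by rewrite -ltnS; apply: leq_trans cF; rewrite E add1n ltnS finset.setCU finset.setIC -finset.setDE.
  - move=> m m' [Mm /= mi] [Mm' /= mi'] l; rewrite !inE => /orP[/eqP ->|].
      by rewrite mi mi'.
    exact: eqF.
  - exists s; split=> [m /sM[]|_ m Mm mi] //; exact: sP.
have /choice[s sP] := sub.
(* An element of [M] not above [m0] has a coordinate smaller than that of [m0], hence lies in one of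
   finitely many slices with one more coordinate fixed. *)
pose idx := [seq (i, c) | i <- enum 'I_N, c <- iota 0 (\max_(i < N) m0 i)].
exists (m0 :: flatten [seq s ic | ic <- idx]).
  move=> m; rewrite inE => /predU1P[-> //|/flattenP[t /mapP[ic _ ->]]].
  exact: (sP ic).1.
move=> m Mm; have [le_m0|] := boolP (m0 <= m)%MM; first by exists m0; rewrite ?inE ?eqxx.
move=> nle; have [i lt_i] : exists i, (m i < m0 i)%N.
  apply: contrapT => /forallNP h; case/negP: nle; apply/mnm_lepP => i.
  by rewrite leqNgt; apply/negP/h.
have iF : i \notin F.
  by apply/negP => iF; move: lt_i; rewrite (eqF _ _ Mm Mm0 i iF) ltnn.
have [m' m's le_m'] := (sP (i, m i)).2 iF m Mm erefl.
exists m' => //; rewrite inE; apply/orP; right; apply/flattenP.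
exists (s (i, m i)) => //; apply: map_f; apply/allpairsP; exists (i, m i) => /=.
by rewrite mem_enum mem_iota /= add0n; split=> //; apply: leq_trans lt_i (leq_bigmax i).
Qed.

Definition finitely_generated (I : set S) : Prop :=
  exists m (g : 'I_m -> S), (forall i, I (g i)) /\
    forall f, I f -> exists c : 'I_m -> S, f = \sum_i c i * g i.

(** Division by elements whose leading monomials form the finite set given by Dickson. Finite
    generation later provides a single denominator for membership in a colon ideal at a point. *)
Lemma hilbert_basis (I : set S) : is_ideal setT I -> finitely_generated I.
Proof.
move=> hI; have [s sI sP] := dickson [set mlead f | f in [set f | I f /\ f != 0]].
have /choice[g gP] : forall m : 'X_{1..N}, exists g : S, m \in s ->
    [/\ I g, g != 0 & mlead g = m].
  move=> m; have [ms|nms] := boolP (m \in s); last by exists 0.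
  by have [g [Ig g0] gm] := sI _ ms; exists g.
exists (size s), (fun i => g (nth 0%MM s i)); split.
  by move=> i; have [|] := gP (nth 0%MM s i); rewrite ?mem_nth.
elim/mleadrect => f IH If.
have [->|f0] := eqVneq f 0.
  by exists (fun=> 0); rewrite big1 // => i _; rewrite mul0r.
have [|m' m's le_m'] := sP (mlead f); first by exists f.
have [Ig g0 gm] := gP _ m's.
pose d := (mlead f - m')%MM; pose c := mleadc f / mleadc (g m').
pose h := c *: ('X_[d] * g m').
have X0 : 'X_[d] != 0 :> S by rewrite -mleadc_eq0 mleadXm mcoeffX eqxx oner_eq0.
have lg0 : mleadc (g m') != 0 by rewrite mleadc_eq0.
have lXg : mlead ('X_[d] * g m') = mlead f by rewrite mleadM // mleadXm gm submK.
have c0 : c != 0 by rewrite mulf_neq0 ?mleadc_eq0 ?invr_eq0.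
have lh : mlead h = mlead f by rewrite mleadZ.
have ch : h@_(mlead f) = mleadc f.
  rewrite mcoeffZ -[X in _@_X](submK le_m') -/d [('X_[d] * _)]mulrC mcoeffMX.
  by have := mulfVK lg0 (mleadc f); rewrite [in X in _ * X]gm.
have Ih : I h by rewrite /h -mul_mpolyC; apply: idealM => //; apply: idealM.
have [j jE] : exists j : 'I_(size s), nth 0%MM s j = m'.
  by have lt_j := m's; rewrite -index_mem in lt_j; exists (Ordinal lt_j); rewrite nth_index.
have [a E] : exists a : 'I_(size s) -> S, f - h = \sum_i a i * g (nth 0%MM s i).
  have [/eqP E0|fh0] := boolP (f - h == 0).
    by exists (fun=> 0); rewrite E0 big1 // => i _; rewrite mul0r.
  apply: IH; last exact: idealB.
  rewrite lt_neqAle; apply/andP; split.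
    apply: contraNneq fh0 => E; rewrite -mleadc_eq0 E mcoeffB ch subrr //.
  by apply: le_trans (mleadB_le _ _) _; rewrite lh joinxx.
exists (fun i => a i + (i == j)%:R * (c%:MP * 'X_[d])).
rewrite -[f in LHS](subrK h) E; under [RHS]eq_bigr do rewrite mulrDl.
rewrite big_split /= (bigD1 j) //= [X in _ = _ + X](bigD1 j) //=; congr (_ + _).
rewrite eqxx mul1r jE big1 ?addr0 => [|i /negPf ->]; last by rewrite !mul0r.
by rewrite -mulrA mul_mpolyC.
Qed.
End HilbertBasis.

(** * Generic tangent spaces of nested primes *)

Section PolynomialInduction.
Variables (R : comNzRingType) (N : nat).
Local Notation S := {mpoly R[N]}.

Lemma mpoly_ring_ind (K : S -> Prop) :
  (forall c, K c%:MP) -> (forall i, K 'X_i) ->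
  (forall f g, K f -> K g -> K (f + g)) ->
  (forall f g, K f -> K g -> K (f * g)) -> forall f, K f.
Proof.
move=> KC KX KD KM; elim/mpolyind => [|c m f _ _ Kf]; first by rewrite -mpolyC0.
apply: (KD) => //; rewrite -mul_mpolyC; apply: (KM) => //.
have K1 : K 1 by rewrite -mpolyC1.
rewrite mpolyXE_id; apply: (big_ind K) => [|x y|i _]; [exact: K1 | exact: KM |].
by elim: (m i) => // j IHj; rewrite exprS; apply: KM.
Qed.
End PolynomialInduction.

Section Gradient.
Variables (k : fieldType) (N : nat).
Local Notation S := {mpoly k[N]}.
Implicit Types (f g : S) (v : 'I_N -> k) (w : 'cV[k]_N).

Definition grad f v : 'rV[k]_N := \row_i (f^`M(i)).@[v].

Lemma gradD f g v : grad (f + g) v = grad f v + grad g v.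
Proof. by apply/rowP => i; rewrite !mxE mderivD mevalD. Qed.

Lemma gradB f g v : grad (f - g) v = grad f v - grad g v.
Proof. by apply/rowP => i; rewrite !mxE mderivB mevalB. Qed.

Lemma gradM f g v : grad (f * g) v = g.@[v] *: grad f v + f.@[v] *: grad g v.
Proof. by apply/rowP => i; rewrite !mxE mderivM mevalD !mevalM mulrC. Qed.

Lemma gradZ c f v : grad (c *: f) v = c *: grad f v.
Proof. by apply/rowP => i; rewrite !mxE mderivZ mevalZ. Qed.

Lemma grad0 v : grad 0 v = 0.
Proof. by apply/rowP => i; rewrite !mxE mderiv0 meval0. Qed.

Lemma grad_sum (T : Type) (s : seq T) (F : T -> S) v :
  grad (\sum_(i <- s) F i) v = \sum_(i <- s) grad (F i) v.
Proof.
elim: s => [|i s IH]; first by rewrite !big_nil grad0.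
by rewrite !big_cons gradD IH.
Qed.

(** At a zero [v] of [I], the Zariski tangent space of the affine scheme of [I]; for homogeneous [I]
    this is the tangent space of the cone. *)
Definition tangent (I : set S) v w : Prop := forall f, I f -> grad f v *m w = 0.

Lemma pi_derivation_chain (L : fieldType) (pi : {rmorphism S -> L}) (E : S -> L) :
  (forall c, E c%:MP = 0) -> (forall f g, E (f + g) = E f + E g) ->
  (forall f g, E (f * g) = E f * pi g + pi f * E g) ->
  forall f, E f = \sum_i pi (f^`M(i)) * E 'X_i.
Proof.
move=> EC ED EM; apply: mpoly_ring_ind.
- by move=> c; rewrite EC big1 // => i _; rewrite mderivC rmorph0 mul0r.
- move=> i; rewrite (bigD1 i) //= mderivX mnm1E eqxx scale1r.
  rewrite (_ : (U_(i) - U_(i))%MM = 0%MM); last by apply/mnmP => j; rewrite mnmE subnn mnmE.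
  rewrite mpolyX0 rmorph1 mul1r big1 ?addr0 // => j ji.
  by rewrite mderivX mnm1E eq_sym (negPf ji) scale0r rmorph0 mul0r.
- move=> f g Ef Eg; rewrite ED Ef Eg -big_split; apply: eq_bigr => i _ /=.
  by rewrite mderivD rmorphD mulrDl.
- move=> f g Ef Eg; rewrite EM Ef Eg mulr_suml mulr_sumr -big_split.
  by apply: eq_bigr => i _ /=; rewrite mderivM rmorphD !rmorphM; ring.
Qed.
End Gradient.

Section CharZero.
Variables (k : fieldType) (N : nat).
Hypothesis char0 : forall n, n.+1%:R != 0 :> k.
Local Notation S := {mpoly k[N]}.

Lemma mderiv_eq0 (i : 'I_N) (f : S) (m : 'X_{1..N}) :
  f^`M(i) = 0 -> m i != 0%N -> f@_m = 0.
Proof.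
move=> fi; rewrite -lt0n => mi.
have /eqP : (f^`M(i))@_(m - U_(i)) = 0 by rewrite fi mcoeff0.
rewrite mcoeff_deriv submK; last first.
  by apply/mnm_lepP => j; rewrite mnm1E; case: eqP => // <-.
by rewrite -mulr_natr mulf_eq0 (negPf (char0 _)) orbF => /eqP.
Qed.

Lemma mderiv_all_eq0 (f : S) : (forall i, f^`M(i) = 0) -> f = (f@_0%MM)%:MP.
Proof.
move=> h; apply/mpolyP => m; rewrite mcoeffC.
have [->|m0] := eqVneq m 0%MM; first by rewrite mulr1.
rewrite mulr0; have [i mi] : exists i, m i != 0%N.
  apply: contrapT => /forallNP h'; case/eqP: m0; apply/mnmP => i.
  by rewrite mnmE; apply/eqP; apply: contrapT => /negP /h'.
exact: mderiv_eq0 mi.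
Qed.

Lemma msize_mderiv (i : 'I_N) (f : S) :
  f^`M(i) != 0 -> (msize f^`M(i) < msize f)%N.
Proof.
move=> fi; have f0 : f != 0 by apply: contraNneq fi => ->; rewrite mderiv0.
rewrite -mlead_deg //; have := mlead_supp fi.
rewrite mcoeff_msupp mcoeff_deriv => h.
have : (mlead f^`M(i) + U_(i))%MM \in msupp f.
  by rewrite mcoeff_msupp; apply: contraNneq h => ->; rewrite mul0rn.
by move=> /msize_mdeg_lt; rewrite mdegD mdeg1 addn1.
Qed.

(** In characteristic $0$, vanishing of these derivatives expresses that only the variables of [T]
    occur. *)
Definition only_vars (T : {set 'I_N}) (f : S) : Prop :=
  forall i, i \notin T -> f^`M(i) = 0.

Definition vars_indep (Q : set S) (T : {set 'I_N}) : Prop :=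
  forall f, only_vars T f -> Q f -> f = 0.

Lemma only_varsM T f g : only_vars T f -> only_vars T g -> only_vars T (f * g).
Proof. by move=> hf hg i iT; rewrite mderivM hf // hg // mul0r mulr0 addr0. Qed.

Lemma only_varsD T f g : only_vars T f -> only_vars T g -> only_vars T (f + g).
Proof. by move=> hf hg i iT; rewrite mderivD hf // hg // addr0. Qed.

Lemma only_varsC T c : only_vars T c%:MP.
Proof. by move=> i iT; rewrite mderivC. Qed.

Lemma mderivXU (i j : 'I_N) : ('X_j : S)^`M(i) = (i == j)%:R.
Proof.
rewrite mderivX mnm1E eq_sym; case: eqP => [->|_]; last by rewrite scale0r.
rewrite scale1r (_ : (U_(j) - U_(j))%MM = 0%MM) ?mpolyX0 //.
by apply/mnmP => l; rewrite mnmE subnn mnmE.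
Qed.

Lemma only_varsX (T : {set 'I_N}) i : i \in T -> only_vars T 'X_i.
Proof. by move=> iT j jT; rewrite mderivXU; case: eqP jT => // ->; rewrite iT. Qed.

Lemma only_varsS (T T' : {set 'I_N}) f : {subset T <= T'} -> only_vars T f -> only_vars T' f.
Proof. by move=> sT h i iT'; apply: h; apply: contra iT'; apply: sT. Qed.

Lemma only_vars_sum T m (F : 'I_m -> S) :
  (forall l, only_vars T (F l)) -> only_vars T (\sum_l F l).
Proof.
move=> h; apply: big_ind => //; last exact: only_varsD.
by rewrite -mpolyC0; apply: only_varsC.
Qed.

Lemma only_varsXn T f n : only_vars T f -> only_vars T (f ^+ n).
Proof.
move=> h; elim: n => [|n IH]; first by rewrite expr0 -mpolyC1; apply: only_varsC.
by rewrite exprS; apply: only_varsM.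
Qed.

(** [T] is a maximal set of variables independent modulo [Q]. Every other ['X_j] has a relation
    [G j] over [T] of least degree, whose derivative in ['X_j] is therefore outside [Q]; [psi] is
    the product of these derivatives. Where it does not vanish, a tangent vector is determined by
    its coordinates in [T]. *)
Lemma exists_transcendence_basis (Q : set S) : is_prime setT Q ->
  exists T : {set 'I_N}, vars_indep Q T /\
  exists2 psi : S, ~ Q psi & forall v, psi.@[v] != 0 ->
    forall w : 'cV_N, tangent Q v w -> (forall i, i \in T -> w i 0 = 0) -> w = 0.
Proof.
move=> pQ; have hQ := prime_is_ideal pQ.
have ind0 : vars_indep Q finset.set0.
  move=> f h Qf; have fC : f = (f@_0%MM)%:MP by apply: mderiv_all_eq0 => i; apply: h; rewrite inE.
  rewrite fC; apply/eqP; rewrite mpolyC_eq0; apply: contrapT => /negP f0.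
  case: pQ => _ Q1 _; apply: Q1.
  by have := idealM (f@_0%MM)^-1%:MP hQ Qf; rewrite fC -mpolyCM mcoeffC eqxx mulr1 mulVf.
pose p (T : {set 'I_N}) := `[< vars_indep Q T >].
have p0 : p finset.set0 by apply/asboolP.
case: (arg_maxnP (fun T : {set 'I_N} => #|T|) p0) => T /asboolP indT maxT.
exists T; split=> //.
have /choice[G GP] : forall j, exists G : S, j \notin T ->
    [/\ only_vars (j |: T) G, Q G & ~ Q G^`M(j)].
  move=> j; have [jT|jT] := boolP (j \in T); first by exists 0.
  have /existsNP[G0 /not_implyP[v0 /not_implyP[Q0 /eqP n0]]] : ~ vars_indep Q (j |: T).
    move=> h; have := maxT (j |: T) (asboolT h).
    by rewrite cardsU1 jT /= add1n => h'; move: (leq_ltn_trans h' (ltnSn _)); rewrite ltnn.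
  pose P n := `[< exists G, [/\ only_vars (j |: T) G, Q G, G != 0 & msize G = n] >].
  have exP : exists n, P n by exists (msize G0); apply/asboolP; exists G0.
  case: (ex_minnP exP) => n /asboolP[G [vG QG nG <-]] Gmin.
  exists G => _; split=> // QG'.
  have G'0 : G^`M(j) = 0.
    apply/eqP; apply: contrapT => /negP G'0; have := msize_mderiv G'0.
    rewrite ltnNge => /negP; apply; apply: Gmin; apply/asboolP; exists G^`M(j); split=> //.
    by move=> i iT; rewrite mderiv_comm vG // mderiv0.
  case/eqP: nG; apply: indT => // i iT; have [->|ij] := eqVneq i j; first by [].
  by apply: vG; rewrite !inE negb_or ij.
exists (\prod_(j in ~: T) (G j)^`M(j)).
  apply: (big_ind (fun x => ~ Q x)) => [|x y nx ny /(primeM pQ)[]|j] //.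
    by case: pQ.
  by rewrite inE => /GP[].
move=> v; rewrite rmorph_prod => /prodf_neq0 h w tw w0.
have wE j : w j 0 = 0.
  have [/w0//|jT] := boolP (j \in T).
  have [vG QG _] := GP j jT.
  have := congr1 (fun M : 'M_1 => M 0 0) (tw _ QG).
  rewrite !mxE (bigD1 j) //= big1 => [|i ij].
    rewrite addr0 mxE => /eqP; rewrite mulf_eq0 => /orP[/eqP E|/eqP //].
    by have := h j; rewrite inE jT /= E eqxx => /(_ isT).
  rewrite mxE; have [iT|iT] := boolP (i \in T); first by rewrite w0 ?mulr0.
  by rewrite vG ?meval0 ?mul0r // !inE negb_or ij.
by apply/colP => j; rewrite wE mxE.
Qed.
End CharZero.

Section IndependentDerivations.
Variable L : fieldType.
Hypothesis char0L : forall n, n.+1%:R != 0 :> L.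

(** The zero derivation of the lower ring is given the value $1$ at the transcendental element, then
    extended in any way to the remaining generators. *)
Lemma exists_derivation_one (A : set L) (zs ws : seq L) a : subring A ->
  (a < size zs)%N -> transcendental (gen A (drop a.+1 zs)) (nth 0 zs a) ->
  exists d, [/\ derivation_on (gen A (ws ++ zs)) d,
    forall x, gen A (drop a.+1 zs) x -> d x = 0 & d (nth 0 zs a) = 1].
Proof.
move=> sA lt_a tr; have sB := gen_subring (drop a.+1 zs) sA.
have h0 : derivation_on (gen A (drop a.+1 zs)) (fun=> 0).
  by split=> x y _ _; rewrite ?addr0 // mul0r mulr0 addr0.
case: (der_extend_at sB h0 (w := nth 0 zs a) (xi := 1)) => [p hp /(tr p hp) ->|d1 [h1 e1 one]].
  by rewrite /der_at -polyC0 (map_der_polyC sB h0) derivC !hornerC mul0r addr0.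
have [d2 [h2 e2]] := der_extend_gen (ws ++ take a zs) char0L (adjoin_subring _ sB) h1.
exists d2; split.
- rewrite -(cat_take_drop a zs) (drop_nth 0 lt_a) catA gen_cat /=; exact: h2.
- by move=> x Bx; rewrite e2 ?e1 //; apply: sub_adjoin.
- by rewrite e2 //; apply: mem_adjoin.
Qed.
End IndependentDerivations.

Section NestedPrimes.
Variables (k : fieldType) (N : nat).
Hypothesis char0 : forall n, n.+1%:R != 0 :> k.
Local Notation S := {mpoly k[N]}.

Lemma mderiv_horner (i : 'I_N) (H : {poly S}) : (forall l, (H`_l)^`M(i) = 0) ->
  (H.['X_i])^`M(i) = (H^`()).['X_i].
Proof.
elim/poly_ind: H => [|H c IH] h; first by rewrite deriv0 !horner0 mderiv0.
have hc : c^`M(i) = 0 by have := h 0%N; rewrite coefD coefMX coefC /= add0r.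
have hH l : (H`_l)^`M(i) = 0 by have := h l.+1; rewrite coefD coefMX coefC /= addr0.
rewrite derivD derivM derivX derivC addr0 mulr1 !hornerE mderivD mderivM hc addr0.
by rewrite IH // mderivXU eqxx mulr1.
Qed.

(** When the coefficients do not involve ['X_i], the partial derivative acts as the formal
    derivative, and induction on the degree applies. *)
Lemma horner_var_eq0 (i : 'I_N) (H : {poly S}) :
  (forall l, (H`_l)^`M(i) = 0) -> H.['X_i] = 0 -> H = 0.
Proof.
have [n] := ubnP (size H); elim: n H => // n IH H lt_n h H0.
have [//|nH] := eqVneq H 0.
have H'0 : H^`() = 0.
  apply: IH.
  - by apply: leq_trans (lt_size_deriv nH) _; rewrite -ltnS.
  - by move=> l; rewrite coef_deriv mderivMn h mul0rn.
  - by rewrite -mderiv_horner // H0 mderiv0.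
have HC : H = (H`_0)%:P.
  apply/polyP => l; rewrite coefC; case: l => [//|l] /=.
  have := congr1 (fun p : {poly S} => p`_l) H'0; rewrite coef_deriv coef0 => /eqP.
  by rewrite -mulr_natr mulf_eq0 -mpolyC_nat mpolyC_eq0 (negPf (char0 l)) orbF => /eqP.
by rewrite HC; rewrite HC hornerC in H0; rewrite H0.
Qed.

Variables (P Q : set S) (T : {set 'I_N}) (y : S).
Hypotheses (pP : is_prime setT P) (hQ : is_ideal setT Q) (PQ : P `<=` Q)
  (indT : vars_indep Q T) (Qy : Q y) (nPy : ~ P y).
Variables (L : fieldType) (pi : {rmorphism S -> L}).
Hypothesis piP : forall x, pi x = 0 <-> P x.

Let A0 : set L := [set pi c%:MP | c in [set: k]].

Lemma constants_subring : subring A0.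
Proof.
split; first by exists 1; rewrite ?rmorph1.
  by move=> _ _ [a _ <-] [b _ <-]; exists (a - b) => //; rewrite mpolyCB rmorphB.
by move=> _ _ [a _ <-] [b _ <-]; exists (a * b) => //; rewrite mpolyCM rmorphM.
Qed.

Let piX (s : seq 'I_N) : seq L := [seq pi 'X_i | i <- s].

Lemma gen_vars s z : gen A0 (piX s) z ->
  exists2 G : S, z = pi G & only_vars [set i in s] G.
Proof.
elim: s z => [|i s IH] z /=.
  by move=> [c _ <-]; exists c%:MP => //; apply: only_varsC.
move=> [p hp ->].
have /choice[G GP] : forall l, exists G : S, p`_l = pi G /\ only_vars [set i in s] G.
  by move=> l; have [G ? ?] := IH _ (hp l); exists G.
exists (\sum_(l < size p) G l * 'X_i ^+ l).
  rewrite horner_coef rmorph_sum; apply: eq_bigr => l _.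
  by rewrite rmorphM rmorphXn (GP l).1.
apply: only_vars_sum => l; apply: only_varsM; last first.
  by apply: only_varsXn; apply: only_varsX; rewrite !inE eqxx.
by apply: only_varsS (GP l).2 => j; rewrite !inE => ->; rewrite orbT.
Qed.

Lemma poly_gen_vars s p : poly_in (gen A0 (piX s)) p ->
  exists2 H : {poly S}, p = map_poly pi H & forall l, only_vars [set i in s] H`_l.
Proof.
move=> hp.
have /choice[G GP] : forall l, exists G : S, p`_l = pi G /\ only_vars [set i in s] G.
  by move=> l; have [G ? ?] := gen_vars (hp l); exists G.
exists (\poly_(l < size p) G l).
  apply/polyP => l; rewrite coef_map coef_poly; case: ltnP => h; first exact: (GP l).1.
  by rewrite nth_default //; symmetry; apply: rmorph0.
move=> l; rewrite coef_poly; case: ltnP => _; first exact: (GP l).2.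
by rewrite -mpolyC0; apply: only_varsC.
Qed.

Lemma only_vars_horner (U : {set 'I_N}) (H : {poly S}) f :
  (forall l, only_vars U H`_l) -> only_vars U f -> only_vars U H.[f].
Proof.
move=> hH hf; rewrite horner_coef; apply: only_vars_sum => l.
by apply: only_varsM => //; apply: only_varsXn.
Qed.

Lemma var_transcendental s i : {subset s <= T} -> i \in T -> i \notin s ->
  transcendental (gen A0 (piX s)) (pi 'X_i).
Proof.
move=> sT iT nis p /poly_gen_vars[H -> hH].
rewrite horner_map => /piP /PQ QH.
rewrite (@horner_var_eq0 i H) ?rmorph0 //; first by move=> l; apply: hH; rewrite inE.
apply: indT => //; apply: only_vars_horner; last exact: only_varsX.
by move=> l; apply: only_varsS (hH l) => j; rewrite inE => /sT.
Qed.

(** In a relation for [y] modulo [P] over the variables of [T], the constant coefficient lies in [Q]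
    because [y] does, so it is $0$; as [y] is outside the prime [P], it can then be cancelled. *)
Lemma extra_transcendental : transcendental (gen A0 (piX (enum T))) (pi y).
Proof.
move=> p /poly_gen_vars[H -> hH]; rewrite horner_map => /piP.
have {}hH l : only_vars T H`_l.
  by apply: only_varsS (hH l) => j; rewrite inE mem_enum.
elim/poly_ind: H hH => [|H c IH] hH; first by rewrite map_poly0.
have hc : only_vars T c by have := hH 0%N; rewrite coefD coefMX coefC /= add0r.
have hH' l : only_vars T H`_l by have := hH l.+1; rewrite coefD coefMX coefC /= addr0.
rewrite !hornerE => Py; have Qc : Q c.
  by rewrite -[c](addKr (H.[y] * y)) addrC; apply: idealB => //; [exact: PQ | exact: idealM].
have c0 := indT hc Qc; rewrite c0 addr0 in Py *.
by rewrite polyC0 addr0 rmorphM /= IH ?mul0r //; case: (primeM pP Py).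
Qed.

(** Modulo [P], the element [y] and the variables of [T] are algebraically independent. The rows of
    [V] are derivations dual to them up to a triangular matrix, so the tangent space of [P] over its
    function field has dimension at least [#|T|.+1]. *)
Lemma nested_prime_derivations : exists V : 'M[L]_(#|T|.+1, N), row_free V /\
  forall F, P F -> forall a, \sum_i V a i * pi F^`M(i) = 0.
Proof.
have char0L n : n.+1%:R != 0 :> L.
  apply/eqP => h; have /piP : pi n.+1%:R = 0 by rewrite rmorph_nat.
  move=> Pn; have [hP P1 _] := pP; apply: P1.
  have := idealM (n.+1%:R^-1 : k)%:MP hP Pn.
  by rewrite -mpolyC_nat -mpolyCM mulVf.
have sA := constants_subring.
pose gs : seq S := y :: [seq 'X_i | i <- enum T].
pose zs := [seq pi g | g <- gs]; pose ws := piX (enum 'I_N).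
have szs : size zs = #|T|.+1 by rewrite /= !size_map -cardE.
have tr a : (a < size zs)%N -> transcendental (gen A0 (drop a.+1 zs)) (nth 0 zs a).
  case: a => [|a]; rewrite szs ltnS => lt_a.
    rewrite /= drop0 -map_comp; exact: extra_transcendental.
  have lt_a' : (a < size (enum T))%N by rewrite -cardE.
  rewrite /= -map_comp -map_drop; case: (enum T) lt_a' (enum_uniq T) (mem_enum T) => // i0 s lt_a' us ms.
  rewrite (nth_map i0) //; apply: var_transcendental.
  - by move=> j /mem_drop; rewrite ms.
  - by rewrite -ms mem_nth.
  - move: us; rewrite -{1}(cat_take_drop a (i0 :: s)) (drop_nth i0 lt_a') cat_uniq /=.
    by case/and4P.
have /choice[d dP] : forall a : 'I_(#|T|.+1), exists d, [/\ derivation_on (gen A0 (ws ++ zs)) d,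
    forall x, gen A0 (drop a.+1 zs) x -> d x = 0 & d (nth 0 zs a) = 1].
  by move=> a; apply: exists_derivation_one => //; [rewrite szs | apply: tr; rewrite szs].
have Gpi f : gen A0 (ws ++ zs) (pi f).
  have [B1 BB BM] := gen_subring (ws ++ zs) sA.
  move: f; apply: mpoly_ring_ind.
  - by move=> c; apply: sub_gen => //; exists c.
  - move=> i; apply: mem_gen => //; rewrite mem_cat; apply/orP; left.
    by apply: map_f; rewrite mem_enum.
  - by move=> f g hf hg; rewrite rmorphD; apply: subringD => //; apply: gen_subring.
  - by move=> f g hf hg; rewrite rmorphM; apply: BM.
have chain a f : d a (pi f) = \sum_i pi f^`M(i) * d a (pi 'X_i).
  have [[dD dM] d0 _] := dP a.
  apply: (pi_derivation_chain (E := fun f => d a (pi f))).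
  - by move=> c; apply: d0; apply: sub_gen => //; exists c.
  - by move=> g h; rewrite rmorphD dD.
  - by move=> g h; rewrite rmorphM dM.
exists (\matrix_(a, i) d a (pi 'X_i)); split; last first.
  move=> F PF a; under eq_bigr do rewrite mxE mulrC.
  have [hd _ _] := dP a.
  rewrite -chain (piP F).2 //; exact: derivation_on0 (gen_subring _ sA) hd.
(* By the chain rule, the entries of [V *m J] are the values of the derivations on [y] and the
   variables of [T]: the matrix is triangular with ones on the diagonal. *)
pose J : 'M[L]_(N, #|T|.+1) := \matrix_(i, b) pi (nth 0 gs b)^`M(i).
set V := \matrix_(a, i) _.
have VJ a b : (V *m J) a b = d a (nth 0 zs b).
  rewrite mxE (nth_map 0); last by rewrite -(size_map pi) szs.
  by rewrite chain; apply: eq_bigr => i _; rewrite !mxE mulrC.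
have tVJ : is_trig_mx (V *m J).
  apply/is_trig_mxP => a b lt_ab; rewrite VJ; have [_ d0 _] := dP a; apply: d0.
  apply: mem_gen => //; rewrite -(subnKC lt_ab) -nth_drop mem_nth // size_drop szs.
  by have := ltn_ord b; lia.
have uVJ : (V *m J) \in unitmx.
  rewrite unitmxE det_trig // big1 ?unitr1 // => a _; rewrite VJ.
  by have [_ _ ->] := dP a.
rewrite -row_leq_rank; have := mxrankM_maxl V J; by rewrite (mxrank_unit uVJ).
Qed.
End NestedPrimes.

(** * Tangent frames *)

Section LinearAlgebra.
Variable F : fieldType.

Lemma kernel_basis m n d (A : 'M[F]_(m, n)) : (\rank A + d = n)%N ->
  exists K : 'M[F]_(n, d), \rank K = d /\
    forall w : 'cV_n, A *m w = 0 <-> exists z, w = K *m z.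
Proof.
move=> rA; have E : \rank (kermx A^T) = d by rewrite mxrank_ker mxrank_tr; apply/eqP; rewrite -(eqn_add2l (\rank A)) subnKC ?rA // -{2}rA leq_addr.
have [B [rB eB]] : exists B : 'M[F]_(d, n), \rank B = d /\ (B :=: kermx A^T)%MS.
  by case: _ / E; exists (row_base (kermx A^T)); split; [rewrite eq_row_base | apply: eq_row_base].
exists B^T; split=> [|w]; first by rewrite mxrank_tr.
split=> [Aw|[z ->]].
  have : (w^T <= B)%MS by rewrite eB; apply/sub_kermxP; rewrite -trmx_mul Aw trmx0.
  by move=> /submxP[z /(congr1 trmx)]; rewrite trmxK trmx_mul => ->; exists z^T.
apply: trmx_inj; rewrite !trmx_mul trmx0 trmxK -mulmxA.
by have /sub_kermxP -> : (B <= kermx A^T)%MS; rewrite ?mulmx0 // eB.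
Qed.

Lemma row_free_extend m n (x : 'rV[F]_n) (M : 'M[F]_(m, n)) :
  row_free M -> ~~ (x <= M)%MS -> row_free (col_mx x M).
Proof.
move=> rg nx.
rewrite -kermx_eq0; apply/rowV0P => u /sub_kermxP.
rewrite -[u]hsubmxK; move: (lsubmx u) (rsubmx u) => a b.
rewrite mul_row_col [a]mx11_scalar mul_scalar_mx; set c := a 0 0 => E.
have c0 : c = 0.
  apply/eqP; apply: contrapT => /negP c0; apply: (negP nx).
  have -> : x = - c^-1 *: (b *m M).
    move/eqP: E; rewrite addr_eq0 => /eqP E.
    by rewrite -[_ *m _]opprK -E scaleNr scalerN opprK scalerA mulVf // scale1r.
  by rewrite scalemx_sub // submxMl.
rewrite c0 scale0r add0r in E; rewrite c0 raddf0.
have -> : b = 0 by apply: (row_free_inj rg); rewrite E mul0mx.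
exact: row_mx0.
Qed.

Lemma inj_rank m n (A : 'M[F]_(m, n)) :
  (forall w : 'cV_n, A *m w = 0 -> w = 0) -> \rank A = n.
Proof.
move=> h; rewrite -mxrank_tr; apply/eqP; rewrite -/(row_free A^T) -kermx_eq0.
apply/rowV0P => u /sub_kermxP E; apply: trmx_inj; rewrite trmx0; apply: h.
by apply: trmx_inj; rewrite trmx_mul trmxK E trmx0.
Qed.

Lemma rank_of_mul_unit m n (A : 'M[F]_(m, n)) (B : 'M[F]_(n, m)) :
  \det (A *m B) != 0 -> \rank A = m.
Proof.
move=> h; apply/eqP; rewrite eqn_leq rank_leq_row /=.
by rewrite -{1}(mxrank_unit (A := A *m B)) ?mxrankM_maxl // unitmxE unitfE.
Qed.

Lemma max_row_free n (G : set 'rV[F]_n) : exists m (g : 'I_m -> 'rV[F]_n),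
  [/\ forall i, G (g i), row_free (\matrix_i g i)
    & forall x, G x -> (x <= \matrix_i g i)%MS].
Proof.
pose P m := `[< exists g : 'I_m -> 'rV[F]_n, (forall i, G (g i)) /\ row_free (\matrix_i g i) >].
have exP : exists m, P m.
  exists 0%N; apply/asboolP; exists (fun=> 0); split=> [[]|] //.
  by rewrite -row_leq_rank.
have bP m : P m -> (m <= n)%N.
  by move=> /asboolP[g [_ /eqP <-]]; apply: rank_leq_col.
case: (ex_maxnP exP bP) => m /asboolP[g [Gg rg]] mmax.
exists m, g; split=> // x Gx; apply: contrapT => /negP nx.
suff : P m.+1 by move=> /mmax; rewrite ltnn.
apply/asboolP; exists (fun i => if unlift ord0 i is Some j then g j else x); split.
  by move=> i; case: (unlift ord0 i).
have -> : \matrix_i (if unlift ord0 i is Some j then g j else x)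
        = col_mx x (\matrix_i g i) :> 'M_(1 + m, n).
  apply/row_matrixP => i; rewrite rowK; case: (unliftP ord0 i) => [j ->|->].
    have -> : lift ord0 j = rshift 1 j by apply/val_inj.
    by rewrite rowKd rowK.
  have -> : @ord0 m = lshift m (@ord0 0) by apply/val_inj.
  by rewrite rowKu row_id.
exact: row_free_extend.
Qed.
End LinearAlgebra.

Section TangentFrame.
Variables (k : closedFieldType) (N : nat).
Hypothesis char0 : forall n, n.+1%:R != 0 :> k.
Local Notation S := {mpoly k[N]}.
Variables (P Q : set S) (y f0 : S).
Hypotheses (pP : is_prime setT P) (pQ : is_prime setT Q) (PQ : P `<=` Q)
  (Qy : Q y) (nPy : ~ P y) (Qf0 : ~ Q f0).
Hypothesis cutQ : forall q : 'I_N -> k, (forall g, Q g -> g.@[q] = 0) ->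
  f0.@[q] != 0 -> exists u : S,
  forall w, tangent P q w -> grad u q *m w = 0 -> tangent Q q w.

(** Let [M] be the Jacobian matrix of elements of [P] whose gradients at a point of [Q] form a basis
    of all gradients there, and [B] a constant right inverse of [M] at that point. Then [R] is
    [Delta] times the projection onto the kernel of [M] along the image of [B], made polynomial by
    the adjugate; its columns are vector fields tangent to [P]. The integer [m] is the number of
    variables in a maximal set independent modulo [Q]. *)
Lemma tangent_frame : exists (m : nat) (Delta psi : S) (R : 'M[S]_N),
  [/\ ~ Q Delta /\ ~ Q psi,
    forall F c, P F -> P (\sum_i F^`M(i) * R i c),
    forall p w, tangent P p w -> forall i, \sum_c (R i c).@[p] * w c 0 = Delta.@[p] * w i 0,
    forall p : 'I_N -> k, (forall g, P g -> g.@[p] = 0) -> Delta.@[p] != 0 ->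
      exists K : 'M[k]_(N, m.+1), \rank K = m.+1 /\
        forall w, tangent P p w <-> exists z, w = K *m z
  & exists2 T : {set 'I_N}, #|T| = m & forall p : 'I_N -> k, psi.@[p] != 0 ->
      forall w : 'cV_N, tangent Q p w -> (forall i, i \in T -> w i 0 = 0) -> w = 0].
Proof.
have [T [indT [psi Qpsi psiP]]] := exists_transcendence_basis char0 pQ.
have [L [pi piP]] := residue_field pP.
have [V [rV VP]] := nested_prime_derivations char0 pP (prime_is_ideal pQ) PQ indT Qy nPy piP.
have [q0 q0Q] : exists2 q, forall g, Q g -> g.@[q] = 0 & (psi * f0).@[q] != 0.
  by apply: prime_zero => // /(primeM pQ)[].
rewrite mevalM mulf_eq0 negb_or => /andP[psi0 f00].
have [u uP] := cutQ q0Q f00.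
have [rho [g [gP rg gspan]]] := max_row_free [set grad F q0 | F in P].
have /choice[F FP] : forall l, exists F, P F /\ grad F q0 = g l.
  by move=> l; have [F PF <-] := gP l; exists F.
pose M : 'M[S]_(rho, N) := \matrix_(l, i) (F l)^`M(i).
pose Mat (p : 'I_N -> k) : 'M[k]_(rho, N) := \matrix_l grad (F l) p.
have MatE p : Mat p = map_mx (meval p) M by apply/matrixP => l i; rewrite !mxE.
have Mq0 : Mat q0 = \matrix_i g i by apply/row_matrixP => l; rewrite !rowK (FP l).2.
pose B0 := pinvmx (Mat q0); have MB0 : Mat q0 *m B0 = 1%:M by apply: mulmxVp; rewrite Mq0.
pose B : 'M[S]_(N, rho) := map_mx (@mpolyC N k) B0.
pose Delta := \det (M *m B).
pose R : 'M[S]_N := Delta%:M - B *m \adj (M *m B) *m M.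
have BE p : map_mx (meval p) B = B0 by apply/matrixP => i j; rewrite !mxE mevalC.
have DE p : Delta.@[p] = \det (Mat p *m B0).
  by rewrite /Delta -det_map_mx map_mxM BE -MatE.
have Dq0 : Delta.@[q0] = 1 by rewrite DE MB0 det1.
have nQD : ~ Q Delta by move=> /q0Q; rewrite Dq0 => /eqP; rewrite oner_eq0.
have nPD : ~ P Delta by move=> /PQ.
have MR : M *m R = 0.
  by rewrite mulmxBr 2!mulmxA mul_mx_adj mul_mx_scalar mul_scalar_mx subrr.
have chainM (G : S) p (w : 'cV_N) : (grad G p *m w) 0 0 = \sum_i (G^`M(i)).@[p] * w i 0.
  by rewrite mxE; apply: eq_bigr => i _; rewrite mxE.
have RE p : map_mx (meval p) R =
    (Delta.@[p])%:M - B0 *m \adj (Mat p *m B0) *m Mat p.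
  by rewrite map_mxB map_scalar_mx !map_mxM map_mx_adj map_mxM BE -MatE.
have tanM p w : tangent P p w -> Mat p *m w = 0.
  move=> tw; apply/row_matrixP => l; rewrite row_mul rowK row0.
  by apply: tw; have [] := FP l.
have Rw p (w : 'cV[k]_N) : Mat p *m w = 0 -> map_mx (meval p) R *m w = Delta.@[p] *: w.
  by move=> Mw; rewrite RE mulmxBl mul_scalar_mx -!mulmxA Mw !mulmx0 subr0.
have rML : \rank (map_mx pi M) = rho.
  apply: (rank_of_mul_unit (B := map_mx pi B)).
  by rewrite -map_mxM det_map_mx; apply/eqP => /piP.
have VM : V *m (map_mx pi M)^T = 0.
  apply/matrixP => a l; rewrite !mxE -[RHS](VP (F l) (FP l).1 a).
  by apply: eq_bigr => i _; rewrite !mxE.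
(* Orthogonality to the rows of [V] bounds [rho] above. For the lower bound, a vector killed at [q0]
   by the gradients, by that of [u] and by the coordinates in [T] is tangent to [Q], hence zero. *)
have rhoE : (rho + #|T|.+1 = N)%N.
  apply/eqP; rewrite eqn_leq; apply/andP; split.
    have := mulmx0_rank_max VM; rewrite mxrank_tr rML; move/eqP: rV => ->.
    by rewrite addnC.
  pose ET : 'M[k]_(#|T|, N) := \matrix_(a, i) (i == enum_val a)%:R.
  suff E : \rank (col_mx (Mat q0) (col_mx (grad u q0) ET)) = N.
    by have := rank_leq_row (col_mx (Mat q0) (col_mx (grad u q0) ET)); rewrite E.
  apply: inj_rank => w; rewrite !mul_col_mx -[0]vsubmxK => /eq_col_mx[].
  rewrite !linear0 => M0 /eqP; rewrite -[X in _ == X]vsubmxK => /eqP/eq_col_mx[].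
  rewrite !linear0 => u0 T0; apply: (psiP q0 psi0).
    apply: uP => // G PG; have /submxP[D ->] : (grad G q0 <= Mat q0)%MS.
      by rewrite Mq0; apply: gspan; exists G.
    by rewrite -mulmxA M0 mulmx0.
  move=> i iT; have := congr1 (fun X : 'cV_ _ => X (enum_rank_in iT i) 0) T0.
  rewrite !mxE (bigD1 i) //= mxE enum_rankK_in // eqxx mul1r big1 ?addr0 // => j ji.
  by rewrite mxE enum_rankK_in // (negPf ji) mul0r.
(* By the ranks, the rows of [M] span the whole orthogonal of [V] over the function field, so [R]
   kills the gradient of every element of [P]. *)
have PR G c : P G -> P (\sum_i G^`M(i) * R i c).
  move=> PG; apply/piP; pose Gl : 'rV[L]_N := \row_i pi G^`M(i).
  have /submxP[D GD] : (Gl <= map_mx pi M)%MS.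
    have VG : Gl *m V^T = 0.
      apply/rowP => a; rewrite !mxE -[RHS](VP G PG a).
      by apply: eq_bigr => i _; rewrite !mxE mulrC.
    have le1 : (map_mx pi M <= kermx V^T)%MS.
      by apply/sub_kermxP; rewrite -[map_mx pi M]trmxK -trmx_mul VM trmx0.
    have := mxrank_leqif_sup le1 => -[_].
    rewrite rML mxrank_ker mxrank_tr (eqP rV) -(canRL (addnK _) rhoE) eqxx => /esym le2.
    by apply: submx_trans le2; apply/sub_kermxP.
  have : Gl *m map_mx pi R = 0 by rewrite GD -mulmxA -map_mxM MR map_mx0 mulmx0.
  move=> /(congr1 (fun X : 'rV_N => X 0 c)); rewrite !mxE => E.
  by rewrite rmorph_sum -[RHS]E; apply: eq_bigr => i _; rewrite rmorphM !mxE.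
exists #|T|, Delta, psi, R; split=> //.
- move=> p w /tanM Mw i; have := congr1 (fun X : 'cV_N => X i 0) (Rw p w Mw).
  rewrite [LHS]mxE [RHS]mxE => <-; by apply: eq_bigr => c _; rewrite [in RHS]mxE.
- move=> p pP0 D0.
  have rMp : \rank (Mat p) = rho by apply: (rank_of_mul_unit (B := B0)); rewrite -DE.
  have [K [rK KP]] : exists K : 'M[k]_(N, #|T|.+1), \rank K = #|T|.+1 /\
      forall w : 'cV_N, Mat p *m w = 0 <-> exists z, w = K *m z.
    by apply: kernel_basis; rewrite rMp.
  exists K; split=> // w; rewrite -KP; split; first exact: tanM.
  move=> Mw G PG; have := Rw p w Mw => /(congr1 (fun X => grad G p *m X)).
  have -> : grad G p *m (map_mx (meval p) R *m w) = 0.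
    rewrite mulmxA (_ : grad G p *m _ = 0) ?mul0mx //.
    apply/rowP => c; rewrite !mxE -[RHS](pP0 _ (PR G c PG)) rmorph_sum.
    by apply: eq_bigr => i _; rewrite !mxE rmorphM.
  rewrite -scalemxAr => /esym/eqP; rewrite scaler_eq0 (negPf D0) => /eqP //.
- by exists T.
Qed.
End TangentFrame.

(** * Sections of twisted ideal sheaves *)

(** A copy of the fraction field that carries the structure of a vector space over $k$. *)
Definition fracmod (k : fieldType) (n : nat) : Type := {fraction {mpoly k[n]}}.
HB.instance Definition _ k n := GRing.Zmodule.on (@fracmod k n).

Section FracModule.
Variables (k : fieldType) (n : nat).

Definition frac_scale (a : k) (x : fracmod k n) : fracmod k n :=
  (tofrac a%:MP * (x : {fraction {mpoly k[n]}})).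

Lemma frac_scaleA a b x : frac_scale a (frac_scale b x) = frac_scale (a * b) x.
Proof. by rewrite /frac_scale mulrA -rmorphM /= mpolyCM. Qed.
Lemma frac_scale1 : left_id 1 frac_scale.
Proof. by move=> x; rewrite /frac_scale mpolyC1 rmorph1 mul1r. Qed.
Lemma frac_scaleDr : right_distributive frac_scale +%R.
Proof. by move=> a x y; rewrite /frac_scale mulrDr. Qed.
Lemma frac_scaleDl x : {morph frac_scale^~ x : a b / a + b}.
Proof. by move=> a b; rewrite /frac_scale mpolyCD rmorphD mulrDl. Qed.

HB.instance Definition _ := GRing.Zmodule_isLmodule.Build k (fracmod k n)
  frac_scaleA frac_scale1 frac_scaleDr frac_scaleDl.
End FracModule.

Lemma fraction_ratio_inv (F : fieldType) (x y a d : F) : x != 0 -> y != 0 -> d != 0 ->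
  (x / y)^-1 * (a / d) = y ^+ 2 * a / (x * y * d).
Proof. by move=> x0 y0 d0; field; rewrite d0 y0 x0. Qed.

Lemma fraction_ratio_pow (F : fieldType) (x y a : F) e : x != 0 -> y != 0 ->
  (x / y)^-1 ^+ e * (a / y ^+ (e * 2)) = a / (x * y) ^+ e.
Proof.
move=> x0 y0; rewrite mulnC exprM -exprVn invf_div expr_div_n expr2 exprMn.
have xe : x ^+ e != 0 by rewrite expf_neq0.
have ye : y ^+ e != 0 by rewrite expf_neq0.
by rewrite ?exprVn ?exprMn; field; rewrite xe ye.
Qed.

Lemma fraction_ratio_step (F : fieldType) (z z' : F) e (r : F) : r != 0 ->
  r^-1 ^+ e.+1 * z = r^-1 ^+ e * z' + r^-1 ^+ e.+1 * (z - r * z').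
Proof. by move=> r0; rewrite mulrBr [r^-1 ^+ _ * (r * _)]mulrA exprSr mulfVK // addrC subrK. Qed.

Section Sections.
Variables (k : closedFieldType) (n : nat).
Local Notation S := {mpoly k[n.+1]}.
Local Notation K := {fraction {mpoly k[n.+1]}}.
Local Notation I := 'I_n.+1.
Implicit Types (J M : set S) (ls : seq I).

Definition mons ls : S := \prod_(i <- ls) 'X_i.

Lemma mons_homog ls : mons ls \is (size ls).-homog.
Proof.
rewrite /mons; elim: ls => [|i ls IH]; first by rewrite big_nil dhomog1.
rewrite big_cons /= (_ : (size ls).+1 = 1 + size ls)%N //.
by apply: dhomogM => //; rewrite dhomogX; apply/eqP; apply: mdeg1.
Qed.

Lemma mpolyX_neq0 (i : I) : 'X_i != 0 :> S.
Proof. by rewrite -mleadc_eq0 mleadXm mcoeffX eqxx oner_eq0. Qed.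

Lemma mons_neq0 ls : mons ls != 0.
Proof. by rewrite /mons prodf_seq_neq0; apply/allP => i _; rewrite /= mpolyX_neq0. Qed.

Lemma tofrac_mons_neq0 ls e : tofrac (mons ls) ^+ e != 0.
Proof. by rewrite expf_neq0 // tofrac_eq0 mons_neq0. Qed.

(** The sections of $J(1)$ where the variables of [ls] do not vanish. Charts are indexed by lists,
    so that shrinking a chart is consing a variable. *)
Definition sec ls J : set (fracmod k n.+1) := [set x : K | exists (e : nat) (a : S),
  [/\ J a, a \is (1 + e * size ls).-homog
    & x = tofrac a / tofrac (mons ls) ^+ e]].

Definition sec_at ls J e (x : K) := exists a : S,
  [/\ J a, a \is (1 + e * size ls).-homog & x = tofrac a / tofrac (mons ls) ^+ e].

Lemma sec_up ls J e e' x : is_ideal setT J -> (e <= e')%N ->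
  sec_at ls J e x -> sec_at ls J e' x.
Proof.
move=> hJ le_e [a [Ja ha ->]]; exists (a * mons ls ^+ (e' - e)); split.
- exact: idealMl.
- have -> : (1 + e' * size ls = (1 + e * size ls) + size ls * (e' - e))%N.
    by rewrite -addnA [(size ls * _)%N]mulnC -mulnDl subnKC.
  by apply: dhomogM => //; apply: dhomogMn; apply: mons_homog.
- rewrite tofracM tofracXn -{2}(subnKC le_e) exprD invfM mulrACA.
  by rewrite mulfV ?mulr1 // tofrac_mons_neq0.
Qed.

Lemma sec_at_common ls ls' J J' x y : is_ideal setT J -> is_ideal setT J' ->
  sec ls J x -> sec ls' J' y ->
  exists e, sec_at ls J e x /\ sec_at ls' J' e y.
Proof.
move=> hJ hJ' [e hx] [e' hy]; exists (e + e')%N; split.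
- exact: sec_up (leq_addr _ _) hx.
- exact: sec_up (leq_addl _ _) hy.
Qed.

Lemma sec_subsp ls J : is_ideal setT J -> subsp (sec ls J).
Proof.
move=> hJ; split.
  by exists 0%N, 0; split; [apply: ideal0 | apply: dhomog0 | rewrite rmorph0 mul0r].
move=> c x y Jx Jy.
have [e [[a [Ja ha ->]] [b [Jb hb ->]]]] := sec_at_common hJ hJ Jx Jy.
exists e, (c%:MP * a + b); split.
- by apply: idealD => //; apply: idealM.
- by rewrite rpredD // mul_mpolyC dhomogZ.
- by rewrite rmorphD rmorphM mulrDl -mulrA.
Qed.

Lemma secS ls J J' : J `<=` J' -> sec ls J `<=` sec ls J'.
Proof. by move=> sJ x [e [a [Ja ha ->]]]; exists e, a; split=> //; apply: sJ. Qed.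

(** Once a variable is inverted, an ideal may be replaced by its saturation; hence the nonempty
    list. *)
Lemma sec_sat i ls J J' : is_ideal setT J' -> J `<=` saturation J' ->
  sec (i :: ls) J `<=` sec (i :: ls) J'.
Proof.
move=> hJ' sJ x [e [a [Ja ha ->]]]; have [m am] := sJ _ Ja.
have E : J' (a * mons (i :: ls) ^+ m).
  rewrite /mons big_cons exprMn mulrCA mulrA.
  by apply: idealMl.
exists (e + m)%N, (a * mons (i :: ls) ^+ m); split => //.
- rewrite mulnDl addnA [(m * _)%N]mulnC; apply: dhomogM => //.
  by apply: dhomogMn; apply: mons_homog.
- rewrite tofracM tofracXn exprD invfM mulrACA.
  by rewrite mulfV ?mulr1 // tofrac_mons_neq0.
Qed.

Lemma sec_eq ls e e' (a b : S) :
  tofrac a / tofrac (mons ls) ^+ e = tofrac b / tofrac (mons ls) ^+ e' ->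
  a * mons ls ^+ e' = b * mons ls ^+ e.
Proof.
move/eqP; rewrite eqr_div ?tofrac_mons_neq0 // -!tofracXn -!tofracM tofrac_eq.
by move/eqP.
Qed.

Lemma sec_cap ls J J' : is_ideal setT J -> is_ideal setT J' ->
  sec ls J `&` sec ls J' `<=` sec ls (J `&` J').
Proof.
move=> hJ hJ' x [Jx J'x].
have [e [[a [Ja ha Ea]] [b [Jb hb Eb]]]] := sec_at_common hJ hJ' Jx J'x.
exists e, a; split=> //; split=> //; have := sec_eq (etrans (esym Ea) Eb).
move=> /(mulIf (expf_neq0 _ (mons_neq0 _))) -> //.
Qed.

Lemma homog_pihomog J a d : homog_ideal J -> J a -> J (pihomog mdeg d a).
Proof. by case=> _ h /h. Qed.

Lemma sec_idsum ls J J' : homog_ideal J -> homog_ideal J' ->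
  sec ls (idsum J J') `<=` subspD (sec ls J) (sec ls J').
Proof.
move=> hJ hJ' x [e [_ [[b [c [Jb Jc ->]]] ha ->]]].
set d := (1 + e * size ls)%N in ha *.
exists (tofrac (pihomog mdeg d b) / tofrac (mons ls) ^+ e),
  (tofrac (pihomog mdeg d c) / tofrac (mons ls) ^+ e); split.
- by exists e, (pihomog mdeg d b); split=> //; [apply: homog_pihomog | apply: pihomogP].
- by exists e, (pihomog mdeg d c); split=> //; [apply: homog_pihomog | apply: pihomogP].
- by rewrite -mulrDl -tofracD -pihomogD pihomog_dE.
Qed.

Lemma mulr_div_cancel (a b c : K) : b != 0 -> a / c = (a * b) / (c * b).
Proof. by move=> b0; rewrite invfM mulrACA mulfV // mulr1. Qed.

Lemma mons_cons i ls : tofrac (mons (i :: ls)) = tofrac 'X_i * tofrac (mons ls).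
Proof. by rewrite /mons big_cons tofracM. Qed.

Lemma sec_cons i ls J : is_ideal setT J -> sec ls J `<=` sec (i :: ls) J.
Proof.
move=> hJ x [e [a [Ja ha ->]]]; exists e, (a * 'X_i ^+ e); split.
- exact: idealMl.
- rewrite /= mulnS addnCA addnC; apply: dhomogM => //.
  by rewrite -[X in X.-homog](mul1n e); apply: dhomogMn; rewrite dhomogX; apply/eqP; apply: mdeg1.
- rewrite mons_cons exprMn tofracM tofracXn [_ * tofrac (mons ls) ^+ e]mulrC.
  by rewrite -mulr_div_cancel // expf_neq0 // tofrac_eq0 mpolyX_neq0.
Qed.

Lemma sec_perm ls ls' J : perm_eq ls ls' -> sec ls J = sec ls' J.
Proof. by move=> h; rewrite /sec /mons (perm_big _ h) (perm_size h). Qed.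

(** The hypothesis makes ['X_j] a non-zero-divisor on the quotient sheaf, so membership in the
    smaller sheaf can be tested after inverting ['X_j]. *)
Lemma sec_descend j i ls M M' : is_ideal setT M -> is_ideal setT M' ->
  (forall f m d, f \is d.-homog -> M f -> M' ('X_j ^+ m * f) -> saturation M' f) ->
  sec (i :: ls) M `&` sec [:: j, i & ls] M' `<=` sec (i :: ls) M'.
Proof.
move=> hM hM' h x [Mx M'x].
have [e [[a [Ja ha Ea]] [b [Jb hb Eb]]]] := sec_at_common hM hM' Mx M'x.
have sat : saturation M' (a * mons (i :: ls) ^+ e).
  apply: (h _ e (1 + e * size (i :: ls) + size (i :: ls) * e)%N).
  - by apply: dhomogM => //; apply: dhomogMn; apply: mons_homog.
  - exact: idealMl.
  have : tofrac (a * 'X_j ^+ e) / tofrac (mons [:: j, i & ls]) ^+ e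
       = tofrac b / tofrac (mons [:: j, i & ls]) ^+ e.
    rewrite -Eb Ea (mons_cons j (i :: ls)) exprMn tofracM tofracXn.
    rewrite [tofrac 'X_j ^+ e * _]mulrC -mulr_div_cancel //.
    by rewrite expf_neq0 // tofrac_eq0 mpolyX_neq0.
  move=> /sec_eq /(mulIf (expf_neq0 _ (mons_neq0 _))) E.
  by rewrite mulrA [_ * a]mulrC E; apply: idealMl.
have := sec_sat (i := i) (ls := ls) hM' (J := saturation M') (fun x => id).
apply; exists (e + e)%N, (a * mons (i :: ls) ^+ e); split=> //.
- rewrite mulnDl addnA [(e * _)%N in X in (_ + X)%N]mulnC; apply: dhomogM => //.
  by apply: dhomogMn; apply: mons_homog.
- by rewrite Ea tofracM tofracXn exprD -mulr_div_cancel ?tofrac_mons_neq0.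
Qed.

Lemma sec_family ls J m (v : 'I_m -> fracmod k n.+1) : is_ideal setT J ->
  (forall l, sec ls J (v l)) ->
  exists e0, forall e, (e0 <= e)%N -> exists a : 'I_m -> S, forall l,
    [/\ J (a l), a l \is (1 + e * size ls).-homog
      & v l = tofrac (a l) / tofrac (mons ls) ^+ e].
Proof.
move=> hJ /choice[f fP]; exists (\max_l f l) => e le_e.
have /choice[a aP] : forall l, sec_at ls J e (v l).
  by move=> l; apply: sec_up (fP l) => //; apply: leq_trans le_e; apply: (leq_bigmax l).
by exists a.
Qed.

Lemma sum_scale_tofrac m (c : 'I_m -> k) (a : 'I_m -> S) (d : K) :
  \sum_l c l *: (tofrac (a l) / d : fracmod k n.+1)
    = tofrac (\sum_l (c l)%:MP * a l) / d :> K.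
Proof.
rewrite raddf_sum mulr_suml; apply: eq_bigr => l _.
by rewrite /GRing.scale /= /frac_scale tofracM mulrA.
Qed.

Lemma homog_sum m (c : 'I_m -> k) (a : 'I_m -> S) d :
  (forall l, a l \is d.-homog) -> \sum_l (c l)%:MP * a l \is d.-homog.
Proof.
by move=> h; apply: rpred_sum => l _; rewrite mul_mpolyC dhomogZ.
Qed.

Variables (M M' : set S) (j : I).
Hypotheses (hM : is_ideal setT M) (hM' : is_ideal setT M').
Hypothesis nzd : forall f m d, f \is d.-homog -> M f -> M' ('X_j ^+ m * f) -> saturation M' f.

(** For the same reason, a family independent on the chart of [i] yields one of the same length on
    the chart of [j]. *)
Lemma qdim_chart i delta : has_qdim (sec [:: j] M) (sec [:: j] M') delta ->
  exists d, has_qdim (sec [:: i] M) (sec [:: i] M') d.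
Proof.
move=> qj; have sM' := sec_subsp [:: i] hM'.
have [|d _] := @qdim_exists _ _ (sec [:: i] M) _ delta sM'; last by exists d.
move=> m v vM vI; have [e /(_ e (leqnn e))[a aP]] := sec_family hM vM.
apply: (qdim_indep (sec_subsp [:: j] hM')
  (v := fun l => tofrac (a l) / tofrac (mons [:: j]) ^+ e : fracmod k n.+1) _ _ qj).
  by move=> l; exists e, (a l); have [? ? _] := aP l.
move=> c; rewrite sum_scale_tofrac => -[e' [b [Mb hb Eb]]]; apply: vI.
have -> : \sum_l c l *: v l = tofrac (\sum_l (c l)%:MP * a l) / tofrac (mons [:: i]) ^+ e.
  by rewrite -sum_scale_tofrac; apply: eq_bigr => l _; have [_ _ ->] := aP l.
apply: (sec_sat (J := saturation M') hM' (fun x => id)).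
exists e, (\sum_l (c l)%:MP * a l); split=> //; last first.
  by apply: homog_sum => l; have [] := aP l.
apply: (nzd (m := e') (d := (1 + e * size [:: i])%N)).
  by apply: homog_sum => l; have [] := aP l.
  by apply: ideal_sum => // l _; apply: idealM => //; have [] := aP l.
have := sec_eq Eb; rewrite {1}/mons big_seq1 mulrC => ->; exact: idealMl.
Qed.

Local Notation ratio i := (tofrac 'X_j / tofrac 'X_i : K).

Lemma sec1_ratio J i x : is_ideal setT J -> sec [:: i] J x -> sec [:: i] J (ratio i * (x : K)).
Proof.
move=> hJ [e [a [Ja ha ->]]]; exists e.+1, ('X_j * a); split.
- exact: idealM.
- rewrite (_ : (1 + e.+1 * size [:: i] = 1 + (1 + e * size [:: i]))%N) /=; last by lia.
  by apply: dhomogM => //; rewrite dhomogX; apply/eqP; apply: mdeg1.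
- by rewrite mulrACA -invfM /mons big_seq1 -exprS -tofracM.
Qed.

Lemma sec2_ratio_inv J i x : is_ideal setT J ->
  sec [:: j; i] J x -> sec [:: j; i] J ((ratio i)^-1 * (x : K)).
Proof.
move=> hJ [e [a [Ja ha ->]]]; exists e.+1, ('X_i ^+ 2 * a); split.
- exact: idealM.
- rewrite (_ : (1 + e.+1 * size [:: j; i] = 1 * 2 + (1 + e * size [:: j; i]))%N) /=; last by lia.
  apply: dhomogM => //; apply: dhomogMn.
  by rewrite dhomogX; apply/eqP; apply: mdeg1.
- have Xi0 : tofrac 'X_i != 0 :> K by rewrite tofrac_eq0 mpolyX_neq0.
  have Xj0 : tofrac 'X_j != 0 :> K by rewrite tofrac_eq0 mpolyX_neq0.
  have D0 := tofrac_mons_neq0 [:: j; i] e.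
  rewrite tofracM tofracXn [tofrac (mons _) ^+ e.+1]exprS; move: D0; set D := _ ^+ e.
  rewrite mons_cons /mons big_seq1 => D0.
  exact: (fraction_ratio_inv (tofrac a) Xj0 Xi0 D0).
Qed.

Lemma ratio_neq0 i : ratio i != 0.
Proof. by rewrite mulf_neq0 ?invr_eq0 ?tofrac_eq0 ?mpolyX_neq0. Qed.

(** On the chart of [i] the quotient has finite dimension and multiplication by $x_j/x_i$ is
    injective on it, hence bijective: inverting $x_j$ creates no new class. *)
Lemma sec_localize i delta : has_qdim (sec [:: j] M) (sec [:: j] M') delta ->
  sec [:: j; i] M `<=` subspD (sec [:: i] M) (sec [:: j; i] M').
Proof.
move=> /(@qdim_chart i)[d qd]; have [v [vM vS vI]] := qd.
have s1 := sec_subsp [:: i] hM'; have s2 := sec_subsp [:: j; i] hM'.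
pose w l : fracmod k n.+1 := ratio i * (v l : K).
have sumw c : \sum_l c l *: w l = ratio i * (\sum_l c l *: v l : K) :> K.
  rewrite mulr_sumr; apply: eq_bigr => l _.
  by rewrite /GRing.scale /= /frac_scale /w mulrCA.
have wI : indep (sec [:: i] M') w.
  move=> c; rewrite sumw => h; apply: vI.
  apply: (sec_descend (j := j) hM hM' nzd); split.
    by apply: subsp_lc => //; apply: sec_subsp.
  rewrite -[X in sec _ _ X](mulKf (ratio_neq0 i)).
  exact/sec2_ratio_inv/sec_cons.
have wS z : sec [:: i] M z -> exists c : 'I_d -> k, sec [:: i] M' (z - \sum_l c l *: w l).
  move=> Mz; apply: contrapT => nz.
  have := indep_extend s1 wI (fun c h => nz (ex_intro _ c h)) => h.
  suff : (d.+1 <= d)%N by rewrite ltnn.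
  apply: (qdim_indep s1 _ h qd) => l; case: (unlift ord_max l) => [l'|] //.
  exact: sec1_ratio.
have inv e : forall z, sec [:: i] M z ->
    subspD (sec [:: i] M) (sec [:: j; i] M') ((ratio i)^-1 ^+ e * (z : K)).
  elim: e => [|e IH] z Mz.
    by exists z, 0; rewrite mul1r addr0; split=> //; case: s2.
  have [c Mc] := wS z Mz; pose z' : fracmod k n.+1 := \sum_l c l *: v l.
  have Mz' : sec [:: i] M z' by apply: subsp_lc => //; apply: sec_subsp.
  have [x [y [Mx My E]]] := IH z' Mz'.
  exists x, (y + (ratio i)^-1 ^+ e.+1 * (z - ratio i * (z' : K))); split=> //.
    apply: subsp_add => //; elim: (e.+1) => [|e' IHe].
      by rewrite mul1r; apply: sec_cons => //; rewrite -sumw.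
    by rewrite exprS -mulrA; apply: sec2_ratio_inv.
  by rewrite addrA -E; exact: (fraction_ratio_step z z' e (ratio_neq0 i)).
(* The denominator $(x_jx_i)^e$ is $x_i^{2e}(x_j/x_i)^e$. *)
move=> x [e [a [Ma ha ->]]].
have Xi0 : tofrac 'X_i != 0 :> K by rewrite tofrac_eq0 mpolyX_neq0.
have Xj0 : tofrac 'X_j != 0 :> K by rewrite tofrac_eq0 mpolyX_neq0.
have E1 : tofrac (mons [:: i]) = tofrac 'X_i by rewrite /mons big_seq1.
have := inv e (tofrac a / tofrac (mons [:: i]) ^+ (e * 2)).
rewrite [in (ratio i)^-1 ^+ e * _]E1 (fraction_ratio_pow (tofrac a) e Xj0 Xi0) -E1 -mons_cons.
by apply; exists (e * 2)%N, a; split=> //; rewrite /= muln1.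
Qed.
End Sections.

(** * Cech cohomology of a skyscraper extension *)

Section QdimCap.
Variables (k : fieldType) (V : lmodType k).
Implicit Types (Z B C : set V).

Lemma qdim_capr Z C n : subsp Z -> has_qdim Z (Z `&` C) n <-> has_qdim Z C n.
Proof.
move=> sZ; split=> -[v [vZ vS vI]]; exists v; split=> //.
- by move=> z /vS[a [_ ?]]; exists a.
- by move=> a Ca; apply: vI; split=> //; apply: subsp_lc.
- move=> z Zz; have [a Ca] := vS z Zz; exists a; split=> //.
  by apply: subsp_sub => //; apply: subsp_lc.
- by move=> a [_ Ca]; apply: vI.
Qed.

End QdimCap.

Section Cech.
Variables (k : fieldType) (V : lmodType k) (I : finType).

Definition psh (F : seq I -> set V) : Prop :=
  [/\ forall ls, subsp (F ls), forall i ls, F ls `<=` F (i :: ls)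
    & forall ls ls', perm_eq ls ls' -> F ls = F ls'].

(** Only nonempty lists are compared, because inclusions up to saturation hold once a variable is
    inverted. *)
Definition sub_psh (F G : seq I -> set V) : Prop :=
  forall i ls, F (i :: ls) `<=` G (i :: ls).

Implicit Types F G M N : seq I -> set V.

Definition C0 M : set {ffun I -> V} := [set c : {ffun I -> V} | forall i, M [:: i] (c i)].

Definition C1 M : set {ffun I * I -> V} :=
  [set c : {ffun I * I -> V} | forall i l, M [:: i; l] (c (i, l))].

Definition d0 (b : {ffun I -> V}) : {ffun I * I -> V} :=
  [ffun il => b il.2 - b il.1].

Definition d1 (c : {ffun I * I -> V}) i l m : V := c (l, m) - c (i, m) + c (i, l).

(** Cocycles of the quotient sheaf $M/G$, represented in $M$. Its cohomology is [Z0 M G] modulo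
    [C0 G] in degree $0$ and [Z1 M G] modulo [B1 M G] in degree $1$. *)
Definition Z0 M G : set {ffun I -> V} := C0 M `&` [set c | C1 G (d0 c)].

Definition Z1 M G : set {ffun I * I -> V} :=
  C1 M `&` [set c | forall i l m, G [:: i; l; m] (d1 c i l m)].

Definition B1 M G : set {ffun I * I -> V} :=
  [set c : {ffun I * I -> V} | exists2 b, C0 M b & C1 G (c - d0 b)].

Lemma psh_cons2 F i l : psh F -> F [:: i] `<=` F [:: i; l].
Proof.
move=> [_ h p] x Fx; rewrite (p [:: i; l] [:: l; i]); first exact: h.
exact: permEl (perm_catC [:: i] [:: l]).
Qed.

Lemma psh_perm3 F i l m : psh F -> F [:: i; l; m] = F [:: l; i; m].
Proof. by move=> [_ _ p]; apply: p; rewrite -(perm_catCA [:: l] [:: i]) . Qed.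

Lemma psh_rot3 F i l m : psh F -> F [:: i; l; m] = F [:: m; i; l].
Proof. by move=> [_ _ p]; apply: p; rewrite -(perm_catC [:: m] [:: i; l]). Qed.

Lemma psh_add F ls x y : psh F -> F ls x -> F ls y -> F ls (x + y).
Proof. by move=> [s _ _]; apply: subsp_add. Qed.

Lemma psh_sub F ls x y : psh F -> F ls x -> F ls y -> F ls (x - y).
Proof. by move=> [s _ _]; apply: subsp_sub. Qed.

Lemma psh_lin F ls a x y : psh F -> F ls x -> F ls y -> F ls (a *: x + y).
Proof. by move=> [s _ _]; case: (s ls) => _; apply. Qed.

Lemma psh0 F ls : psh F -> F ls 0.
Proof. by move=> [s _ _]; case: (s ls). Qed.

Lemma psh_opp F ls x : psh F -> F ls x -> F ls (- x).
Proof. by move=> [s _ _]; apply: subsp_opp. Qed.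

Lemma subsp_C0 M : psh M -> subsp (C0 M).
Proof.
move=> pM; split=> [i|a x y hx hy i]; first by rewrite ffunE; apply: psh0.
by rewrite !ffunE; apply: psh_lin.
Qed.

Lemma subsp_C1 M : psh M -> subsp (C1 M).
Proof.
move=> pM; split=> [i l|a x y hx hy i l]; first by rewrite ffunE; apply: psh0.
by rewrite !ffunE; apply: psh_lin.
Qed.

Lemma d0_lin a x y : d0 (a *: x + y) = a *: d0 x + d0 y.
Proof. by apply/ffunP => il; rewrite !ffunE opprD addrACA -scalerBr. Qed.

Lemma d0_0 : d0 0 = 0.
Proof. by apply/ffunP => il; rewrite !ffunE subrr. Qed.

Lemma d0D x y : d0 (x + y) = d0 x + d0 y.
Proof. by have := d0_lin 1 x y; rewrite !scale1r. Qed.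

Lemma d0N x : d0 (- x) = - d0 x.
Proof. by have := d0_lin (-1) x 0; rewrite d0_0 !addr0 !scaleN1r. Qed.

Lemma d0B x y : d0 (x - y) = d0 x - d0 y.
Proof. by rewrite d0D d0N. Qed.

Lemma d1_lin a x y i l m : d1 (a *: x + y) i l m = a *: d1 x i l m + d1 y i l m.
Proof. rewrite /d1 !ffunE; set u := x _; set u' := x _; set u'' := x _.
by rewrite opprD [X in X + _ = _]addrACA -scalerBr addrACA -scalerDr. Qed.

Lemma d1_0 i l m : d1 0 i l m = 0.
Proof. by rewrite /d1 !ffunE subrr addr0. Qed.

Lemma d1D x y i l m : d1 (x + y) i l m = d1 x i l m + d1 y i l m.
Proof. by have := d1_lin 1 x y i l m; rewrite !scale1r. Qed.

Lemma d1N x i l m : d1 (- x) i l m = - d1 x i l m.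
Proof. by have := d1_lin (-1) x 0 i l m; rewrite d1_0 !addr0 !scaleN1r. Qed.

Lemma d1_d0 b i l m : d1 (d0 b) i l m = 0.
Proof. by rewrite /d1 !ffunE /= opprB [X in X + _]addrC [X in X + _]addrA subrK addrA subrK subrr. Qed.

Lemma d1_C1 M c i l m : psh M -> C1 M c -> M [:: i; l; m] (d1 c i l m).
Proof.
move=> pM hc; have [_ h _] := pM; apply: psh_add => //; first apply: psh_sub => //.
- by apply: h; apply: hc.
- by rewrite (psh_perm3 _ _ _ pM); apply: h; apply: hc.
- by rewrite (psh_rot3 _ _ _ pM); apply: h; apply: hc.
Qed.

Lemma subsp_Z0 M G : psh M -> psh G -> subsp (Z0 M G).
Proof.
move=> pM pG; apply: subspI; first exact: subsp_C0.
have [c0 cl] := subsp_C1 pG.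
by split=> [|a x y hx hy]; rewrite /mkset ?d0_0 ?d0_lin //; apply: cl.
Qed.

Lemma subsp_Z1 M G : psh M -> psh G -> subsp (Z1 M G).
Proof.
move=> pM pG; apply: subspI; first exact: subsp_C1.
split=> [|a x y hx hy] i l m; rewrite ?d1_0 ?d1_lin; first exact: psh0.
exact: psh_lin.
Qed.

Lemma subsp_B1 M G : psh M -> psh G -> subsp (B1 M G).
Proof.
move=> pM pG; have [_ cl] := subsp_C1 pG; split.
  exists 0; first by case: (subsp_C0 pM).
  by rewrite d0_0 subr0; case: (subsp_C1 pG).
move=> a x y [b hb hx] [b' hb' hy]; exists (a *: b + b').
  by case: (subsp_C0 pM) => _; apply.
by rewrite d0_lin opprD addrACA -scalerBr; apply: cl.
Qed.

Lemma C0S M N : sub_psh M N -> C0 M `<=` C0 N.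
Proof. by move=> s c h i; apply: s. Qed.

Lemma C1S M N : sub_psh M N -> C1 M `<=` C1 N.
Proof. by move=> s c h i l; apply: s. Qed.

Lemma C0_d0 M b : psh M -> C0 M b -> C1 M (d0 b).
Proof.
move=> pM h i l; rewrite ffunE /=; have [_ h1 _] := pM.
by apply: psh_sub => //; [apply: h1 | apply: psh_cons2].
Qed.

Lemma Z0S M M' G G' : sub_psh M M' -> sub_psh G G' -> Z0 M G `<=` Z0 M' G'.
Proof. by move=> sM sG c [h1 h2]; split; [apply: C0S h1 | apply: C1S h2]. Qed.

Lemma Z1S M M' G G' : sub_psh M M' -> sub_psh G G' -> Z1 M G `<=` Z1 M' G'.
Proof.
by move=> sM sG c [h1 h2]; split; [apply: C1S h1 | move=> i l m; apply: sG; apply: h2].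
Qed.

Lemma B1S M M' G G' : sub_psh M M' -> sub_psh G G' -> B1 M G `<=` B1 M' G'.
Proof. by move=> sM sG c [b hb hc]; exists b; [apply: C0S hb | apply: C1S hc]. Qed.

(** * Evaluation on a skyscraper quotient *)

Section Skyscraper.
Variables (G N M : seq I -> set V) (j : I) (delta : nat).
Hypotheses (pG : psh G) (pN : psh N) (pM : psh M).
Hypotheses (GN : sub_psh G N) (NM : sub_psh N M).
Hypothesis descend : forall i ls x, M (i :: ls) x -> N [:: j, i & ls] x -> N (i :: ls) x.
Hypothesis localize : forall i, M [:: j; i] `<=` subspD (M [:: i]) (N [:: j; i]).
Hypothesis qdelta : has_qdim (M [:: j]) (N [:: j]) delta.

Lemma Z0_at_chart c : Z0 M G c -> N [:: j] (c j) -> C0 N c.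
Proof.
move=> [hM hG] hj i; apply: descend => //.
have := GN (hG j i); rewrite ffunE /= => /(psh_add pN) h.
by rewrite -(subrK (c j) (c i)); apply: h; apply: psh_cons2.
Qed.

Lemma Z0_cap_C0 : Z0 M G `&` C0 N = Z0 N G.
Proof.
apply/seteqP; split=> [c [[_ ?] ?]|c [h1 h2]] //; split=> //.
by split=> //; apply: C0S h1.
Qed.

Lemma extend_section x : M [:: j] x ->
  exists b, [/\ C0 M b, b j = x & forall i, N [:: j; i] (b i - x)].
Proof.
move=> Mx; have /choice[f fP] : forall i, exists b, [/\ M [:: i] b, N [:: j; i] (b - x) & i = j -> b = x].
  move=> i; have [->|ij] := eqVneq i j.
    by exists x; split=> //; rewrite subrr; apply: psh0.
  have [b [n [Mb Nn E]]] := localize (psh_cons2 i pM Mx).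
  exists b; split=> //; last by move=> E'; rewrite E' eqxx in ij.
  by rewrite E opprD addNKr; apply: psh_opp.
exists [ffun i => f i]; split=> [i||i]; rewrite ffunE.
- by have [] := fP i.
- by have [_ _ ->] := fP j.
- by have [] := fP i.
Qed.

Lemma d0_descend b x : C0 M b -> (forall i, N [:: j; i] (b i - x)) -> C1 N (d0 b).
Proof.
move=> hb hx i l; have [_ hN _] := pN; apply: descend.
  by have := C0_d0 pM hb i l.
rewrite ffunE /= -(subrKA x (b l)); apply: psh_add => //.
  by rewrite (psh_perm3 _ _ _ pN); apply: hN.
by rewrite -opprB; apply: psh_opp => //; rewrite (psh_rot3 _ _ _ pN); apply: hN.
Qed.

Definition ev_chart : set V := [set c j | c in Z0 M G].

Lemma subsp_ev_chart : subsp ev_chart.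
Proof.
have [z0 zl] := subsp_Z0 pM pG; split; first by exists 0; rewrite ?ffunE.
by move=> a _ _ [c hc <-] [c' hc' <-]; exists (a *: c + c'); rewrite ?ffunE //; apply: zl.
Qed.

(** In the cohomology sequence of $0\to N/G\to M/G\to M/N\to 0$, the space $H^0(M/N)$ is seen on the
    chart of [j] and has dimension [delta]. The rank of $H^0(M/G)\to H^0(M/N)$ is [rho]; its
    cokernel is the kernel of $H^1(N/G)\to H^1(M/G)$, of dimension [z]. *)
Lemma sky_rank : exists rho z, [/\ (rho + z = delta)%N, has_qdim (Z0 M G) (C0 N) rho
  & has_qdim (Z1 N G `&` B1 M G) (B1 N G) z].
Proof.
have sNj : subsp (N [:: j]) by case: pN.
have sev := subsp_ev_chart; have sD := subsp_subspD sNj sev.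
have N0 := sNj.1; have ev0 := sev.1.
have [z [rho [E q1 q2]]] := qdim_split sD sNj
  (fun x Nx => ex_intro _ x (ex_intro _ 0 (And3 Nx ev0 (esym (addr0 x)))))
  (fun x Dx => let: ex_intro b (ex_intro c (And3 Nb ec E)) := Dx in
    let: ex_intro2 f (conj hf _) Ef := ec in
    eq_ind_r (M [:: j]) (psh_add pM (NM Nb) (eq_ind _ (M [:: j]) (hf j) _ Ef)) E) qdelta.
exists rho, z; split; first by rewrite E addnC.
- have q3 : has_qdim ev_chart (N [:: j]) rho.
    apply: eq_qdim q2 => // [_ [b [c [Nb ec ->]]]|z' ez].
      by exists c => //; rewrite addrK.
    by exists z'; rewrite ?subrr //; exists 0, z'; rewrite add0r.
  apply: (qdim_corr (G := fun x c => Z0 M G c /\ c j = x)) q3 => //.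
  + exact: subsp_C0.
  + by split; [case: (subsp_Z0 pM pG) | rewrite ffunE].
  + move=> a x x' y y' [h1 <-] [h2 <-]; rewrite !ffunE; split=> //.
    by case: (subsp_Z0 pM pG) => _; apply.
  + by move=> _ [c hc <-]; exists c.
  + by move=> c hc; exists (c j) => //; exists c.
  + by move=> _ c [hc <-]; split=> [h|h]; [exact: Z0_at_chart hc h | exact: h].
(* The connecting map: a section [x] on the chart of [j] is extended to a cochain [b] of [M] that
   agrees with it modulo [N], and sent to the differential of [b]. *)
- apply: (qdim_corr (G := fun x c => exists b, [/\ C0 M b, b j = x,
    forall i, N [:: j; i] (b i - x) & C1 G (c - d0 b)])) q1 => //.
  + exact: subsp_B1.
  + exists 0; split=> [|||] *; rewrite ?ffunE ?d0_0 ?subr0 //; try exact: psh0.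
    * by case: (subsp_C0 pM).
    * by case: (subsp_C1 pG).
  + move=> a x x' y y' [b [h1 <- h2 h3]] [b' [h1' <- h2' h3']].
    exists (a *: b + b'); split.
    * by case: (subsp_C0 pM) => _; apply.
    * by rewrite !ffunE.
    * by move=> i; rewrite !ffunE opprD addrACA -scalerBr; apply: psh_lin.
    * by rewrite d0_lin opprD addrACA -scalerBr; case: (subsp_C1 pG) => _; apply.
  + move=> x Mx; have [b [hb bj bN]] := extend_section Mx.
    exists (d0 b); last by exists b; split=> //; rewrite subrr; case: (subsp_C1 pG).
    split; last by exists b => //; rewrite subrr; case: (subsp_C1 pG).
    split; first exact: d0_descend bN.
    by move=> i l m; rewrite /= d1_d0; apply: psh0.
  + move=> c [[hN hG] [b hb hc]]; exists (b j); first exact: hb.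
    exists b; split=> // i.
    have := hc j i; rewrite !ffunE /= => /GN h.
    have := psh_sub pN (hN j i) h; by rewrite opprB addrC subrK.
  + move=> _ c [b [hb <- hN hc]]; split.
      move=> [n [_ [Nn [z' hz <-] E']]]; exists (b - z').
        have hbz : C0 M (b - z').
          exact: subsp_sub (subsp_C0 pM) hb hz.1.
        move=> i; apply: descend => //.
        have := psh_sub pN (hN i) (GN (hz.2 j i)); rewrite !ffunE /= => h.
        have := psh_add pN h (psh_cons2 i pN Nn); rewrite E'.
        by rewrite opprD opprB !addrA subrK addrAC subrK.
      rewrite d0B opprB [_ - d0 b]addrC addrA.
      exact: subsp_add (subsp_C1 pG) hc hz.2.
    move=> [b' hb' hc']; exists (b' j), (b j - b' j); split=> //; last by rewrite addrC subrK.
    exists (b - b'); last by rewrite !ffunE.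
    split; first exact: subsp_sub (subsp_C0 pM) hb (C0S NM hb').
    have := subsp_sub (subsp_C1 pG) hc' hc.
    by rewrite opprB addrC addrA subrK -d0B.
Qed.
End Skyscraper.
End Cech.

(** * The cohomology sequence of the restriction to a divisor *)

Section LongExactSequence.
Variables (k : fieldType) (V : lmodType k) (I : finType).
Implicit Types F G M N : seq I -> set V.

Lemma B1_sub_Z1 M G : psh M -> psh G -> sub_psh G M -> B1 M G `<=` Z1 M G.
Proof.
move=> pM pG GM c [b hb hc]; split.
  rewrite -(subrK (d0 b) c); apply: (subsp_add (subsp_C1 pM)); first exact: C1S hc.
  exact: C0_d0.
move=> i l m; have := d1_C1 i l m pG hc.
by rewrite d1D d1N d1_d0 subr0.
Qed.

Variables X A W H T : seq I -> set V.
Hypotheses (pX : psh X) (pA : psh A) (pW : psh W) (pH : psh H) (pT : psh T).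
Hypotheses (XA : sub_psh X A) (AW : sub_psh A W) (AH : sub_psh A H).
Hypothesis WT : sub_psh W T.
Hypothesis WHA : forall i ls x, W (i :: ls) x -> H (i :: ls) x -> A (i :: ls) x.
Hypothesis TWH : forall i, T [:: i] `<=` subspD (W [:: i]) (H [:: i]).

Let XW : sub_psh X W. Proof. by move=> i ls x /XA /AW. Qed.
Let XH : sub_psh X H. Proof. by move=> i ls x /XA /AH. Qed.

(** The sequence is $0\to A/X\to W/X\to T/H\to 0$. The connecting map sends a section [w + h] of
    $T/H$ to the differential of [w]; it identifies the cokernel of $H^0(W/X)\to H^0(T/H)$ with the
    kernel of $H^1(A/X)\to H^1(W/X)$. *)
Lemma connecting_qdim q :
  has_qdim (Z1 A X `&` B1 W X) (B1 A X) q ->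
  has_qdim (Z0 T H) (subspD (Z0 W X) (C0 H)) q.
Proof.
have sC0A := subsp_C0 pA; have sC0W := subsp_C0 pW; have sC0H := subsp_C0 pH.
have sC1X := subsp_C1 pX; have sC1H := subsp_C1 pH.
have sZ0W := subsp_Z0 pW pX.
apply: (qdim_corr (G := fun c b => exists w h, [/\ C0 W w, C0 H h, b = w + h
    & C1 X (c - d0 w)])).
- exact: subsp_B1.
- exact: subsp_subspD.
- exists 0, 0; rewrite d0_0 subr0 addr0; split=> //; [exact: sC0W.1 | exact: sC0H.1 | exact: sC1X.1].
- move=> a c _ c' _ [w [h [hw hh -> hc]]] [w' [h' [hw' hh' -> hc']]].
  exists (a *: w + w'), (a *: h + h'); split.
  + exact: sC0W.2.
  + exact: sC0H.2.
  + by rewrite scalerDr addrACA.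
  + by rewrite d0_lin opprD addrACA -scalerBr; apply: sC1X.2.
- move=> c [[hA hX] [w hw hc]]; exists w; last first.
    by exists w, 0; rewrite addr0; split=> //; exact: sC0H.1.
  split; first exact: C0S hw.
  have := subsp_sub sC1H (C1S AH hA) (C1S XH hc).
  by rewrite opprB addrC subrK.
- move=> b [hb hdb].
  have /choice[f fP] : forall i, exists wh : V * V, [/\ W [:: i] wh.1, H [:: i] wh.2 & b i = wh.1 + wh.2].
    by move=> i; have [w [h [? ? ?]]] := TWH (hb i); exists (w, h).
  pose w := [ffun i => (f i).1]; pose h := [ffun i => (f i).2].
  have hw : C0 W w by move=> i; rewrite ffunE; case: (fP i).
  have hh : C0 H h by move=> i; rewrite ffunE; case: (fP i).
  have E : b = w + h by apply/ffunP => i; rewrite !ffunE; have [_ _ ->] := fP i.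
  have dw : C1 A (d0 w).
    have dH : C1 H (d0 w).
      have := subsp_sub sC1H hdb (C0_d0 pH hh).
      by rewrite E d0D addrK.
    by move=> i l; apply: WHA; [apply: (C0_d0 pW hw) | apply: dH].
  exists (d0 w); last by exists w, h; split=> //; rewrite subrr; exact: sC1X.1.
  split; last by exists w => //; rewrite subrr; exact: sC1X.1.
  by split=> // i l m; rewrite d1_d0; apply: psh0.
- move=> c b [w [h [hw hh -> hc]]]; split.
    move=> [a' ha' hca]; exists (w - a'), (a' + h); split.
    + split; first exact: subsp_sub sC0W hw (C0S AW ha').
      have := subsp_sub sC1X hca hc.
      by rewrite opprB addrC addrA subrK -d0B.
    + exact: subsp_add sC0H (C0S AH ha') hh.
    + by rewrite addrA subrK.
  move=> [w' [h' [[hw' hdw'] hh' E]]]; exists (w - w').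
    have Ew : w - w' = h' - h.
      by apply/eqP; rewrite subr_eq addrAC eq_sym subr_eq eq_sym addrC E addrC.
    move=> i; apply: WHA; first exact: (subsp_sub sC0W hw hw').
    by rewrite Ew; apply: (subsp_sub sC0H hh' hh).
  rewrite d0B opprB [_ - d0 w]addrC addrA.
  exact: subsp_add sC1X hc hdw'.
Qed.

(** The image of $H^1(A/X)$ in $H^1(W/X)$ has dimension [a - q], and the quotient by this image
    embeds in $H^1(T/H)$, of dimension [t]. *)
Lemma long_exact_H1 a t :
  has_qdim (Z1 A X) (B1 A X) a -> has_qdim (Z1 T H) (B1 T H) t ->
  exists w q, [/\ has_qdim (Z1 W X) (B1 W X) w,
    has_qdim (Z0 T H) (subspD (Z0 W X) (C0 H)) q & (w + q <= a + t)%N].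
Proof.
move=> qA qT.
have sB1A := subsp_B1 pA pX; have sB1W := subsp_B1 pW pX; have sB1T := subsp_B1 pT pH.
have sZ1A := subsp_Z1 pA pX; have sZ1W := subsp_Z1 pW pX.
have sAW : subsp (Z1 A X `&` B1 W X) by apply: subspI.
have [m1 [q [Ea /(qdim_capr _ _ sZ1A) q1 q2]]] := qdim_split sAW sB1A
  (fun c hc => conj (B1_sub_Z1 pA pX XA hc) (B1S AW (fun _ _ _ => id) hc)) (fun c hc => hc.1) qA.
have [m' le_m' qm'] := qdim_sub sB1T (Z1S WT XH) qT.
have sWT : subsp (Z1 W X `&` B1 T H) by apply: subspI.
have q3 : has_qdim (Z1 W X `&` B1 T H) (B1 W X) m1.
  apply: eq_qdim q1 => //.
    move=> c hc; exists c; last by rewrite subrr; exact: sB1W.1.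
    split; first exact: (Z1S AW (fun _ _ _ => id) hc).
    exists 0; first exact: (subsp_C0 pT).1.
    by rewrite d0_0 subr0; exact: (C1S AH hc.1).
  move=> c [[hW hX] [b hb hc]].
  have /choice[f fP] : forall i, exists wh : V * V, [/\ W [:: i] wh.1, H [:: i] wh.2 & b i = wh.1 + wh.2].
    by move=> i; have [w [h [? ? ?]]] := TWH (hb i); exists (w, h).
  pose w := [ffun i => (f i).1]; pose h := [ffun i => (f i).2].
  have hw : C0 W w by move=> i; rewrite ffunE; case: (fP i).
  have hh : C0 H h by move=> i; rewrite ffunE; case: (fP i).
  have E : b = w + h by apply/ffunP => i; rewrite !ffunE; have [_ _ ->] := fP i.
  exists (c - d0 w); last first.
    exists (- w); first exact: subsp_opp (subsp_C0 pW) hw.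
    by rewrite d0N opprK addrAC subrK subrr; exact: (subsp_C1 pX).1.
  split.
    have hH : C1 H (c - d0 w).
      have := subsp_add (subsp_C1 pH) hc (C0_d0 pH hh).
      by rewrite E d0D opprD addrA subrK.
    move=> i l; apply: WHA; last exact: hH.
    exact: (subsp_sub (subsp_C1 pW) hW (C0_d0 pW hw)).
  by move=> i l m; rewrite d1D d1N d1_d0 subr0.
have q4 := (qdim_capr (Z := Z1 W X) (B1 T H) m' sZ1W).2 qm'.
exists (m' + m1)%N, q; split.
- apply: (qdim_chain sWT sB1W _ _ q4 q3).
  + move=> c hc; split; first exact: (B1_sub_Z1 pW pX XW hc).
    exact: (B1S WT XH hc).
  + by move=> c [].
- exact: connecting_qdim.
- by rewrite Ea; lia.
Qed.
End LongExactSequence.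

(** * The count of dimensions *)

Section HoraceCount.
Variables (k : fieldType) (V : lmodType k) (I : finType).
Implicit Types F G M N : seq I -> set V.

Definition skyscraper (j : I) M N delta : Prop :=
  [/\ sub_psh N M,
    forall i ls x, M (i :: ls) x -> N [:: j, i & ls] x -> N (i :: ls) x,
    forall i, M [:: j; i] `<=` subspD (M [:: i]) (N [:: j; i])
  & has_qdim (M [:: j]) (N [:: j]) delta].

(** A skyscraper has no $H^1$, so $H^1(N/G)\to H^1(M/G)$ is onto, with kernel of dimension [z]. *)
Lemma sky_H1 j G M N delta : psh G -> psh N -> psh M -> sub_psh G N ->
  skyscraper j M N delta ->
  exists rho z, [/\ (rho + z = delta)%N, has_qdim (Z0 M G) (C0 N) rho,
    forall h, has_qdim (Z1 N G) (B1 N G) h ->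
      exists2 h', h = (h' + z)%N & has_qdim (Z1 M G) (B1 M G) h'
  & forall h', has_qdim (Z1 M G) (B1 M G) h' -> has_qdim (Z1 N G) (B1 N G) (h' + z)].
Proof.
move=> pG pN pM GN [NM desc loc qd].
have [rho [z [E q1 q2]]] := sky_rank pG pN pM GN NM desc loc qd.
have sZ1N := subsp_Z1 pN pG; have sB1M := subsp_B1 pM pG; have sB1N := subsp_B1 pN pG.
have sC : subsp (Z1 N G `&` B1 M G) by apply: subspI.
have BC : B1 N G `<=` Z1 N G `&` B1 M G.
  by move=> c hc; split; [exact: (B1_sub_Z1 pN pG GN) | exact: (B1S NM (fun _ _ _ => id) hc)].
have CZ : Z1 N G `&` B1 M G `<=` Z1 N G by move=> c [].
have GM : sub_psh G M by move=> i ls x /GN /NM.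
(* A cocycle [c] of [M] is moved into [N] by subtracting the differential of a cochain whose value
   at [i] represents [c (j, i)] modulo [N]. *)
have onto c : Z1 M G c -> exists2 c', Z1 N G c' & B1 M G (c' - c).
  move=> [hM hG].
  have /choice[b bP] : forall i, exists b, M [:: i] b /\ N [:: j; i] (c (j, i) - b).
    move=> i; have [b [m [Mb Nm ->]]] := loc i _ (hM j i); exists b; split=> //.
    by rewrite addrC addKr.
  pose b' := [ffun i => b i]; have hb : C0 M b' by move=> i; rewrite ffunE; case: (bP i).
  exists (c - d0 b'); last first.
    exists (- b'); first exact: subsp_opp (subsp_C0 pM) hb.
    by rewrite d0N opprK addrAC subrK subrr; exact: (subsp_C1 pG).1.
  split; last by move=> i l m; rewrite d1D d1N d1_d0 subr0.
  move=> i l; apply: desc; first exact: (subsp_sub (subsp_C1 pM) hM (C0_d0 pM hb)).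
  have [_ hN _] := pN; rewrite !ffunE /=.
  have -> : c (i, l) - (b l - b i)
      = d1 c j i l + (c (j, l) - b l) - (c (j, i) - b i).
    rewrite /d1 !opprB [c (i, l) - _ + _]addrAC [_ + (c (j, l) - _)]addrA subrK.
    rewrite [_ + _ - b l]addrAC [b i - c (j, i)]addrC [RHS]addrA addrK.
    by rewrite addrA addrAC.
  apply: psh_sub => //; first apply: psh_add => //.
  - by apply: GN; apply: hG.
  - by rewrite (psh_perm3 _ _ _ pN); apply: hN; case: (bP l).
  - by rewrite (psh_rot3 _ _ _ pN); apply: hN; case: (bP i).
have same h : has_qdim (Z1 N G) (B1 M G) h <-> has_qdim (Z1 M G) (B1 M G) h.
  have refl c : Z1 N G c -> exists2 c', Z1 M G c' & B1 M G (c - c').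
    move=> hc; exists c; first exact: (Z1S NM (fun _ _ _ => id) hc).
    by rewrite subrr; exact: sB1M.1.
  split=> q; apply: (eq_qdim sB1M _ _ q) => c hc.
  - exact: refl.
  - exact: onto.
  - have [c' h1 h2] := onto c hc; exists c' => //.
    by rewrite -opprB; apply: subsp_opp.
  - exists c; first exact: (Z1S NM (fun _ _ _ => id) hc).
    by rewrite subrr; exact: sB1M.1.
exists rho, z; split=> // [h qh|h' qh'].
- have [m1 [m2 [Eh /(qdim_capr _ _ sZ1N) /same qm1 qm2]]] := qdim_split sC sB1N BC CZ qh.
  by exists m1 => //; rewrite Eh (qdim_uniq sB1N qm2 q2).
- apply: (qdim_chain sC sB1N BC CZ _ q2).
  by apply/(qdim_capr _ _ sZ1N)/same.
Qed.

(** [X] and [H] stand for the ideal sheaves of $X$ and $H'$; [W], [A], [T] for the three sheaves of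
    the exact sequence; [L], [R1], [R2] for their subsheaves attached to $2\widetilde{Z}$, to the
    residual scheme with $2\widetilde{S}$ and to the trace with $\widetilde{S}$. The comparison of
    ranks is [rank_bound], that of lengths is [count]. *)
Variables X L W R1 A R2 T H : seq I -> set V.
Hypotheses (pX : psh X) (pL : psh L) (pW : psh W) (pR1 : psh R1) (pA : psh A)
  (pR2 : psh R2) (pT : psh T) (pH : psh H).
Hypotheses (XL : sub_psh X L) (XR1 : sub_psh X R1) (HR2 : sub_psh H R2).
Hypotheses (AW : sub_psh A W) (AH : sub_psh A H) (WT : sub_psh W T).
Hypothesis WHA : forall i ls x, W (i :: ls) x -> H (i :: ls) x -> A (i :: ls) x.
Hypothesis TWH : forall i, T [:: i] `<=` subspD (W [:: i]) (H [:: i]).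
Variables (j : I) (dW dA dT : nat).
Hypotheses (skyW : skyscraper j W L dW) (skyA : skyscraper j A R1 dA)
  (skyT : skyscraper j T R2 dT) (count : (dW <= dA + dT)%N).
Hypothesis rank_bound : forall a t, has_qdim (Z0 A X) (C0 R1) a ->
  has_qdim (Z0 W X) (C0 R2) t ->
  exists2 w, (a + t <= w)%N & has_qdim (Z0 W X) (C0 L) w.

Let XA : sub_psh X A. Proof. by case: skyA => h _ _ _ i ls x /XR1 /h. Qed.
Let XW : sub_psh X W. Proof. by move=> i ls x /XA /AW. Qed.
Let XH : sub_psh X H. Proof. by move=> i ls x /XA /AH. Qed.
(** The sections of [T] coming from [W] have codimension [q], so restricting the evaluation to them
    lowers its rank by at most [q]. *)
Lemma restriction_rank rT q : has_qdim (Z0 T H) (C0 R2) rT ->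
  has_qdim (Z0 T H) (subspD (Z0 W X) (C0 H)) q ->
  exists2 t, (rT <= q + t)%N & has_qdim (Z0 W X) (C0 R2) t.
Proof.
move=> qT qq; have sR2 := subsp_C0 pR2; have sW := subsp_Z0 pW pX.
have sH := subsp_C0 pH; have sT := subsp_Z0 pT pH.
have sD : subsp (Z0 T H `&` subspD (Z0 W X) (C0 R2)).
  by apply: subspI => //; apply: subsp_subspD.
have [m1 [m2 [-> /(qdim_capr _ _ sT) q1 q2]]] : exists m1 m2,
    [/\ rT = (m1 + m2)%N, has_qdim (Z0 T H) (Z0 T H `&` subspD (Z0 W X) (C0 R2)) m1 &
     has_qdim (Z0 T H `&` subspD (Z0 W X) (C0 R2)) (Z0 T H `&` C0 R2) m2].
  apply: qdim_split => //.
  - exact: subspI.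
  - by move=> c [h1 h2]; split=> //; exists 0, c; rewrite add0r; split=> //; exact: sW.1.
  - exact: ((qdim_capr _ _ sT).2 qT).
have [t _ qt] := qdim_sub sR2 (Z0S WT XH) qT.
exists t => //; rewrite leq_add //.
  have [m le_m qm] := qdim_subr (subsp_subspD sW sH) (subsp_subspD sW sR2)
    (fun c => fun '(ex_intro x (ex_intro y (And3 h1 h2 h3))) =>
       ex_intro _ x (ex_intro _ y (And3 h1 (C0S HR2 h2) h3))) qq.
  by rewrite (qdim_uniq _ q1 qm) //; apply: subsp_subspD.
suff /(qdim_uniq (subspI sT sR2) q2) -> : has_qdim (Z0 T H `&` subspD (Z0 W X) (C0 R2)) (Z0 T H `&` C0 R2) t by [].
have WT0 : Z0 W X `<=` Z0 T H by exact: Z0S WT XH.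
have qt' : has_qdim (Z0 W X) (Z0 T H `&` C0 R2) t.
  apply: (qdim_capr _ _ sW).1; rewrite (_ : _ `&` (_ `&` _) = Z0 W X `&` C0 R2); first exact: ((qdim_capr _ _ sW).2 qt).
  by apply/seteqP; split=> c [h1]; [move=> [] | move=> h2; split=> //; split=> //; apply: WT0].
apply: eq_qdim qt' => //; first exact: subspI.
  move=> c hc; exists c; last by rewrite subrr; split; [exact: sT.1 | exact: sR2.1].
  by split; [apply: WT0 | exists c, 0; rewrite addr0; split=> //; exact: sR2.1].
move=> c [hT [w [b [hw hb E]]]]; exists w => //.
split; first exact: (subsp_sub sT (WT0 _ hw) hT).
by rewrite E opprD addNKr; exact: (subsp_opp sR2 hb).
Qed.

(** Each $h^1$ grows by the length of the skyscraper minus the rank of evaluation on it. The defect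
    [q] of surjectivity of $H^0(W)\to H^0(T)$ is gained in the cohomology sequence and lost in the
    rank on the trace, and cancels. *)
Lemma horace_H1 x y : has_qdim (Z1 R1 X) (B1 R1 X) x ->
  has_qdim (Z1 R2 H) (B1 R2 H) y ->
  exists2 m, (m <= x + y)%N & has_qdim (Z1 L X) (B1 L X) m.
Proof.
move=> qx qy.
have [rW [zW [EW qrW _ hW]]] := sky_H1 pX pL pW XL skyW.
have [rA [zA [EA qrA hA _]]] := sky_H1 pX pR1 pA XR1 skyA.
have [rT [zT [ET qrT hT _]]] := sky_H1 pH pR2 pT HR2 skyT.
have [a Ea qa] := hA _ qx; have [t Et qt] := hT _ qy.
have [w [q [qw qq le_wq]]] := long_exact_H1 pX pA pW pH pT XA AW AH WT WHA TWH qa qt.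
have [s le_s qs] := restriction_rank qrT qq.
have [rW' le_r qrW'] := rank_bound qrA qs.
have ErW := qdim_uniq (subsp_C0 pL) qrW qrW'.
exists (w + zW)%N; last exact: hW.
by move: le_wq le_s le_r EW EA ET count; rewrite Ea Et -ErW; lia.
Qed.

(** The sections of [W] vanishing on $H'$ have dimension [rA + x], and the image of all sections in
    those of [T] has dimension at most [t + y], with [t] the rank of $H^0(W)$ on the trace points.
    The rank on the double points, at least [rA + t], is subtracted. *)
Lemma horace_H0 x y : has_qdim (Z0 R1 X) (C0 X) x ->
  has_qdim (Z0 R2 H) (C0 H) y ->
  exists2 m, (m <= x + y)%N & has_qdim (Z0 L X) (C0 X) m.
Proof.
move=> qx qy.
have [NMW descW _ _] := skyW; have [NMA descA _ _] := skyA; have [NMT _ _ _] := skyT.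
have [rA [zA [EA qrA _ _]]] := sky_H1 pX pR1 pA XR1 skyA.
have [rW [zW [EW qrW _ _]]] := sky_H1 pX pL pW XL skyW.
have sX := subsp_C0 pX; have sH := subsp_C0 pH; have sR2 := subsp_C0 pR2.
have sR1 := subsp_C0 pR1; have sL := subsp_C0 pL.
have sZW := subsp_Z0 pW pX; have sZA := subsp_Z0 pA pX.
have qhA : has_qdim (Z0 A X) (C0 X) (rA + x).
  apply: (@qdim_chain _ _ _ (Z0 R1 X)) => //.
  - exact: subsp_Z0.
  - move=> c hc; split; first exact: (C0S XR1 hc).
    by have := C0_d0 pX hc.
  - exact: (Z0S NMA (fun _ _ _ => id)).
  - by rewrite -(Z0_cap_C0 X NMA); exact: ((qdim_capr _ _ sZA).2 qrA).
have TfinW : exists2 t, (t <= dT)%N & has_qdim (Z0 W X) (C0 R2) t.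
  have [rT [zT [ET qrT _ _]]] := sky_H1 pH pR2 pT HR2 skyT.
  have [t le_t qt] := qdim_sub sR2 (Z0S WT XH) qrT.
  by exists t => //; rewrite -ET (leq_trans le_t) ?leq_addr.
have [t _ qt] := TfinW.
have [rW' le_r qrW'] := rank_bound qrA qt.
have ErW := qdim_uniq sL qrW qrW'.
have [e [y' [Ee le_y' qe]]] : exists e y', [/\ e = (t + y')%N, (y' <= y)%N & has_qdim (Z0 W X) (Z0 W X `&` C0 H) e].
  have [y' le_y' qy'] : exists2 y', (y' <= y)%N & has_qdim (Z0 W X `&` C0 R2) (C0 H) y'.
    apply: qdim_sub qy => // c [[_ hX] h2]; split=> //.
    exact: (C1S XH hX).
  exists (t + y')%N, y'; split=> //.
  apply: (@qdim_chain _ _ _ (Z0 W X `&` C0 R2)).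
  - exact: subspI.
  - exact: subspI.
  - by move=> c [h1 h2]; split=> //; exact: (C0S HR2 h2).
  - by move=> c [].
  - exact: ((qdim_capr _ _ sZW).2 qt).
  - apply: (qdim_capr _ _ (subspI sZW sR2)).1.
    rewrite (_ : _ `&` (_ `&` C0 H) = (Z0 W X `&` C0 R2) `&` C0 H).
      exact: ((qdim_capr _ _ (subspI sZW sR2)).2 qy').
    by apply/seteqP; split=> c [[h1 h2]]; [move=> [] | move=> h3].
have EA0 : Z0 W X `&` C0 H = Z0 A X.
  apply/seteqP; split=> c; first by move=> [[h1 h2] h3]; split=> // i; apply: WHA; [exact: h1 | exact: h3].
  move=> [h1 h2]; split; last exact: (C0S AH h1).
  by split=> //; exact: (C0S AW h1).
have qhW : has_qdim (Z0 W X) (C0 X) (e + (rA + x)).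
  apply: (@qdim_chain _ _ _ (Z0 A X)) => //.
  - move=> c hc; split; first exact: (C0S XA hc).
    by have := C0_d0 pX hc.
  - exact: (Z0S AW (fun _ _ _ => id)).
  - by rewrite -EA0.
have sZL : subsp (Z0 L X) by exact: subsp_Z0.
have [m1 [m2 [E q1 q2]]] := qdim_split sZL sX
  (fun c hc => conj (C0S XL hc) (C0_d0 pX hc)) (Z0S NMW (fun _ _ _ => id)) qhW.
have Em1 : m1 = rW.
  apply: (qdim_uniq sL _ qrW); apply/(qdim_capr _ _ sZW).
  by rewrite (Z0_cap_C0 X NMW).
exists m2 => //; move: E le_r Ee le_y'; rewrite Em1 -ErW; lia.
Qed.
End HoraceCount.

(** * Cech cochains indexed by tuples and by lists of charts *)

Section CechTransfer.
Variables (k : closedFieldType) (n : nat).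
Local Notation S := {mpoly k[n.+1]}.
Local Notation K := {fraction {mpoly k[n.+1]}}.
Local Notation Kk := (fracmod k n.+1).
Local Notation I := 'I_n.+1.
Variables (J0 J : set S).
Let G ls := sec ls J0.
Let M ls := sec ls (idsum J J0).

Lemma sections_onE p (s : {ffun 'I_p.+1 -> I}) (J' : set S) :
  sections_on s J' = sec [seq s l | l <- enum 'I_p.+1] J'.
Proof.
rewrite /sections_on /sec size_map size_enum_ord.
have -> : mons k [seq s l | l <- enum 'I_p.+1] = \prod_(l < p.+1) 'X_(s l).
  by rewrite /mons big_map big_enum.
by apply/seteqP; split=> x.
Qed.

Lemma sections_on0 (s : {ffun 'I_1 -> I}) (J' : set S) :
  sections_on s J' = sec [:: s ord0] J'.
Proof. by rewrite sections_onE enum_ordSl /= (size0nil (size_enum_ord 0)). Qed.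

Lemma sections_on1 (s : {ffun 'I_2 -> I}) (J' : set S) :
  sections_on s J' = sec [:: s ord0; s (lift ord0 ord0)] J'.
Proof. by rewrite sections_onE !enum_ordSl /= (size0nil (size_enum_ord 0)). Qed.

Lemma sections_on2 (s : {ffun 'I_3 -> I}) (J' : set S) :
  sections_on s J' = sec [:: s ord0; s (lift ord0 ord0); s (lift ord0 (lift ord0 ord0))] J'.
Proof. by rewrite sections_onE !enum_ordSl /= (size0nil (size_enum_ord 0)). Qed.

Lemma psh_sec (J' : set S) : is_ideal setT J' -> psh (fun ls : seq I => sec ls J').
Proof.
move=> hJ'; split=> [ls|i ls|ls ls' /sec_perm -> //].
- exact: sec_subsp.
- exact: sec_cons.
Qed.

Lemma has_dim_transfer p m (V' : lmodType k) (Z B : set V')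
    (T : cochain k n p -> V') (U : V' -> cochain k n p) :
  (forall x, T (U x) = x) ->
  (forall z w, T (z - w) = T z - T w) ->
  (forall a (v : 'I_m -> cochain k n p), T (lin_comb a v) = \sum_i a i *: T (v i)) ->
  (forall z, cech_cocycle J0 J z <-> Z (T z)) ->
  (forall z, cech_coboundary J0 J z <-> B (T z)) ->
  cech_has_dim J0 J p m <-> has_qdim Z B m.
Proof.
move=> TU TB Tlc TZ TBd; split=> -[v [vZ vS vI]].
- exists (fun i => T (v i)); split=> [i|z|a].
  + exact/TZ.
  + rewrite -(TU z) => /TZ /vS[a /TBd]; rewrite TB Tlc => h; by exists a.
  + by rewrite -Tlc => /TBd /vI.
- have E : (fun i => T (U (v i))) = v by apply/funext => i.
  exists (fun i => U (v i)); split=> [i|z|a].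
  + by apply/TZ; rewrite TU.
  + move=> /TZ /vS[a h]; exists a; apply/TBd; rewrite TB Tlc.
    by under eq_bigr do rewrite TU.
  + by move=> /TBd; rewrite Tlc; under eq_bigr do rewrite TU; apply: vI.
Qed.

Definition pt1 (i : I) : {ffun 'I_1 -> I} := [ffun=> i].
Definition pt2 (i l : I) : {ffun 'I_2 -> I} := [ffun a => if a == ord0 then i else l].

Lemma pt1K (s : {ffun 'I_1 -> I}) : pt1 (s ord0) = s.
Proof. by apply/ffunP => a; rewrite ffunE (ord1 a). Qed.

Lemma pt2K (s : {ffun 'I_2 -> I}) : pt2 (s ord0) (s (lift ord0 ord0)) = s.
Proof.
apply/ffunP => a; rewrite ffunE; case: (unliftP ord0 a) => [b ->|->] //=.
by rewrite (ord1 b).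
Qed.

Lemma cech_diff0 (c : cochain k n 0) (s : {ffun 'I_2 -> I}) :
  cech_diff c s = c (pt1 (s (lift ord0 ord0))) - c (pt1 (s ord0)).
Proof.
rewrite ffunE !big_ord_recl big_ord0 addr0 expr0 mul1r /= expr1 mulN1r.
by congr (c _ - c _); apply/ffunP => a; rewrite !ffunE (ord1 a); congr (s _); apply/val_inj.
Qed.

Lemma cech_diff1 (c : cochain k n 1) (s : {ffun 'I_3 -> I}) :
  cech_diff c s = c (pt2 (s (lift ord0 ord0)) (s (lift ord0 (lift ord0 ord0))))
    - c (pt2 (s ord0) (s (lift ord0 (lift ord0 ord0))))
    + c (pt2 (s ord0) (s (lift ord0 ord0))).
Proof.
rewrite ffunE !big_ord_recl big_ord0 addr0 expr0 mul1r /= expr1 mulN1r.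
rewrite [(-1) ^+ _]expr2 mulrNN !mulr1 mul1r addrA.
by congr (c _ - c _ + c _); apply/ffunP => a; rewrite !ffunE;
  case: (unliftP ord0 a) => [b ->|->] /=; rewrite ?(ord1 b); congr (s _); apply/val_inj.
Qed.

Lemma has_dim_H0 m : cech_has_dim J0 J 0 m <-> has_qdim (Z0 M G) (C0 G) m.
Proof.
pose T (c : cochain k n 0) : {ffun I -> Kk} := [ffun i => c (pt1 i)].
pose U (b : {ffun I -> Kk}) : cochain k n 0 := [ffun s : {ffun 'I_1 -> I} => b (s ord0)].
apply: (has_dim_transfer (T := T) (U := U)); rewrite /T /U.
- by move=> b; apply/ffunP => i; rewrite !ffunE.
- by move=> z w; apply/ffunP => i; rewrite !ffunE.
- move=> a v; apply/ffunP => i; rewrite sum_ffunE !ffunE; apply: eq_bigr => l _.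
  by rewrite !ffunE.
- move=> z; split=> [[hM hG]|[hM hG]].
    split=> [i|i l]; first by have := hM (pt1 i); rewrite sections_on0 !ffunE.
    have := hG (pt2 i l); rewrite sections_on1 cech_diff0 !ffunE /=.
    by rewrite /G.
  split=> s; first by have := hM (s ord0); rewrite sections_on0 ffunE pt1K.
  have := hG (s ord0) (s (lift ord0 ord0)); rewrite sections_on1 cech_diff0.
  by rewrite !ffunE.
- move=> z; split=> h; first by move=> i; have := h (pt1 i); rewrite sections_on0 !ffunE.
  by move=> s; have := h (s ord0); rewrite sections_on0 ffunE pt1K.
Qed.

Lemma has_dim_H1 m : cech_has_dim J0 J 1 m <-> has_qdim (Z1 M G) (B1 M G) m.
Proof.
pose T (c : cochain k n 1) : {ffun I * I -> Kk} := [ffun il => c (pt2 il.1 il.2)].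
pose U (b : {ffun I * I -> Kk}) : cochain k n 1 :=
  [ffun s : {ffun 'I_2 -> I} => b (s ord0, s (lift ord0 ord0))].
apply: (has_dim_transfer (T := T) (U := U)); rewrite /T /U.
- by move=> b; apply/ffunP => -[i l]; rewrite !ffunE.
- by move=> z w; apply/ffunP => i; rewrite !ffunE.
- move=> a v; apply/ffunP => i; rewrite sum_ffunE !ffunE; apply: eq_bigr => l _.
  by rewrite !ffunE.
- move=> z; split=> [[hM hG]|[hM hG]].
    split=> [i l|i l q]; first by have := hM (pt2 i l); rewrite sections_on1 !ffunE.
    pose s : {ffun 'I_3 -> I} := [ffun a => if unlift ord0 a is Some b then pt2 l q b else i].
    have s0 : s ord0 = i by rewrite ffunE unlift_none.
    have sl b : s (lift ord0 b) = pt2 l q b by rewrite ffunE liftK.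
    have := hG s; rewrite sections_on2 cech_diff1 s0 !sl !ffunE /=.
    by rewrite /G /d1 !ffunE.
  split=> s; first by have := hM (s ord0) (s (lift ord0 ord0)); rewrite sections_on1 ffunE pt2K.
  have := hG (s ord0) (s (lift ord0 ord0)) (s (lift ord0 (lift ord0 ord0))).
  by rewrite sections_on2 cech_diff1 /d1 !ffunE.
- move=> z; split=> [[b [hM hG]]|[b hM hG]].
    exists [ffun i => b (pt1 i)]; first by move=> i; have := hM (pt1 i); rewrite sections_on0 !ffunE.
    move=> i l; have := hG (pt2 i l); rewrite sections_on1 cech_diff0 !ffunE /=.
    by rewrite /G.
  exists [ffun s : {ffun 'I_1 -> I} => b (s ord0)]; split=> s.
    by have := hM (s ord0); rewrite sections_on0 ffunE.
  have := hG (s ord0) (s (lift ord0 ord0)); rewrite sections_on1 cech_diff0 !ffunE /=.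
  by rewrite pt2K.
Qed.
End CechTransfer.

(** An infinite dimension on the right makes the inequality trivial. Otherwise uniqueness identifies
    the dimension chosen by [h_ideal] on the left with the one found. *)
Lemma dim_le_h_ideal (k : closedFieldType) (n : nat) (I1 J1 I2 J2 I3 J3 : set {mpoly k[n.+1]}) p :
  (forall m m', cech_has_dim I1 J1 p m -> cech_has_dim I1 J1 p m' -> m = m') ->
  (forall x y, cech_has_dim I2 J2 p x -> cech_has_dim I3 J3 p y ->
     exists2 m, (m <= x + y)%N & cech_has_dim I1 J1 p m) ->
  dim_le (h_ideal I1 J1 p) (dim_add (h_ideal I2 J2 p) (h_ideal I3 J3 p)).
Proof.
move=> uniq h; rewrite /h_ideal.
case: (pselect (exists m, cech_has_dim I2 J2 p m)) => [e2|_]; last by case: pselect => //=; case: pselect.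
case: (pselect (exists m, cech_has_dim I3 J3 p m)) => [e3|_]; last by case: pselect.
case: (cid e2) => x hx; case: (cid e3) => y hy /=.
have [m le_m hm] := h x y hx hy.
case: pselect => [e1|[]]; last by exists m.
by case: (cid e1) => m' hm' /=; rewrite (uniq _ _ hm' hm).
Qed.

(** * First-order jets along cones *)

Section Homogeneous.
Variables (k : fieldType) (N : nat).
Local Notation S := {mpoly k[N]}.
Implicit Types f g : S.

Lemma pihomogM e d f g : f \is e.-homog ->
  pihomog mdeg (e + d) (f * g) = f * pihomog mdeg d g.
Proof.
move=> hf; rewrite {1}(pihomog_partitionE (mf := mdeg) (leqnn (msize g))) mulr_sumr raddf_sum /=.
have H (b : nat) : f * pihomog mdeg b g \is (e + b).-homog.
  by apply: dhomogM => //; apply: pihomogP.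
have [lt_d|le_d] := ltnP d (msize g).
  rewrite (bigD1 (Ordinal lt_d)) //= big1 ?addr0; first by rewrite pihomog_dE.
  move=> b nb; apply: pihomog_ne0 (H b); rewrite eqn_add2l eq_sym.
  by apply: contra nb => /eqP E; apply/eqP/val_inj.
rewrite big1; last first.
  move=> b _; apply: pihomog_ne0 (H b); rewrite eqn_add2l.
  by rewrite neq_ltn (leq_trans (ltn_ord b) le_d).
suff -> : pihomog mdeg d g = 0 by rewrite mulr0.
rewrite pihomogE big1_seq // => m /andP[/eqP Em ms].
by have := msize_mdeg_lt ms; rewrite Em ltnNge le_d.
Qed.

Lemma homog_var (i : 'I_N) : ('X_i : S) \is 1.-homog.
Proof. by rewrite dhomogX; apply/eqP; apply: mdeg1. Qed.

Lemma homog_varX (i : 'I_N) e : ('X_i : S) ^+ e \is e.-homog.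
Proof. by rewrite -[X in X.-homog](mul1n e); apply: dhomogMn; apply: homog_var. Qed.

Lemma homog_prod (T : Type) (s : seq T) (F : T -> S) (d : T -> nat) :
  (forall i, F i \is (d i).-homog) ->
  \prod_(i <- s) F i \is (\sum_(i <- s) d i)%N.-homog.
Proof.
move=> h; elim: s => [|i s IH]; first by rewrite !big_nil dhomog1.
by rewrite !big_cons; apply: dhomogM.
Qed.

Lemma mmap_homog (f : S) d (y : S) (z : 'I_N -> S) : f \is d.-homog ->
  mmap (@mpolyC N k) (fun j => y * z j) f = y ^+ d * mmap (@mpolyC N k) z f.
Proof.
move=> /dhomogP hf; rewrite /mmap mulr_sumr; apply: eq_big_seq => m ms.
rewrite mulrCA; congr (_ * _); rewrite /mmap1.
under eq_bigr do rewrite exprMn.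
have E : mdeg m = d := hf m ms.
by rewrite big_split /= -E mdegE prodrXr.
Qed.

Lemma mmap_id (f : S) : mmap (@mpolyC N k) (fun j => 'X_j) f = f.
Proof.
rewrite [RHS]mpolyE /mmap; apply: eq_bigr => m _.
by rewrite mul_mpolyC mmap1_id.
Qed.

Lemma mmap_const (f : S) (v : 'I_N -> k) :
  mmap (@mpolyC N k) (fun j => (v j)%:MP) f = (f.@[v])%:MP.
Proof.
rewrite mevalE rmorph_sum /mmap; apply: eq_bigr => m _ /=.
rewrite mpolyCM; congr (_ * _); rewrite rmorph_prod; apply: eq_bigr => i _ /=.
by rewrite rmorphXn.
Qed.

Lemma eval_homog f d (v : 'I_N -> k) t : f \is d.-homog ->
  f.@[fun i => t * v i] = t ^+ d * f.@[v].
Proof.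
move=> hf; apply: (can_inj (@mpolyCK N k)).
rewrite -mmap_const mpolyCM rmorphXn /= -mmap_const -mmap_homog //.
by rewrite /mmap; apply: eq_bigr => m _; congr (_ * _); apply: eq_bigr => i _; rewrite mpolyCM.
Qed.

Lemma mderiv_homog f d (i : 'I_N) : f \is d.+1.-homog -> f^`M(i) \is d.-homog.
Proof.
move=> /dhomogP hf; apply/dhomogP => m; rewrite mcoeff_msupp mcoeff_deriv => h.
have : (m + U_(i))%MM \in msupp f.
  by rewrite mcoeff_msupp; apply: contraNneq h => ->; rewrite mul0rn.
by move=> /hf /=; rewrite mdegD mdeg1 addn1 => -[].
Qed.

Lemma mderiv_homog0 f (i : 'I_N) : f \is 0.-homog -> f^`M(i) = 0.
Proof.
move=> /dhomogP hf; apply/mpolyP => m; rewrite mcoeff_deriv mcoeff0.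
suff -> : f@_(m + U_(i)) = 0 by rewrite mul0rn.
apply/eqP; rewrite mcoeff_eq0; apply/negP => /hf /=.
by rewrite mdegD mdeg1 addn1.
Qed.

Lemma euler_monomial (m : 'X_{1..N}) :
  \sum_i 'X_i * ('X_[m])^`M(i) = (mdeg m)%:R * 'X_[m] :> S.
Proof.
rewrite mdegE natr_sum mulr_suml; apply: eq_bigr => i _.
rewrite mderivX -mul_mpolyC mulrCA mpolyC_nat.
have [->|mi] := eqVneq (m i) 0%N; first by rewrite !mul0r.
congr (_ * _); rewrite -mpolyXD addmC submK //.
by apply/mnm_lepP => l; rewrite mnm1E; case: eqP => // <-; rewrite lt0n.
Qed.

Lemma euler f d : f \is d.-homog -> \sum_i 'X_i * f^`M(i) = d%:R * f.
Proof.
move=> /dhomogP hf; rewrite {1 2}[f]mpolyE mulr_sumr.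
rewrite (eq_bigr (fun i => \sum_(m <- msupp f) f@_m *: ('X_i * ('X_[m])^`M(i)))); last first.
  move=> i _; rewrite raddf_sum /= mulr_sumr; apply: eq_bigr => m _.
  by rewrite mderivZ scalerAr.
rewrite exchange_big; apply: eq_big_seq => m ms /=.
by rewrite -scaler_sumr euler_monomial (hf m ms : mdeg m = d) scalerAr.
Qed.

Lemma euler_eval f d (v : 'I_N -> k) : f \is d.-homog ->
  (grad f v *m \col_i v i) 0 0 = d%:R * f.@[v].
Proof.
move=> hf; have := congr1 (meval v) (euler hf); rewrite mevalM rmorph_nat => <-.
rewrite rmorph_sum mxE; apply: eq_bigr => i _.
by rewrite !mxE rmorphM /= mevalXU mulrC.
Qed.

(** First-order expansion at [A]: the remainder is built from products of two increments, which lie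
    in [Q]. *)
Lemma taylor (Q : set S) (A B : 'I_N -> S) : is_ideal setT Q ->
  (forall i j, Q (B i * B j)) -> forall f,
  Q (mmap (@mpolyC N k) (fun i => A i + B i) f - mmap (@mpolyC N k) A f
     - \sum_i mmap (@mpolyC N k) A f^`M(i) * B i).
Proof.
move=> hQ QB.
have mor (z : 'I_N -> S) : exists2 p : {rmorphism S -> S},
    (forall f, mmap (@mpolyC N k) z f = p f)
    & (forall c, p c%:MP = c%:MP) /\ (forall i, p 'X_i = z i).
  exists (mmap (@mpolyC N k) z) => //; split=> [c|i]; first exact: mmapC.
  by rewrite /= mmapX mmap1U.
have [pAB EAB [ABC ABX]] := mor (fun i => A i + B i).
have [pA EA [AC AX]] := mor A.
move=> f; rewrite EAB EA; under eq_bigr do rewrite EA.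
pose L f := \sum_i pA f^`M(i) * B i.
suff h g : Q (pAB g - pA g - L g) by exact: h.
move: g; apply: mpoly_ring_ind.
- move=> c; rewrite /L big1 => [|i _]; last by rewrite mderivC rmorph0 mul0r.
  by rewrite subr0 ABC AC subrr; apply: ideal0.
- move=> i; have -> : L 'X_i = B i.
    rewrite /L (bigD1 i) //= big1 => [|j ji]; last first.
      by rewrite mderivXU (negPf ji) rmorph0 mul0r.
    by rewrite mderivXU eqxx rmorph1 mul1r addr0.
  by rewrite ABX AX [A i + _]addrC addrK subrr; apply: ideal0.
- move=> {}f g Qf Qg.
  have -> : L (f + g) = L f + L g.
    rewrite /L -big_split; apply: eq_bigr => i _ /=.
    by rewrite mderivD rmorphD mulrDl.
  rewrite (rmorphD pAB) (rmorphD pA).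
  have E (a b c d e e' : S) : a + b - (c + d) - (e + e') = (a - c - e) + (b - d - e') by ring.
  by rewrite E; apply: idealD.
- move=> {}f g Qf Qg.
  have -> : L (f * g) = L f * pA g + pA f * L g.
    rewrite /L mulr_suml mulr_sumr -big_split; apply: eq_bigr => i _ /=.
    by rewrite mderivM rmorphD !rmorphM; ring.
  have QL : Q (L f * L g).
    rewrite /L mulr_suml; apply: ideal_sum => // i _; rewrite mulr_sumr.
    by apply: ideal_sum => // j _; rewrite mulrACA; apply: idealM.
  rewrite (rmorphM pAB) (rmorphM pA).
  have E (a b c d e e' : S) : a * b - c * d - (e * d + c * e')
      = (a - c - e) * b + ((c + e) * (b - d - e') + e * e') by ring.
  by rewrite E; apply: idealD; [|apply: idealMl|apply: idealD; [|apply: idealM|]].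
Qed.
End Homogeneous.

Section Jets.
Variables (k : closedFieldType) (n : nat).
Hypothesis char0 : forall n, n.+1%:R != 0 :> k.
Local Notation S := {mpoly k[n.+1]}.
Local Notation I := 'I_n.+1.
Implicit Types (J : set S) (f g : S) (v : I -> k).

Definition nonzero v : Prop := exists i, v i != 0.

Lemma point_ideal_is_ideal v : is_ideal setT (point_ideal v).
Proof.
apply: is_idealP => [t|f g hf hg t|a f hf t]; first by rewrite meval0.
  by rewrite mevalD hf hg addr0.
by rewrite mevalM hf mulr0.
Qed.

Lemma point_ideal_eval v f : point_ideal v f -> f.@[v] = 0.
Proof. by move=> h; have := h 1; rewrite (meval_eq (v2 := v)) // => i; rewrite mul1r. Qed.

Lemma homog_point_ideal v f d : f \is d.-homog -> f.@[v] = 0 -> point_ideal v f.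
Proof. by move=> hf fv t; rewrite (eval_homog v t hf) fv mulr0. Qed.

(** Vanishing on the first neighbourhood of [v] in the scheme of [J], phrased with tangent vectors.
    For a form at a point of a homogeneous [J] it agrees with membership in $I_v^2+J$ up to powers
    of the variables. *)
Definition jet_in J v f : Prop :=
  f.@[v] = 0 /\ forall w, tangent J v w -> grad f v *m w = 0.

Lemma jet_ideal J v : is_ideal setT (jet_in J v).
Proof.
apply: is_idealP => [|f g [f0 hf] [g0 hg]|a f [f0 hf]].
- by split=> [|w _]; rewrite ?meval0 // grad0 mul0mx.
- by split=> [|w tw]; rewrite ?mevalD ?f0 ?g0 ?addr0 // gradD mulmxDl hf ?hg ?addr0.
- split=> [|w tw]; first by rewrite mevalM f0 mulr0.
  by rewrite gradM f0 scale0r add0r -scalemxAl hf ?scaler0.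
Qed.

Lemma jet_cancel J v s f : s.@[v] != 0 -> jet_in J v (s * f) -> jet_in J v f.
Proof.
move=> s0 [e h]; have f0 : f.@[v] = 0.
  by move: e; rewrite mevalM => /eqP; rewrite mulf_eq0 (negPf s0) => /eqP.
split=> // w tw; have := h w tw; rewrite gradM f0 scale0r add0r -scalemxAl.
by move/eqP; rewrite scaler_eq0 (negPf s0) => /eqP.
Qed.

Lemma jet_square J v : idmul (point_ideal v) (point_ideal v) `<=` jet_in J v.
Proof.
apply: idmul_sub; first exact: jet_ideal.
move=> a b /point_ideal_eval a0 /point_ideal_eval b0; split; first by rewrite mevalM a0 mul0r.
by move=> w _; rewrite gradM a0 b0 !scale0r addr0 mul0mx.
Qed.

Lemma jet_self J v f : point_of J v -> J f -> jet_in J v f.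
Proof. by move=> [_ hv] Jf; split=> [|w]; [apply: hv | apply]. Qed.

Lemma jet_sat J v f : point_of J v -> saturation J f -> jet_in J v f.
Proof.
move=> pv [m h]; have [[i vi] _] := pv.
apply: (jet_cancel (s := 'X_i ^+ m)); first by rewrite rmorphXn /= mevalXU expf_neq0.
exact: jet_self.
Qed.

Lemma double_jet J v : point_of J v ->
  idsum (idmul (point_ideal v) (point_ideal v)) J `<=` jet_in J v.
Proof.
move=> pv; apply: idsum_sub; first exact: jet_ideal.
- exact: jet_square.
- by move=> f; apply: jet_self.
Qed.

Lemma tangent_homog J v w : homog_ideal J ->
  (forall f d, J f -> f \is d.-homog -> grad f v *m w = 0) -> tangent J v w.
Proof.
move=> [_ hJ] h f Jf; rewrite (pihomog_partitionE (mf := mdeg) (leqnn (msize f))).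
rewrite grad_sum mulmx_suml big1 // => d _.
by apply: (h _ d); [apply: hJ | apply: pihomogP].
Qed.

Lemma euler_tangent J v : homog_ideal J -> point_of J v -> tangent J v (\col_i v i).
Proof.
move=> hJ [_ hv]; apply: tangent_homog => // f d Jf hf.
apply/matrixP => i j; rewrite !ord1 (euler_eval v hf) hv // mulr0.
by rewrite mxE.
Qed.

Lemma submx_of_kernel m (x : 'rV[k]_n.+1) (M : 'M[k]_(m, n.+1)) :
  (forall w : 'cV_n.+1, M *m w = 0 -> x *m w = 0) -> (x <= M)%MS.
Proof.
move=> h; rewrite submxE; apply/eqP/matrixP => i j.
have : x *m (cokermx M *m delta_mx j (0 : 'I_1)) = 0.
  by apply: h; rewrite mulmxA mulmx_coker mul0mx.
rewrite mulmxA -colE => /matrixP /(_ i 0).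
by rewrite !mxE.
Qed.

(** Write $v_ix_a=x_iv_a+(v_ix_a-x_iv_a)$, with the bracket in the ideal of the point, and expand
    $f(v_ix)=v_i^df(x)$ to first order. *)
Lemma vanishing_jet_square v i f d : v i != 0 -> f \is d.-homog ->
  f.@[v] = 0 -> grad f v = 0 -> idmul (point_ideal v) (point_ideal v) f.
Proof.
move=> vi hf fv gf.
have hI := point_ideal_is_ideal v; have hQ := is_ideal_idmul (point_ideal v) hI.
pose A (j : I) : S := 'X_i * (v j)%:MP; pose B (j : I) : S := (v i)%:MP * 'X_j - A j.
have PB j : point_ideal v (B j).
  move=> t; rewrite mevalB !mevalM !mevalXU !mevalC; ring.
have := taylor A hQ (fun j l => idmul_mul (PB j) (PB l)) f.
have -> : mmap (@mpolyC n.+1 k) (fun j => A j + B j) f = (v i ^+ d)%:MP * f.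
  rewrite -[f in RHS]mmap_id rmorphXn /= -mmap_homog //.
  by apply: eq_bigr => m _; congr (_ * _); apply: eq_bigr => j _; rewrite /B addrC subrK.
rewrite (mmap_homog _ _ hf) mmap_const fv mulr0 subr0 big1 ?subr0 => [h|j _].
  have := idealM (v i ^+ d)^-1%:MP hQ h.
  by rewrite mulrA -mpolyCM mulVf ?mul1r // expf_neq0.
have fj : (f^`M(j)).@[v] = 0 by have := congr1 (fun X : 'rV_n.+1 => X 0 j) gf; rewrite !mxE.
case: d hf => [|d] hf; first by rewrite mderiv_homog0 // mmap0 mul0r.
by rewrite (mmap_homog _ _ (mderiv_homog j hf)) mmap_const fj mulr0 mul0r.
Qed.

(** If [v i] is $0$, then ['X_i ^+ 2] is in the square of the ideal of the point. Otherwise the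
    gradient of [f] is a combination of gradients of forms of [J]; subtracting these forms, brought
    to one degree by powers of ['X_i], leaves a form with zero jet. *)
Lemma jet_double_chart J v f d i : homog_ideal J -> point_of J v ->
  f \is d.-homog -> jet_in J v f ->
  exists m, idsum (idmul (point_ideal v) (point_ideal v)) J ('X_i ^+ m * f).
Proof.
move=> hJ pv hf [fv jf]; have [hJi _] := hJ.
have hI := point_ideal_is_ideal v; have hQ := is_ideal_idmul (point_ideal v) hI.
have [vi|vi] := eqVneq (v i) 0.
  exists 2%N; apply: idsuml => //; apply: idealMl => //; rewrite expr2.
  by apply: idmul_mul; apply: (homog_point_ideal (homog_var _ i)); rewrite mevalXU.
have [m [g [gG _ gspan]]] := max_row_free
  [set x | exists F e, [/\ J F, F \is e.-homog & x = grad F v]].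
have /choice[F FP] : forall l, exists F, exists e, [/\ J F, F \is e.-homog & g l = grad F v].
  by move=> l; exact: gG.
have /choice[e {}FP] := FP.
have /submxP[c fc] : (grad f v <= \matrix_l g l)%MS.
  apply: submx_of_kernel => w Mw; apply: jf; apply: tangent_homog => // G b JG hG.
  have /submxP[D ->] : (grad G v <= \matrix_l g l)%MS by apply: gspan; exists G, b.
  by rewrite -mulmxA Mw mulmx0.
pose m0 := (\max_l e l)%N.
pose a l := (m0 + d - e l)%N.
pose b l := c 0 l * v i ^+ m0 / v i ^+ a l.
pose h := \sum_l (b l)%:MP * ('X_i ^+ a l * F l).
have Jh : J h.
  apply: ideal_sum => // l _; apply: idealM => //; apply: idealM => //.
  by have [] := FP l.
exists m0; rewrite -(subrK h ('X_i ^+ m0 * f)).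
exists ('X_i ^+ m0 * f - h), h; split=> //.
have hh : h \is (m0 + d).-homog.
  apply: rpred_sum => l _; rewrite mul_mpolyC dhomogZ //.
  have -> : (m0 + d = a l + e l)%N.
    by rewrite subnK // (leq_trans _ (leq_addr _ _)) // (leq_bigmax l).
  by apply: dhomogM; [apply: homog_varX | have [] := FP l].
apply: (vanishing_jet_square vi (d := (m0 + d)%N)).
- by rewrite rpredB //; apply: dhomogM => //; apply: homog_varX.
- by rewrite mevalB mevalM fv mulr0 (pv.2 _ Jh) subrr.
- rewrite gradB gradM fv scale0r add0r rmorphXn /= mevalXU grad_sum.
  rewrite fc mulmx_sum_row scaler_sumr -sumrB big1 // => l _.
  have [JF _ Eg] := FP l.
  rewrite rowK mul_mpolyC gradZ gradM (pv.2 _ JF) scale0r add0r rmorphXn /= mevalXU.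
  by rewrite !scalerA Eg /b mulfVK ?expf_neq0 // [_ * c 0 l]mulrC subrr.
Qed.

Lemma jet_double J v f d : homog_ideal J -> point_of J v ->
  f \is d.-homog -> jet_in J v f ->
  exists m, forall m' i, (m <= m')%N ->
    idsum (idmul (point_ideal v) (point_ideal v)) J ('X_i ^+ m' * f).
Proof.
move=> hJ pv hf jf.
have /choice[e eP] : forall i, exists m,
    idsum (idmul (point_ideal v) (point_ideal v)) J ('X_i ^+ m * f).
  by move=> i; apply: jet_double_chart hf jf.
exists (\max_i e i)%N => m' i le_m.
have hI : is_ideal setT (idsum (idmul (point_ideal v) (point_ideal v)) J).
  apply: is_ideal_idsum; last by case: hJ.
  exact/is_ideal_idmul/point_ideal_is_ideal.
have le_i : (e i <= m')%N by apply: leq_trans le_m; apply: (leq_bigmax i).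
by rewrite -(subnK le_i) exprD -mulrA; apply: idealM.
Qed.

(* In degree d >= 1 the value at v is recovered from the derivative along v. *)
Lemma jet_of_grad J v f d : homog_ideal J -> point_of J v -> f \is d.+1.-homog ->
  (forall w, tangent J v w -> grad f v *m w = 0) -> jet_in J v f.
Proof.
move=> hJ pv hf h; split=> //.
have := euler_eval v hf; rewrite (h _ (euler_tangent hJ pv)) mxE => /esym/eqP.
by rewrite mulf_eq0 (negPf (char0 d)) => /eqP.
Qed.
End Jets.

(** * Local equations of Cartier divisors *)

Lemma fraction_identity (F : fieldType) (u a1 z1 x w a z : F) :
  x != 0 -> w != 0 -> a != 0 -> z != 0 ->
  w * a * z * (x * (u / w * (a1 / a) + z1 / z)) - u * (x * a1 * z) = x * w * a * z1.
Proof. by move=> x0 w0 a0 z0; field; rewrite z0 a0 w0. Qed.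

Lemma fraction_cancel (F : fieldType) (u f x w s : F) : x != 0 -> w != 0 -> s != 0 ->
  u / w * (f / x) = s * (u * f) / (s * w * x).
Proof. by move=> x0 w0 s0; field; rewrite x0 w0 s0. Qed.

Lemma fraction_cross (F : fieldType) (f x b y : F) : b != 0 -> x != 0 ->
  f / x = y / b -> b * f = x * y.
Proof. by move=> b0 x0 /eqP; rewrite eqr_div // => /eqP; rewrite mulrC => ->; rewrite mulrC. Qed.

Section Local.
Variables (k : closedFieldType) (n : nat).
Local Notation S := {mpoly k[n.+1]}.
Local Notation K := {fraction {mpoly k[n.+1]}}.
Local Notation I := 'I_n.+1.
Implicit Types (J : set S) (f g : S) (v : I -> k).

(** Membership in the stalk at [v], with a form as denominator, expressed inside the polynomial
    ring. *)
Definition loc J v f : Prop :=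
  exists s d, [/\ s \is d.-homog, s.@[v] != 0 & J (s * f)].

Lemma loc_in J v f : J f -> loc J v f.
Proof. by move=> Jf; exists 1, 0%N; rewrite dhomog1 meval1 oner_eq0 mul1r. Qed.

Lemma loc_of_sat J v f : nonzero v -> saturation J f -> loc J v f.
Proof.
move=> [i vi] [m h]; exists ('X_i ^+ m), m; split=> //; first exact: homog_varX.
by rewrite rmorphXn /= mevalXU expf_neq0.
Qed.

Lemma locM J v s d f : s \is d.-homog -> s.@[v] != 0 -> loc J v (s * f) -> loc J v f.
Proof.
move=> hs s0 [s' [d' [hs' s0' h]]]; exists (s' * s), (d' + d)%N.
by split; [apply: dhomogM | rewrite mevalM mulf_neq0 | rewrite -mulrA].
Qed.

Lemma loc_ideal J v : is_ideal setT J -> is_ideal setT (loc J v).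
Proof.
move=> hJ; apply: is_idealP.
- by apply: loc_in; apply: ideal0.
- move=> f g [s [d [hs s0 hf]]] [s' [d' [hs' s0' hg]]].
  exists (s * s'), (d + d')%N; split; first exact: dhomogM.
    by rewrite mevalM mulf_neq0.
  rewrite mulrDr; apply: idealD => //.
    by rewrite [s * s']mulrC -mulrA; apply: idealM.
  by rewrite -mulrA; apply: idealM.
- move=> a f [s [d [hs s0 hf]]]; exists s, d; split=> //.
  by rewrite mulrCA; apply: idealM.
Qed.

(** The ideal of all [s] with [s * f] in [J] has no zero outside the origin, so by the
    Nullstellensatz it contains a power of every variable. *)
Lemma sat_of_loc J f : is_ideal setT J -> (forall v, nonzero v -> loc J v f) ->
  saturation J f.
Proof.
move=> hJ h; have hC : is_ideal setT [set s | J (s * f)].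
  apply: is_idealP; first by rewrite /mkset mul0r; apply: ideal0.
    by move=> x y hx hy; rewrite /mkset mulrDl; apply: idealD.
  by move=> a x hx; rewrite /mkset -mulrA; apply: idealM.
have /choice[e eP] : forall i : I, exists m, J ('X_i ^+ m * f).
  move=> i; apply: (nullstellensatz hC) => v hv; rewrite mevalXU.
  apply/eqP; apply: contrapT => /negP vi.
  have [s [d [_ /eqP s0 Js]]] := h v (ex_intro _ i vi).
  by apply: s0; apply: hv.
exists (\max_i e i)%N => i.
have le_i : (e i <= \max_i e i)%N by apply: (leq_bigmax i).
by rewrite -(subnK le_i) exprD -mulrA; apply: idealM.
Qed.

Lemma sat_ideal J : is_ideal setT J -> is_ideal setT (saturation J).
Proof.
move=> hJ; apply: is_idealP.
- by exists 0%N => i; rewrite mulr0; apply: ideal0.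
- move=> x y [m hx] [m' hy]; exists (m + m')%N => i; rewrite mulrDr.
  apply: idealD => //; first by rewrite addnC exprD -mulrA; apply: idealM.
  by rewrite exprD -mulrA; apply: idealM.
- by move=> a x [m hx]; exists m => i; rewrite mulrCA; apply: idealM.
Qed.

Lemma sub_sat J : is_ideal setT J -> J `<=` saturation J.
Proof. by move=> hJ f Jf; exists 0%N => i; rewrite mul1r. Qed.

Lemma satS J J' : J `<=` J' -> saturation J `<=` saturation J'.
Proof. by move=> sJ f [m h]; exists m => i; apply: sJ. Qed.

Lemma sat_sat J : is_ideal setT J -> saturation (saturation J) `<=` saturation J.
Proof.
move=> hJ f sf; apply: sat_of_loc => // v nv.
have [s [d [hs s0 h]]] := loc_of_sat nv sf.
exact: locM hs s0 (loc_of_sat nv h).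
Qed.

Lemma sat_eval J v f : point_of J v -> saturation J f -> f.@[v] = 0.
Proof.
move=> [[i vi] hv] [m /(_ i) /hv]; rewrite mevalM rmorphXn /= mevalXU => /eqP.
by rewrite mulf_eq0 expf_eq0 (negPf vi) andbF => /eqP.
Qed.

Lemma homog_idsum J J' : homog_ideal J -> homog_ideal J' -> homog_ideal (idsum J J').
Proof.
move=> [h p] [h' p']; split=> [|_ d [a [b [Ja Jb ->]]]]; first exact: is_ideal_idsum.
by exists (pihomog mdeg d a), (pihomog mdeg d b); rewrite pihomogD; split=> //; [apply: p | apply: p'].
Qed.

Lemma point_sat J J' v : is_ideal setT J -> closed_sub J J' -> point_of J' v -> point_of J v.
Proof.
move=> hJ sJ pv; split; first by case: pv.
by move=> f Jf; apply: (sat_eval pv); apply: sJ; apply: sub_sat.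
Qed.

(* u is an equation of D at v: D = (u) + X locally, and u is not a zero divisor
   on X. *)
Definition local_equation IX ID v u du : Prop :=
  [/\ ID u, u \is du.-homog,
    forall h d, ID h -> h \is d.-homog -> exists s ds t dt,
      [/\ s \is ds.-homog, s.@[v] != 0, t \is dt.-homog,
          (ds + d = du + dt)%N & IX (s * h - u * t)]
  & forall f, loc IX v (u * f) -> loc IX v f].

Lemma stalk_mem J v x (a b : S) e : J a -> a \is e.-homog -> b \is e.-homog ->
  b.@[v] != 0 -> x = tofrac a / tofrac b -> stalk J v x.
Proof. by move=> Ja ha hb b0 ->; exists e, a, b. Qed.

(** [u] is the numerator of a generator of the stalk. The two conditions on the generator become
    those on [u] by clearing denominators, which are units at [v]. *)
Lemma cartier_local IX ID v : homog_ideal IX -> homog_ideal ID ->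
  cartier_divisor IX ID -> point_of IX v -> exists u du, local_equation IX ID v u du.
Proof.
move=> [hX pX] [hD pD] [_ cart] pv; have [g [_ nzd E]] := cart v pv.
have [[i vi] _] := pv.
have st0 : stalk IX v 0.
  exists 0%N, 0, 1; split=> //; [exact: ideal0 | exact: dhomog0 | exact: dhomog1 | | ].
    by rewrite meval1 oner_eq0.
  by rewrite rmorph0 mul0r.
have st1 : local_ring v 1.
  exists 0%N, 1, 1; split=> //; [exact: dhomog1 | exact: dhomog1 | | ].
    by rewrite meval1 oner_eq0.
  by rewrite rmorph1 divr1.
have [du [u [w [Du hu hw w0 gE]]]] : stalk ID v g.
  by rewrite E; exists (g * 1), 0; split=> //; [exists 1 | rewrite mulr1 addr0].
have tf0 b : b.@[v] != 0 -> tofrac b != 0 :> K.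
  by move=> b0; rewrite tofrac_eq0; apply: contraNneq b0 => ->; rewrite meval0.
have Xi d : ('X_i ^+ d : S).@[v] != 0 by rewrite rmorphXn /= mevalXU expf_neq0.
exists u, du; split=> //.
- move=> h d Dh hh.
  have : stalk ID v (tofrac h / tofrac ('X_i ^+ d)) by exists d, h, ('X_i ^+ d); split=> //; apply: homog_varX.
  rewrite E gE => -[_ [z [[a la <-] lz Eh]]].
  have [d1 [a1 [a2 [_ ha1 ha2 a20 Ea]]]] := la.
  have [d2 [z1 [z2 [Xz1 hz1 hz2 z20 Ez]]]] := lz.
  rewrite {}Ea {}Ez in Eh.
  exists (w * a2 * z2), (du + d1 + d2)%N, ('X_i ^+ d * a1 * z2), (d + d1 + d2)%N; split.
  + by apply: dhomogM => //; apply: dhomogM.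
  + by rewrite !mevalM !mulf_neq0.
  + by apply: dhomogM => //; apply: dhomogM => //; apply: homog_varX.
  + by rewrite [LHS]addnC !addnA [(d + du)%N]addnC.
  + suff -> : w * a2 * z2 * h - u * ('X_i ^+ d * a1 * z2) = 'X_i ^+ d * w * a2 * z1.
      by apply: idealM.
    apply/eqP; rewrite -tofrac_eq; apply/eqP.
    rewrite rmorphB /= !rmorphM /=.
    have X0 := tf0 _ (Xi d).
    rewrite -(fraction_identity (tofrac u) (tofrac a1) (tofrac z1) X0 (tf0 _ w0) (tf0 _ a20) (tf0 _ z20)).
    by rewrite -Eh [_ * (tofrac h / _)]mulrC divfK.
- have step f d : f \is d.-homog -> loc IX v (u * f) -> loc IX v f.
    move=> hf [s [e [hs s0 h]]].
    have : stalk IX v (g * (tofrac f / tofrac ('X_i ^+ d))).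
      apply: (@stalk_mem _ _ _ (s * (u * f)) (s * w * 'X_i ^+ d) (e + (du + d))) => //.
      + by apply: dhomogM => //; apply: dhomogM.
      + by rewrite addnA; apply: dhomogM; [apply: dhomogM | apply: homog_varX].
      + by rewrite !mevalM !mulf_neq0.
      + rewrite gE !rmorphM /=.
        exact: (fraction_cancel (tofrac u) (tofrac f) (tf0 _ (Xi d)) (tf0 _ w0) (tf0 _ s0)).
    move=> /nzd; case; first by exists d, f, ('X_i ^+ d); split=> //; apply: homog_varX.
    move=> e' [x [b [Xx hx hb b0 Ef]]]; exists b, e'; split=> //.
    suff -> : b * f = 'X_i ^+ d * x by apply: idealM.
    apply/eqP; rewrite -tofrac_eq !rmorphM /=; apply/eqP.
    exact: fraction_cross (tf0 _ b0) (tf0 _ (Xi d)) Ef.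
  (* Reduction to forms: [s * u] is homogeneous and [IX] contains the homogeneous components of its
     elements. *)
  move=> f [s [e [hs s0 h]]].
  have lX := loc_ideal v hX.
  rewrite (pihomog_partitionE (mf := mdeg) (leqnn (msize f))); apply: ideal_sum => // d _.
  apply: (step _ d); first exact: pihomogP.
  exists s, e; split=> //.
  by rewrite mulrA -(pihomogM _ _ (dhomogM hs hu)) -mulrA; apply: pX.
Qed.

(** The product of the separate denominators serves all [h l] at once and gives quotients of one
    degree, so that dividing by [u] commutes with linear combinations of the family. *)
Lemma common_local_division IX ID v u du m (h : 'I_m -> S) d :
  is_ideal setT IX ->
  local_equation IX ID v u du -> (forall l, ID (h l)) -> (forall l, h l \is d.-homog) ->
  exists s ds dg (g : 'I_m -> S), [/\ s \is ds.-homog, s.@[v] != 0,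
    forall l, g l \is dg.-homog & forall l, IX (s * h l - u * g l)].
Proof.
move=> hX [_ _ div _] Dh hh.
have /choice[s /choice[ds /choice[t /choice[dt P]]]] :
  forall l, exists s ds t dt, [/\ s \is ds.-homog, s.@[v] != 0, t \is dt.-homog,
          (ds + d = du + dt)%N & IX (s * h l - u * t)].
  by move=> l; apply: div.
pose c l := \prod_(l' | l' != l) s l'.
have cs l : c l * s l = \prod_l s l by rewrite [RHS](bigD1 l) //= mulrC.
pose D := (\sum_l ds l)%N.
have hc l : c l \is (\sum_(l' | l' != l) ds l')%N.-homog.
  rewrite /c -!(big_filter (index_enum _)); apply: homog_prod => l'.
  by have [] := P l'.
exists (\prod_l s l), D, (D + d - du)%N, (fun l => c l * t l); split.
- by apply: homog_prod => l; have [] := P l.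
- by rewrite rmorph_prod; apply/prodf_neq0 => l _; have [] := P l.
- move=> l; have [_ _ ht E _] := P l.
  have -> : (D + d - du = \sum_(l' | l' != l) ds l' + dt l)%N.
    by rewrite /D (bigD1 l) //=; move: E; lia.
  exact: dhomogM.
- move=> l; have [_ _ _ _ Xl] := P l.
  have -> : \prod_l s l * h l - u * (c l * t l) = c l * (s l * h l - u * t l).
    by rewrite -(cs l); ring.
  exact: idealM.
Qed.
End Local.

(** * The three skyscraper quotients *)

Section SkyscraperSections.
Variables (k : closedFieldType) (n : nat).
Local Notation S := {mpoly k[n.+1]}.
Local Notation I := 'I_n.+1.

Lemma loc_common (A : finType) (J : A -> set S) (v : I -> k) (f : A -> S) :
  (forall a, is_ideal setT (J a)) -> (forall a, loc (J a) v (f a)) ->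
  exists s d, [/\ s \is d.-homog, s.@[v] != 0 & forall a, J a (s * f a)].
Proof.
move=> hJ /choice[s /choice[d P]].
exists (\prod_a s a), (\sum_a d a)%N; split.
- by apply: homog_prod => a; have [] := P a.
- by rewrite rmorph_prod; apply/prodf_neq0 => a _; have [] := P a.
- move=> a; rewrite (bigD1 a) //= [s a * _]mulrC -mulrA; apply: idealM => //.
  by have [] := P a.
Qed.

Lemma loc_same_point (J : set S) (v w : I -> k) f : same_point v w -> loc J v f -> loc J w f.
Proof.
move=> [c [c0 E]] [s [d [hs s0 h]]]; exists s, d; split=> //.
apply: contraNneq s0 => sw; rewrite (meval_eq (v2 := fun i => c * w i)) //.
by rewrite (eval_homog w c hs) sw mulr0.
Qed.

Lemma homog_witness (J : set S) (v : I -> k) : homog_ideal J -> nonzero v -> ~ point_of J v ->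
  exists s d, [/\ s \is d.-homog, s.@[v] != 0 & J s].
Proof.
move=> [_ hJ] nv np; have /existsNP[F /not_implyP[JF Fv]] : ~ forall f, J f -> f.@[v] = 0.
  by move=> h; apply: np.
apply: contrapT => h; apply: Fv.
rewrite (pihomog_partitionE (mf := mdeg) (leqnn (msize F))) rmorph_sum big1 // => d _ /=.
apply/eqP; apply: contrapT => /negP nz; apply: h.
by exists (pihomog mdeg d F), d; split=> //; [apply: pihomogP | apply: hJ].
Qed.

Variables (M M' : set S) (j : I).
Hypotheses (hM : is_ideal setT M) (hM' : is_ideal setT M').

Lemma skyscraper_sec delta : M' `<=` saturation M ->
  (forall f m d, f \is d.-homog -> M f -> M' ('X_j ^+ m * f) -> saturation M' f) ->
  has_qdim (sec [:: j] M) (sec [:: j] M') delta ->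
  skyscraper j (fun ls => sec ls M) (fun ls => sec ls M') delta.
Proof.
move=> sM nzd qd; split=> // [i ls|i ls x Mx M'x|i].
- exact: sec_sat.
- by apply: (sec_descend hM hM' nzd).
- exact: (sec_localize hM hM' nzd qd).
Qed.

Lemma qdim_chart_bound B :
  (forall m e (a : 'I_m -> S), (forall l, M (a l)) -> (forall l, a l \is e.+1.-homog) ->
     exists phi : 'I_m -> 'rV[k]_B, forall c : 'I_m -> k,
       \sum_l c l *: phi l = 0 -> saturation M' (\sum_l (c l)%:MP * a l)) ->
  exists2 delta, (delta <= B)%N & has_qdim (sec [:: j] M) (sec [:: j] M') delta.
Proof.
move=> h; apply: qdim_exists; first exact: sec_subsp.
move=> m v vM vI; have [e /(_ e (leqnn e))[a aP]] := sec_family hM vM.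
have [l|l|phi phiP] := h m e a.
- by have [] := aP l.
- by have [_ hl _] := aP l; rewrite /= muln1 in hl.
rewrite leqNgt; apply/negP => lt_B.
have : kermx (\matrix_l phi l) != 0.
  rewrite -mxrank_eq0 mxrank_ker subn_eq0 -ltnNge.
  exact: leq_ltn_trans (rank_leq_col _) lt_B.
case/rowV0Pn => u /sub_kermxP uM u0.
have /phiP sat : \sum_l u 0 l *: phi l = 0.
  by rewrite -[RHS]uM mulmx_sum_row; apply: eq_bigr => l _; rewrite rowK.
case/eqP: u0; apply/rowP => l; rewrite mxE; apply: (vI (fun l => u 0 l)).
have -> : \sum_l u 0 l *: v l = tofrac (\sum_l (u 0 l)%:MP * a l) / tofrac (mons k [:: j]) ^+ e.
  by rewrite -sum_scale_tofrac; apply: eq_bigr => l' _; have [_ _ ->] := aP l'.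
apply: (sec_sat (J := saturation M') hM' (fun x => id)).
exists e, (\sum_l (u 0 l)%:MP * a l); split=> //.
by apply: homog_sum => l'; have [] := aP l'.
Qed.

Lemma qdim_chart_ge delta m e (a : 'I_m -> S) :
  has_qdim (sec [:: j] M) (sec [:: j] M') delta ->
  (forall l, M (a l)) -> (forall l, a l \is e.+1.-homog) ->
  (forall c : 'I_m -> k, forall b, M' ('X_j ^+ b * \sum_l (c l)%:MP * a l) ->
     forall l, c l = 0) -> (m <= delta)%N.
Proof.
move=> qd Ma ha h.
apply: (qdim_indep (sec_subsp [:: j] hM')
  (v := fun l => tofrac (a l) / tofrac (mons k [:: j]) ^+ e : fracmod k n.+1) _ _ qd).
  by move=> l; exists e, (a l); split=> //; rewrite /= muln1.
move=> c; rewrite sum_scale_tofrac => -[e' [b [Mb hb Eb]]].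
apply: (h c e').
have := sec_eq Eb; rewrite {1}/mons big_seq1 mulrC => ->; exact: idealMl.
Qed.
End SkyscraperSections.

Section HoraceSetting.
Variables (k : closedFieldType) (n : nat).
Hypothesis char0 : forall n, n.+1%:R != 0 :> k.
Local Notation S := {mpoly k[n.+1]}.
Local Notation I := 'I_n.+1.
Variables IX IH IH' IW : set S.
Hypotheses (hX : homog_ideal IX) (hH : homog_ideal IH) (hH' : homog_ideal IH')
  (hW : homog_ideal IW).
Hypotheses (XH : closed_sub IX IH) (XW : closed_sub IX IW).
Variable j : I.

Let iX : is_ideal setT IX. Proof. by case: hX. Qed.
Let iH : is_ideal setT IH. Proof. by case: hH. Qed.
Let iH' : is_ideal setT IH'. Proof. by case: hH'. Qed.
Let iW : is_ideal setT IW. Proof. by case: hW. Qed.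
Let satX J : closed_sub IX J -> IX `<=` saturation J.
Proof. by move=> XJ f Xf; apply: XJ; apply: sub_sat. Qed.

(** [twoH], [resid] and [trace] are the sums [idsum J I] that [h_ideal] forms from the three schemes
    of the inequality; [whole], [vanishing] and [restricted] define the sheaves $I_W$, $A$ and $T$
    that contain them. *)
Definition twoH r (Z : 'M[k]_(r, n.+1)) := idsum (IW `&` double_points IH Z) IX.
Definition resid r (P : 'M[k]_(r, n.+1)) :=
  idsum (idmul (colon IW IH' `&` double_points (idsum IH IH') P) IH') IX.
Definition trace r (P : 'M[k]_(r, n.+1)) :=
  idsum (idsum IW IH' `&` simple_points P) IH'.
Definition whole := idsum IW IX.
Definition vanishing := whole `&` IH'.
Definition restricted := idsum (idsum IW IH') IH'.

Lemma double_points_ideal J r (P : 'M[k]_(r, n.+1)) : is_ideal setT J ->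
  is_ideal setT (double_points J P).
Proof.
move=> hJ; have h i : is_ideal setT (idsum (idmul (point_ideal (P i)) (point_ideal (P i))) J).
  exact/is_ideal_idsum/hJ/is_ideal_idmul/point_ideal_is_ideal.
apply: is_idealP => [i|f g hf hg i|a f hf i].
- exact: (ideal0 (h i)).
- exact: (idealD (h i) (hf i) (hg i)).
- exact: (idealM a (h i) (hf i)).
Qed.

Lemma simple_points_ideal r (P : 'M[k]_(r, n.+1)) : is_ideal setT (simple_points P).
Proof.
have h i := point_ideal_is_ideal (P i).
apply: is_idealP => [i|f g hf hg i|a f hf i].
- exact: (ideal0 (h i)).
- exact: (idealD (h i) (hf i) (hg i)).
- exact: (idealM a (h i) (hf i)).
Qed.

Lemma whole_ideal : is_ideal setT whole. Proof. exact: is_ideal_idsum. Qed.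

Lemma whole_sat : whole `<=` saturation IW.
Proof. by apply: idsum_sub; [apply: sat_ideal | apply: sub_sat | apply: satX]. Qed.

Section DoubleInH.
Variables (r d : nat) (Z : 'M[k]_(r, n.+1)).
Hypotheses (ZH : points_on IH Z) (Zj : forall i, Z i j != 0).

Lemma twoH_ideal : is_ideal setT (twoH Z).
Proof. by apply: is_ideal_idsum => //; apply: is_ideal_setI => //; apply: double_points_ideal. Qed.

Lemma sat_twoH f e : f \is e.-homog -> saturation IW f ->
  (forall i, jet_in IH (Z i) f) -> saturation (twoH Z) f.
Proof.
move=> hf [m0 Wf] jf.
have /choice[m mP] : forall i, exists m, forall m' l, (m <= m')%N ->
    idsum (idmul (point_ideal (Z i)) (point_ideal (Z i))) IH ('X_l ^+ m' * f).
  by move=> i; exact: (jet_double hH (ZH i) hf (jf i)).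
exists (m0 + \max_i m i)%N => l; apply: idsuml => //; split.
  by rewrite addnC exprD -mulrA; apply: idealM.
move=> i; apply: (mP i); apply: leq_trans (leq_addl _ _).
exact: (leq_bigmax i).
Qed.

Lemma twoH_jet i : twoH Z `<=` jet_in IH (Z i).
Proof.
apply: idsum_sub; first exact: jet_ideal.
- by move=> f [_ h]; apply: double_jet.
- by move=> f Xf; apply: jet_sat => //; apply: satX.
Qed.

(** A jet is recorded by its derivatives along the [d] columns of [K i]; as the forms have positive
    degree, the value follows by Euler's formula. Hence at most [d] conditions per point. *)
Lemma skyscraper_twoH :
  (forall i, exists K : 'M[k]_(n.+1, d), forall w, tangent IH (Z i) w -> exists z, w = K *m z) ->
  exists2 dW, (dW <= r * d)%N &
    skyscraper j (fun ls => sec ls whole) (fun ls => sec ls (twoH Z)) dW.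
Proof.
move=> /choice[K KP].
have [delta le_d qd] : exists2 delta, (delta <= r * d)%N &
    has_qdim (sec [:: j] whole) (sec [:: j] (twoH Z)) delta.
  apply: qdim_chart_bound; [exact: whole_ideal | exact: twoH_ideal |].
  move=> m e a Wa ha.
  pose phi l := mxvec (\matrix_(i < r, b < d) (grad (a l) (Z i) *m K i) 0 b).
  exists phi => c c0; apply: (sat_twoH (e := e.+1)).
  - exact: homog_sum.
  - apply: whole_sat; apply: ideal_sum => [|l _]; first exact: whole_ideal.
    by apply: idealM => //; apply: whole_ideal.
  - move=> i; apply: (jet_of_grad char0 hH (ZH i) (homog_sum c ha)) => w /KP[z ->].
    rewrite mulmxA (_ : grad _ _ *m K i = 0) ?mul0mx //.
    apply/rowP => b; rewrite [RHS]mxE.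
    have := congr1 (fun X : 'rV_(r * d) => vec_mx X i b) c0.
    rewrite linear_sum linear0 summxE [RHS]mxE => E.
    rewrite grad_sum mulmx_suml summxE -[RHS]E; apply: eq_bigr => l _.
    by rewrite /phi [in RHS]linearZ /= mxvecK mul_mpolyC gradZ -scalemxAl [LHS]mxE [RHS]mxE; congr (_ * _); rewrite [RHS]mxE.
exists delta => //; apply: skyscraper_sec qd; [exact: whole_ideal | exact: twoH_ideal | |].
- apply: idsum_sub; first exact/sat_ideal/whole_ideal.
    by move=> f [Wf _]; apply: sub_sat; [apply: whole_ideal | apply: idsuml].
  by move=> f Xf; apply: sub_sat; [apply: whole_ideal | apply: idsumr].
- move=> f m e hf Wf Lf; apply: sat_twoH hf (whole_sat Wf) _ => i.
  apply: (jet_cancel (s := 'X_j ^+ m)); last exact: twoH_jet.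
  by rewrite rmorphXn /= mevalXU expf_neq0.
Qed.
End DoubleInH.
End HoraceSetting.

Section LocalResidual.
Variables (k : closedFieldType) (n : nat).
Local Notation S := {mpoly k[n.+1]}.
Local Notation I := 'I_n.+1.

Lemma distinct_form (p q : I -> k) j : p j != 0 -> q j != 0 -> ~ same_point p q ->
  exists l : S, [/\ l \is 1.-homog, l.@[p] = 0 & l.@[q] != 0].
Proof.
move=> pj qj npq; apply: contrapT => h; apply: npq; exists (p j / q j); split.
  by rewrite mulf_neq0 ?invr_eq0.
move=> a; apply: contrapT => /eqP ne; apply: h.
exists ((p a)%:MP * 'X_j - (p j)%:MP * 'X_a); split.
- by rewrite rpredB // mul_mpolyC dhomogZ // homog_var.
- by rewrite mevalB !mevalM !mevalC !mevalXU mulrC subrr.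
- rewrite mevalB !mevalM !mevalC !mevalXU subr_eq0.
  by apply: contra ne => /eqP E; rewrite mulrAC -E mulfK.
Qed.

Lemma loc_off (J : set S) (p v : I -> k) f : is_ideal setT J -> nonzero p -> nonzero v ->
  ~ same_point p v -> loc (idsum (idmul (point_ideal p) (point_ideal p)) J) v f.
Proof.
move=> hJ [j pj] [a va] npv.
have [l [hl lp lv]] : exists l : S, [/\ l \is 1.-homog, l.@[p] = 0 & l.@[v] != 0].
  have [vj|vj] := eqVneq (v j) 0; last exact: (distinct_form pj vj npv).
  have [pa|pa] := eqVneq (p a) 0.
    by exists 'X_a; rewrite homog_var !mevalXU.
  exact: (distinct_form pa va npv).
exists (l * l), (1 + 1)%N; split.
- exact: dhomogM.
- by rewrite mevalM mulf_neq0.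
- apply: idsuml => //; apply: (idealMl _ (is_ideal_idmul _ (point_ideal_is_ideal p))).
  by apply: idmul_mul; apply: homog_point_ideal hl lp.
Qed.

(** A form of [J] not vanishing at [P i] is multiplied by squares of linear forms through the other
    points, then by a power of ['X_j] to reach degree [e]. *)
Lemma separating_family (J : set S) r (P : 'M[k]_(r, n.+1)) j : homog_ideal J ->
  (forall i, P i j != 0) -> distinct_points P -> disjoint_from J P ->
  exists e0, forall e, (e0 <= e)%N -> exists G : 'I_r -> S, forall i,
    [/\ J (G i), G i \is e.-homog, (G i).@[P i] != 0
      & forall i', i' != i -> idmul (point_ideal (P i')) (point_ideal (P i')) (G i)].
Proof.
move=> hJ Pj dP JP.
have /choice[w /choice[d wP]] : forall i, exists s d,
    [/\ s \is d.-homog, s.@[P i] != 0 & J s].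
  by move=> i; apply: (homog_witness hJ); [exists j | apply: JP].
have /choice[l lP] : forall ii : 'I_r * 'I_r, exists l : S, ii.2 != ii.1 ->
    [/\ l \is 1.-homog, l.@[P ii.2] = 0 & l.@[P ii.1] != 0].
  move=> [i i'] /=; have [->|ne] := eqVneq i' i; first by exists 0.
  by have [l hl] := distinct_form (Pj i') (Pj i) (dP _ _ ne); exists l.
pose g i := w i * \prod_(i' | i' != i) (l (i, i') * l (i, i')).
pose dg i := (d i + \sum_(i' | i' != i) (1 + 1))%N.
have hg i : g i \is (dg i).-homog.
  apply: dhomogM; first by case: (wP i).
  rewrite -!(big_filter (index_enum _)).
  have : all (fun i' => i' != i) [seq i' <- index_enum 'I_r | i' != i] by apply: filter_all.
  elim: [seq _ <- _ | _] => [|i' s IHs] /=; first by rewrite !big_nil dhomog1.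
  by case/andP => ne /IHs hs; rewrite !big_cons; apply: dhomogM => //;
    apply: dhomogM; case: (lP (i, i') ne).
exists (\max_i dg i)%N => e le_e; exists (fun i => 'X_j ^+ (e - dg i) * g i) => i.
have [hw w0 Jw] := wP i; split.
- by apply: (idealM _ hJ.1); apply: (idealMl _ hJ.1).
- have le_d : (dg i <= e)%N by apply: leq_trans le_e; apply: (leq_bigmax i).
  by rewrite -(subnK le_d) addnK; apply: dhomogM => //; apply: homog_varX.
- rewrite !mevalM rmorphXn /= mevalXU mulf_neq0 ?expf_neq0 // mulf_neq0 //.
  rewrite rmorph_prod; apply/prodf_neq0 => i' ne /=.
  by have [_ _ h] := lP (i, i') ne; rewrite mevalM mulf_neq0.
- move=> i' ne; have hQ := is_ideal_idmul (point_ideal (P i')) (point_ideal_is_ideal (P i')).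
  apply: idealM => //; apply: idealM => //; rewrite (bigD1 i') //=.
  apply: (idealMl _ hQ); have [hl l0 _] := lP (i, i') ne.
  by apply: idmul_mul; apply: homog_point_ideal hl l0.
Qed.
End LocalResidual.

Section Residual.
Variables (k : closedFieldType) (n : nat).
Local Notation S := {mpoly k[n.+1]}.
Local Notation I := 'I_n.+1.
Variables IX IH IH' IW : set S.
Hypotheses (hX : homog_ideal IX) (hH : homog_ideal IH) (hH' : homog_ideal IH')
  (hW : homog_ideal IW).
Hypotheses (XH : closed_sub IX IH) (XW : closed_sub IX IW).
Hypothesis cartH' : cartier_divisor IX IH'.
Variable j : I.

Let iX : is_ideal setT IX. Proof. by case: hX. Qed.
Let iH : is_ideal setT IH. Proof. by case: hH. Qed.
Let iH' : is_ideal setT IH'. Proof. by case: hH'. Qed.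
Let iW : is_ideal setT IW. Proof. by case: hW. Qed.
Local Notation IE := (idsum IH IH').
Let hE : homog_ideal IE. Proof. exact: homog_idsum. Qed.
Let iE : is_ideal setT IE. Proof. by case: hE. Qed.
Let XE : IX `<=` saturation IE.
Proof.
move=> f Xf; have : saturation IH f by apply: XH; apply: sub_sat.
by apply: satS; apply: idsuml.
Qed.

Lemma is_ideal_multiples (J : set S) u : is_ideal setT J ->
  is_ideal setT [set u * a | a in J].
Proof.
move=> hJ; apply: is_idealP.
- by exists 0; rewrite ?mulr0 //; apply: ideal0.
- by move=> _ _ [x hx <-] [y hy <-]; exists (x + y); rewrite ?mulrDr //; apply: idealD.
- by move=> a _ [x hx <-]; exists (a * x); [apply: idealM | rewrite mulrCA].
Qed.

Lemma local_division v u du h : local_equation IX IH' v u du -> IH' h ->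
  loc (idsum [set u * a | a in setT] IX) v h.
Proof.
move=> [_ _ div _] Hh.
have iu : is_ideal setT (idsum [set u * a | a in setT] IX).
  by apply: is_ideal_idsum => //; apply: is_ideal_multiples.
rewrite (pihomog_partitionE (mf := mdeg) (leqnn (msize h))).
apply: (ideal_sum _ (loc_ideal v iu)) => d _.
 have [|s [ds [t [dt [hs s0 ht _ Xst]]]]] := div (pihomog mdeg d h) d _ (pihomogP _ _ _).
  by case: hH' => _; apply.
exists s, ds; split=> //; exists (u * t), (s * pihomog mdeg d h - u * t).
by split=> //; rewrite addrC subrK.
Qed.

(** Near [v] the ideal of $H'$ is generated by [u] modulo that of $X$, so the product with [u]
    decides; finitely many generators of [IH'] give a common denominator. *)
Lemma loc_colon v u du g : local_equation IX IH' v u du ->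
  nonzero v -> saturation IW (u * g) -> loc (colon IW IH') v g.
Proof.
move=> eq_u nv Wug.
have lW := loc_ideal v iW.
have XlW : IX `<=` loc IW v.
  by move=> x Xx; apply: loc_of_sat => //; apply: XW; apply: sub_sat.
have gh h : IH' h -> loc IW v (g * h).
  move=> /(local_division eq_u)[s [d [hs s0 [_ [x [[a _ <-] Xx E]]]]]].
  apply: (locM hs s0); rewrite mulrCA E mulrDr; apply: idealD => //.
    have -> : g * (u * a) = a * (u * g) by ring.
    by apply: idealM => //; apply: loc_of_sat.
  by apply: idealM => //; apply: XlW.
have [m [h [Hh hP]]] := hilbert_basis iH'.
have [|s [d [hs s0 sP]]] := loc_common (J := fun _ : 'I_m => IW) (fun _ => iW)
    (f := fun a => g * h a) (v := v).
  by move=> a; apply: gh.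
exists s, d; split=> // f /hP[c ->]; rewrite mulr_sumr; apply: ideal_sum => // a _.
have -> : s * g * (c a * h a) = c a * (s * (g * h a)) by ring.
exact: idealM.
Qed.

Variables (r : nat) (P : 'M[k]_(r, n.+1)).
Hypotheses (PE : points_on IE P) (Pj : forall i, P i j != 0).
Hypothesis dP : distinct_points P.

Let nP i : nonzero (P i). Proof. by exists j. Qed.

Lemma on_divisor i : point_of IX (P i).
Proof.
split; first exact: nP.
by move=> f /XE h; exact: (sat_eval (PE i) h).
Qed.

Lemma resid_ideal : is_ideal setT (resid IX IH IH' IW P).
Proof. by apply: is_ideal_idsum => //; apply: is_ideal_idmul; apply: is_ideal_setI; [apply: is_ideal_colon | apply: double_points_ideal]. Qed.

Lemma loc_resid v u du s ds f g : local_equation IX IH' v u du -> nonzero v ->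
  s \is ds.-homog -> s.@[v] != 0 -> IX (s * f - u * g) -> saturation IW f ->
  (forall i, loc (idsum (idmul (point_ideal (P i)) (point_ideal (P i))) IE) v g) ->
  loc (resid IX IH IH' IW P) v f.
Proof.
move=> eq_u nv hs s0 Xfg Wf gP; have [Hu _ _ _] := eq_u.
have [t [d [ht t0 tC]]] : loc (colon IW IH') v g.
  apply: (loc_colon eq_u) => //.
  have -> : u * g = s * f - (s * f - u * g) by rewrite opprB addrC subrK.
  have sW := sat_ideal iW; apply: idealB => //; first exact: idealM.
  by apply: XW; apply: sub_sat.
have iQ i : is_ideal setT (idsum (idmul (point_ideal (P i)) (point_ideal (P i))) IE).
  by apply: is_ideal_idsum => //; apply/is_ideal_idmul/point_ideal_is_ideal.
have [t' [d' [ht' t0' tD]]] := loc_common iQ gP.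
apply: (locM hs s0); exists (t * t'), (d + d')%N; split; first exact: dhomogM.
  by rewrite mevalM mulf_neq0.
exists (t * t' * g * u), (t * t' * (s * f - u * g)); split; last by ring.
- apply: idmul_mul => //; split.
    by rewrite [t * t']mulrC -mulrA; exact: (idealM _ (@is_ideal_colon _ _ IH' iW) tC).
  move=> i; rewrite -mulrA; exact: (idealM t (iQ i) (tD i)).
- exact: idealM.
Qed.

(** Checked at each closed point: off $X$ the ideal [IX] suffices, on $X$ away from [P] only the
    colon ideal matters, and at [P i] the jet of a quotient of [f] by the local equation decides. *)
Lemma sat_resid f d : f \is d.-homog -> vanishing IX IH' IW f ->
  (forall i, exists u du s ds g dg, [/\ local_equation IX IH' (P i) u du,
     s \is ds.-homog /\ s.@[P i] != 0, g \is dg.-homog, IX (s * f - u * g)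
     & jet_in IE (P i) g]) ->
  saturation (resid IX IH IH' IW P) f.
Proof.
move=> hf [Wf Hf] jP; have iR := resid_ideal.
have sWf : saturation IW f by exact: (whole_sat hX hW XW Wf).
apply: (sat_of_loc iR) => v nv.
have [pX|npX] := pselect (point_of IX v); last first.
  have [s [ds [hs s0 Xs]]] := homog_witness hX nv npX.
  exists s, ds; split=> //; apply: idsumr; last exact: idealMl.
  by apply: is_ideal_idmul; apply: is_ideal_setI; [apply: is_ideal_colon | apply: double_points_ideal].
have [[i sv]|off] := pselect (exists i, same_point (P i) v); last first.
  have [u [du eq_u]] := cartier_local hX hH' cartH' pX.
  have [_ _ div _] := eq_u; have [s [ds [t [dt [hs s0 ht _ Xst]]]]] := div f d Hf hf.
  apply: (loc_resid eq_u nv hs s0 Xst sWf) => i.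
  by apply: loc_off => // sp; apply: off; exists i.
apply: (loc_same_point sv).
have [u [du [s [ds [g [dg [eq_u [hs s0] hg Xfg jg]]]]]]] := jP i.
apply: (loc_resid eq_u (nP i) hs s0 Xfg sWf) => i'.
have [->|ne] := eqVneq i' i; last by apply: loc_off => //; apply: dP.
have [m mP] := jet_double hE (PE i) hg jg.
exists ('X_j ^+ m), m; split; first exact: homog_varX.
  by rewrite rmorphXn /= mevalXU expf_neq0.
exact: mP.
Qed.

(** Since [u] is not a zero divisor on $X$, quotients of [f] by [u] agree locally modulo [IX]; the
    jet of [g] can thus be read from an expression of [f] in the residual ideal. *)
Lemma resid_jet i u du s f g : local_equation IX IH' (P i) u du ->
  s.@[P i] != 0 -> IX (s * f - u * g) -> loc (resid IX IH IH' IW P) (P i) f ->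
  jet_in IE (P i) g.
Proof.
move=> eq_u s0 Xfg [t [d [ht t0 Rtf]]]; have jE := jet_ideal IE (P i).
pose C := idsum [set u * a | a in jet_in IE (P i)] IX.
have iC : is_ideal setT C.
  by apply: is_ideal_idsum => //; apply: is_ideal_multiples.
have lC := loc_ideal (P i) iC.
have [s' [d' [hs' s0' [_ [x [[a ja <-] Xx E]]]]]] : loc C (P i) (t * f).
  suff : resid IX IH IH' IW P `<=` loc C (P i) by apply.
  apply: idsum_sub => //; last first.
    by move=> x Xx; apply: loc_in; apply: idsumr => //; apply: is_ideal_multiples.
  apply: idmul_sub => // a h [_ /(_ i) aD] /(local_division eq_u)[t' [e [ht' t0' [_ [x [[b _ <-] Xx E]]]]]].
  apply: (locM ht' t0'); apply: loc_in; exists (u * (b * a)), (a * x); split.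
  - by exists (b * a) => //; apply: idealM => //; exact: (double_jet (PE i) aD).
  - exact: idealM.
  - by rewrite mulrCA E; ring.
have /(_ (s * a - s' * t * g)) := let: And4 _ _ _ h := eq_u in h.
case.
  apply: loc_in.
  have -> : u * (s * a - s' * t * g) = s' * t * (s * f - u * g) - s * x.
    have -> : s' * t * (s * f - u * g) = s * (s' * (t * f)) - s' * t * u * g by ring.
    by rewrite E; ring.
  by apply: idealB => //; apply: idealM.
move=> z [dz [_ z0 Xz]].
apply: (jet_cancel (s := s' * t)); first by rewrite mevalM mulf_neq0.
have -> : s' * t * g = s * a - (s * a - s' * t * g) by rewrite opprB addrC subrK.
apply: idealB => //; first exact: idealM.
apply: (jet_cancel z0); exact: (jet_sat (PE i) (XE Xz)).
Qed.

End Residual.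

Section ResidualSkyscrapers.
Variables (k : closedFieldType) (n : nat).
Local Notation S := {mpoly k[n.+1]}.
Local Notation I := 'I_n.+1.
Variables IX IH IH' IW : set S.
Hypotheses (hX : homog_ideal IX) (hH : homog_ideal IH) (hH' : homog_ideal IH')
  (hW : homog_ideal IW).
Hypotheses (XH : closed_sub IX IH) (XW : closed_sub IX IW).
Hypothesis cartH' : cartier_divisor IX IH'.
Variable j : I.

Let iX : is_ideal setT IX. Proof. by case: hX. Qed.
Let iH : is_ideal setT IH. Proof. by case: hH. Qed.
Let iH' : is_ideal setT IH'. Proof. by case: hH'. Qed.
Let iW : is_ideal setT IW. Proof. by case: hW. Qed.
Local Notation IE := (idsum IH IH').
Let hE : homog_ideal IE. Proof. exact: homog_idsum. Qed.
Let iE : is_ideal setT IE. Proof. by case: hE. Qed.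

Variables (r : nat) (P : 'M[k]_(r, n.+1)).
Hypotheses (PE : points_on IE P) (Pj : forall i, P i j != 0).
Hypotheses (dP : distinct_points P) (WP : disjoint_from IW P).

Let Xj b i : ('X_j ^+ b : S).@[P i] != 0.
Proof. by rewrite rmorphXn /= mevalXU expf_neq0. Qed.

Lemma trace_simple : trace IH' IW P `<=` simple_points P.
Proof.
apply: idsum_sub => [|f []//|f Hf i]; first exact: simple_points_ideal.
have iP := point_ideal_is_ideal (P i).
rewrite (pihomog_partitionE (mf := mdeg) (leqnn (msize f))); apply: (ideal_sum _ iP) => d _.
apply: (homog_point_ideal (pihomogP _ _ _)); apply: (PE i).2; apply: idsumr => //.
by case: hH' => _; apply.
Qed.

Lemma restricted_simple f : restricted IH' IW f -> simple_points P f -> trace IH' IW P f.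
Proof.
move=> [_ [h [[w [h' [Ww Hh' ->]]] Hh ->]]] fP; apply: idsuml => //; split=> //.
by exists w, (h' + h); rewrite addrA; split=> //; apply: idealD.
Qed.

Lemma restricted_ideal : is_ideal setT (restricted IH' IW).
Proof. by apply: is_ideal_idsum => //; apply: is_ideal_idsum. Qed.

Lemma trace_ideal : is_ideal setT (trace IH' IW P).
Proof.
apply: is_ideal_idsum => //; apply: is_ideal_setI; first exact: is_ideal_idsum.
exact: simple_points_ideal.
Qed.

Lemma trace_restricted : trace IH' IW P `<=` restricted IH' IW.
Proof.
apply: idsum_sub; [exact: restricted_ideal | by move=> f [h _]; apply: idsuml |].
by apply: idsumr; apply: is_ideal_idsum.
Qed.

Lemma homog_simple f d : f \is d.-homog -> (forall i, f.@[P i] = 0) -> simple_points P f.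
Proof. by move=> hf f0 i; apply: homog_point_ideal hf (f0 i). Qed.

(** Separating forms give [r] independent values; the upper bound serves for finiteness. *)
Lemma skyscraper_trace : exists2 dT, (r <= dT)%N &
  skyscraper j (fun ls => sec ls (restricted IH' IW)) (fun ls => sec ls (trace IH' IW P)) dT.
Proof.
have iT := trace_ideal; have iR := restricted_ideal.
have [delta _ qd] : exists2 delta, (delta <= r)%N &
    has_qdim (sec [:: j] (restricted IH' IW)) (sec [:: j] (trace IH' IW P)) delta.
  apply: (qdim_chart_bound j iR iT) => m e a Ra ha.
  exists (fun l => \row_i (a l).@[P i]) => c c0; apply: (sub_sat iT).
  apply: restricted_simple.
    by apply: (ideal_sum _ iR) => l _; apply: (idealM _ iR).
  apply: (homog_simple (homog_sum c ha)) => i.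
  have := congr1 (fun X : 'rV_r => X 0 i) c0; rewrite summxE [RHS]mxE => <-.
  rewrite rmorph_sum; apply: eq_bigr => l _.
  by rewrite rmorphM /= mevalC !mxE.
exists delta; last first.
  apply: (skyscraper_sec iR iT) qd.
    by move=> f /trace_restricted; apply: (sub_sat iR).
  move=> f m d hf Rf Tf; apply: (sub_sat iT); apply: (restricted_simple Rf).
  apply: (homog_simple hf) => i; apply/eqP.
  have := point_ideal_eval (trace_simple Tf i); rewrite mevalM => /eqP.
  by rewrite mulf_eq0 (negPf (Xj m i)).
have [e0 /(_ e0.+1 (leqnSn e0))[G GP]] := separating_family hW Pj dP WP.
apply: (qdim_chart_ge (e := e0) iT (a := G) qd) => [i|i|c b Tc i].
- by have [WG _ _ _] := GP i; apply: idsuml => //; apply: idsuml.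
- by have [] := GP i.
- have [_ _ Gi _] := GP i.
  have := point_ideal_eval (trace_simple Tc i); rewrite mevalM => /eqP.
  rewrite mulf_eq0 (negPf (Xj b i)) rmorph_sum (bigD1 i) //= big1 => [|i' ne].
    by rewrite addr0 mevalM mevalC mulf_eq0 (negPf Gi) orbF => /eqP.
  rewrite mevalM; have [_ _ _ /(_ i)] := GP i'; rewrite eq_sym ne => /(_ isT) h.
  by rewrite (jet_square IE h).1 mulr0.
Qed.

Lemma vanishing_ideal : is_ideal setT (vanishing IX IH' IW).
Proof. by apply: is_ideal_setI => //; apply: whole_ideal. Qed.

Lemma resid_vanishing : resid IX IH IH' IW P `<=` saturation (vanishing IX IH' IW).
Proof.
have iV := vanishing_ideal.
apply: idsum_sub; first exact: sat_ideal.
  apply: idmul_sub; first exact: sat_ideal.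
  move=> a h [aC _] Hh; apply: (sub_sat iV); split; last exact: (idealM _ iH').
  by apply: idsuml => //; apply: aC.
move=> f Xf; have [m hm] : saturation IH' f.
  by case: cartH' => h _; apply: h; apply: sub_sat.
by exists m => i; split => //; apply: idsumr => //; apply: (idealM _ iX).
Qed.

Lemma grad_linear m (A : 'M[k]_(m, n.+1)) l v :
  grad (\sum_a (A l a)%:MP * 'X_a : S) v = row l A.
Proof.
rewrite grad_sum; apply/rowP => b; rewrite summxE !mxE (bigD1 b) //= big1 => [|a ne].
  by rewrite addr0 mul_mpolyC gradZ !mxE mderivXU eqxx meval1 mulr1.
by rewrite mul_mpolyC gradZ !mxE mderivXU eq_sym (negPf ne) meval0 mulr0.
Qed.

(** The lower bound comes from products of three forms: an equation of $H'$ near [P i], a linear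
    form dual to one of [m] tangent vectors of the cone over $E$, and a form of [IW] separating
    [P i] from the other points. After division by the equation their jets are independent. *)
Lemma skyscraper_resid m :
  (forall i, exists K : 'M[k]_(n.+1, m), \rank K = m /\ forall z, tangent IE (P i) (K *m z)) ->
  exists2 dA, (r * m <= dA)%N &
  skyscraper j (fun ls => sec ls (vanishing IX IH' IW))
    (fun ls => sec ls (resid IX IH IH' IW P)) dA.
Proof.
move=> KP; have iV := vanishing_ideal.
have iR := resid_ideal hX hH hH' hW P.
have /choice[u /choice[du uP]] : forall i, exists u du, local_equation IX IH' (P i) u du.
  by move=> i; apply: cartier_local => //; exact: (on_divisor hX hH' XH PE Pj i).
have divide p (a : 'I_p -> S) e i : (forall l, vanishing IX IH' IW (a l)) ->
    (forall l, a l \is e.-homog) -> exists s ds dg (g : 'I_p -> S),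
    [/\ s \is ds.-homog, s.@[P i] != 0, forall l, g l \is dg.-homog
      & forall l, IX (s * a l - u i * g l)].
  by move=> Va ha; apply: (common_local_division iX (uP i)) ha => l; case: (Va l).
(* Recording the full jet of each quotient gives a coarse bound, enough for finiteness. *)
have [delta _ qd] : exists2 delta, (delta <= r * (1 + n.+1))%N &
    has_qdim (sec [:: j] (vanishing IX IH' IW)) (sec [:: j] (resid IX IH IH' IW P)) delta.
  apply: (qdim_chart_bound j iV iR) => p e a Va ha.
  have /choice[s /choice[ds /choice[dg /choice[g gP]]]] := fun i => divide p a e.+1 i Va ha.
  pose val i l : 'rV[k]_(1 + n.+1) := row_mx (g i l).@[P i]%:M (grad (g i l) (P i)).
  exists (fun l => mxvec (\matrix_i val i l)) => c c0.
  apply: (sat_resid hX hH hH' hW XW cartH' PE Pj dP (homog_sum c ha)).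
    by apply: (ideal_sum _ iV) => l _; apply: (idealM _ iV).
  move=> i; have [hs s0 hg Xg] := gP i.
  exists (u i), (du i), (s i), (ds i), (\sum_l (c l)%:MP * g i l), (dg i); split=> //.
  - exact: homog_sum.
  - rewrite !mulr_sumr -sumrB; apply: (ideal_sum _ iX) => l _.
    have -> : s i * ((c l)%:MP * a l) - u i * ((c l)%:MP * g i l)
       = (c l)%:MP * (s i * a l - u i * g i l) by ring.
    exact: (idealM _ iX).
  - have E : \sum_l c l *: val i l = 0.
      have := congr1 (fun X : 'rV_(r * (1 + n.+1)) => row i (vec_mx X)) c0.
      rewrite !linear_sum !linear0 => E0; rewrite -[RHS]E0; apply: eq_bigr => l _.
      by rewrite !linearZ /= mxvecK rowK.
    have [E1 E2] : \sum_l c l * (g i l).@[P i] = 0 /\ \sum_l c l *: grad (g i l) (P i) = 0.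
      split.
        have := congr1 (fun X : 'rV_(1 + n.+1) => lsubmx X 0 0) E.
        rewrite linear_sum linear0 summxE [RHS]mxE => E0; rewrite -[RHS]E0.
        apply: eq_bigr => l _.
        by rewrite linearZ /= row_mxKl [RHS]mxE mxE eqxx mulr1n.
      have := congr1 (@rsubmx k 1 1 n.+1) E; rewrite linear_sum linear0 => E0.
      by rewrite -[RHS]E0; apply: eq_bigr => l _; rewrite linearZ /= row_mxKr.
    split.
      rewrite rmorph_sum -[RHS]E1; apply: eq_bigr => l _.
      by rewrite rmorphM /= mevalC.
    move=> w _; rewrite grad_sum (_ : \sum_l _ = 0) ?mul0mx //.
    by rewrite -[RHS]E2; apply: eq_bigr => l _; rewrite mul_mpolyC gradZ.
exists delta; last first.
  apply: (skyscraper_sec iV iR resid_vanishing _ qd) => f b d hf Vf Rf.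
  apply: (sat_resid hX hH hH' hW XW cartH' PE Pj dP hf Vf) => i.
  have [s [ds [dg [g [hs s0 hg Xg]]]]] := divide 1%N (fun=> f) d i (fun=> Vf) (fun=> hf).
  exists (u i), (du i), s, ds, (g 0), dg; split=> //.
  apply: (resid_jet (IW := IW) hX hH' XH PE (uP i) s0 (Xg 0)).
  by exists ('X_j ^+ b), b; split; [apply: homog_varX | apply: Xj |].
have [K {}KP] := choice KP.
pose D := (\max_i du i)%N.
(* The equations of $H'$ at the various points are brought to the same degree. *)
pose U i := 'X_j ^+ (D - du i) * u i.
have hU i : U i \is D.-homog.
  have le_d : (du i <= D)%N by apply: (leq_bigmax i).
  rewrite -[X in X.-homog](subnK le_d); apply: dhomogM; first exact: homog_varX.
  by have [] := uP i.
have HU i : IH' (U i) by apply: (idealM _ iH'); have [] := uP i.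
have [e0 /(_ e0.+1 (leqnSn e0))[G GP]] := separating_family hW Pj dP WP.
pose A i : 'M[k]_(m, n.+1) := pinvmx (K i).
have AK i : A i *m K i = 1%:M.
  apply: mulVpmx; rewrite /row_full; by case: (KP i) => ->.
pose lin i l : S := \sum_a (A i l a)%:MP * 'X_a.
pose a (il : 'I_r * 'I_m) := U il.1 * (lin il.1 il.2 * G il.1).
have Va il : vanishing IX IH' IW (a il).
  split; last by rewrite /a mulrC; apply: (idealM _ iH').
  apply: idsuml => //; rewrite /a mulrA; apply: (idealM _ iW).
  by have [] := GP il.1.
have ha il : a il \is (D + (1 + e0)).+1.-homog.
  have -> : ((D + (1 + e0)).+1 = D + (1 + e0.+1))%N by lia.
  apply: dhomogM => //; apply: dhomogM; last by have [] := GP il.1.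
  by apply: homog_sum => b; apply: homog_var.
have -> : (r * m = #|{: 'I_r * 'I_m}|)%N by rewrite card_prod !card_ord.
apply: (qdim_chart_ge iR (a := fun l => a (enum_val l)) qd) => // c b Rc l0.
pose c' il := c (enum_rank il).
have E : \sum_l (c l)%:MP * a (enum_val l) = \sum_i \sum_l (c' (i, l))%:MP * a (i, l).
  rewrite pair_bigA /= (eq_bigr (fun l => (c' (enum_val l))%:MP * a (enum_val l))); last first.
    by move=> l _; rewrite /c' enum_valK.
  rewrite -(big_enum_val (fun il => (c' il)%:MP * a il)) /=.
  by apply: eq_big => [[x y]|[x y] _].
suff c0 i l : c' (i, l) = 0.
  by rewrite -[l0]enum_valK; case: (enum_val l0) => i l; apply: c0.
have [s [ds [dg [g [hs s0 hg Xg]]]]] : exists s ds dg (g : 'I_r -> S),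
    [/\ s \is ds.-homog, s.@[P i] != 0, forall i', g i' \is dg.-homog
      & forall i', IX (s * U i' - u i * g i')].
  exact: (common_local_division iX (uP i)).
(* [U i] is [u i] times a form not vanishing at [P i], so neither does its quotient by [u i]. *)
have gi : (g i).@[P i] != 0.
  have [_ _ _ nz] := uP i.
  have [t [dt [_ t0 Xt]]] : loc IX (P i) (s * 'X_j ^+ (D - du i) - g i).
    apply: nz; apply: loc_in; rewrite mulrBr.
    have -> : u i * (s * 'X_j ^+ (D - du i)) = s * U i by rewrite /U; ring.
    exact: Xg.
  have := (on_divisor hX hH' XH PE Pj i).2 _ Xt.
  rewrite mevalM mevalB mevalM => /eqP; rewrite mulf_eq0 (negPf t0) subr_eq0 => /eqP <-.
  by rewrite mulf_neq0.
pose f := 'X_j ^+ b * \sum_l (c l)%:MP * a (enum_val l).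
pose h := 'X_j ^+ b * \sum_i' \sum_l (c' (i', l))%:MP * (g i' * (lin i' l * G i')).
have Xfh : IX (s * f - u i * h).
  have -> : s * f - u i * h = 'X_j ^+ b * \sum_i' \sum_l (c' (i', l))%:MP *
      ((lin i' l * G i') * (s * U i' - u i * g i')).
    rewrite /f /h E [s * _]mulrCA [u i * _]mulrCA -mulrBr; congr (_ * _).
    rewrite !mulr_sumr -sumrB; apply: eq_bigr => i' _; rewrite !mulr_sumr -sumrB; apply: eq_bigr => l' _.
    by rewrite /a /=; ring.
  apply: (idealM _ iX); apply: (ideal_sum _ iX) => i' _; apply: (ideal_sum _ iX) => l' _.
  by do 2 apply: (idealM _ iX).
have jh := resid_jet hX hH' XH PE (uP i) s0 Xfh (loc_in _ Rc).
have {}jh := jet_cancel (Xj b i) jh.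
have jE := jet_ideal IE (P i).
(* At [P i] the terms of the other points have zero jet, and the factor [g i * G i] is a unit. *)
have jl : jet_in IE (P i) (\sum_l (c' (i, l))%:MP * lin i l).
  apply: (jet_cancel (s := g i * G i)).
    by rewrite mevalM mulf_neq0 //; have [] := GP i.
  move: jh; rewrite (bigD1 i) //=; set rest := \sum_(i' | i' != i) _ => jh.
  have jr : jet_in IE (P i) rest.
    apply: (ideal_sum _ jE) => i' ne; apply: (ideal_sum _ jE) => l' _.
    do 3 apply: (idealM _ jE); apply: jet_square; have [_ _ _] := GP i'.
    by apply; rewrite eq_sym.
  have := idealB jE jh jr; rewrite addrK mulr_sumr.
  by congr (jet_in _ _ _); apply: eq_bigr => l' _; ring.
have cK : (\row_l c' (i, l)) *m A i *m K i = 0.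
  apply/trmx_inj; apply/eqP; rewrite trmx0; apply/eqP.
  apply/matrixP => x y; rewrite ord1 [RHS]mxE mxE.
  have := jl.2 _ ((KP i).2 (delta_mx x (0 : 'I_1))).
  rewrite mulmxA (_ : grad _ _ = (\row_l c' (i, l)) *m A i); last first.
    rewrite grad_sum mulmx_sum_row; apply: eq_bigr => l' _.
    by rewrite mul_mpolyC gradZ grad_linear mxE.
  by rewrite -colE => /matrixP /(_ 0 0); rewrite !mxE.
move: cK; rewrite -mulmxA AK mulmx1 => /rowP /(_ l).
by rewrite !mxE.
Qed.
End ResidualSkyscrapers.

(** * Generic rank along a product of cones *)

Section Minors.
Variables (k : fieldType) (N r : nat).
Local Notation S := {mpoly k[N]}.
Local Notation SS := {mpoly k[r * N]}.

Definition factor (i : 'I_r) : S -> SS := mmap (@mpolyC (r * N) k) (fun a => 'X_(mxvec_index i a)).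

Lemma mmap_factor (T : comNzRingType) (f : {rmorphism k -> T}) (Y : 'M[T]_(r, N)) i F :
  mmap f (mxvec Y 0) (factor i F) = mmap f (Y i) F.
Proof.
rewrite /factor; move: F; apply: mpoly_ring_ind => [c|a|F G hF hG|F G hF hG].
- by rewrite !mmapC.
- by rewrite !mmapX !mmap1U mmapX mmap1U mxvecE.
- by rewrite !raddfD /= hF hG.
- by rewrite !rmorphM /= hF hG.
Qed.

Variables (B c : nat) (rho : 'I_r -> 'I_c -> 'rV[S]_B).

Definition at_rows (T : comNzRingType) (f : {rmorphism k -> T}) (Y : 'M[T]_(r, N)) :
    'M[T]_(c, r * B) :=
  \matrix_l mxvec (\matrix_i map_mx (mmap f (Y i)) (rho i l)).

(** The jets of [c] sections at [r] points form a matrix with [c] rows. Compressing its columns by a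
    constant matrix [C] replaces the selection of a maximal minor. *)
Definition minor (C : 'M[k]_(r * B, c)) : SS :=
  \det ((\matrix_l mxvec (\matrix_i map_mx (factor i) (rho i l)))
        *m map_mx (@mpolyC (r * N) k) C).

Lemma minor_eval (T : comNzRingType) (f : {rmorphism k -> T}) (Y : 'M[T]_(r, N)) C :
  mmap f (mxvec Y 0) (minor C) = \det (at_rows f Y *m map_mx f C).
Proof.
rewrite /minor -det_map_mx map_mxM; congr (\det (_ *m _)); last first.
  by apply/matrixP => x y; rewrite !mxE /= mmapC.
apply/row_matrixP => l; rewrite -map_row !rowK map_mxvec; congr mxvec.
apply/row_matrixP => i; rewrite -map_row !rowK; apply/rowP => b.
by rewrite !mxE /= mmap_factor.
Qed.

Lemma meval_minor (p : 'M[k]_(r, N)) C :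
  (minor C).@[mxvec p 0] = \det (at_rows idfun p *m C).
Proof.
by have := minor_eval idfun p C; rewrite [map_mx _ C]map_mx_id // => <-.
Qed.

Lemma meval_rows (p : 'M[k]_(r, N)) l i b : vec_mx (row l (at_rows idfun p)) i b = (rho i l 0 b).@[p i].
Proof. by rewrite rowK mxvecK !mxE. Qed.

Lemma exists_minor (p : 'M[k]_(r, N)) :
  (forall g : 'I_c -> k, (forall i b, \sum_l g l * (rho i l 0 b).@[p i] = 0) ->
     forall l, g l = 0) ->
  exists C, (minor C).@[mxvec p 0] != 0.
Proof.
move=> h; have rf : row_free (at_rows idfun p).
  rewrite -kermx_eq0; apply/rowV0P => v /sub_kermxP v0; apply/rowP => l; rewrite mxE.
  apply: (h (fun l => v 0 l)) => i b.
  have := congr1 (fun X : 'rV_(r * B) => vec_mx X i b) v0.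
  rewrite mulmx_sum_row linear_sum linear0 summxE [RHS]mxE => E0; rewrite -[RHS]E0.
  apply: eq_bigr => l' _; rewrite linearZ /= [RHS]mxE; congr (_ * _).
  by rewrite meval_rows.
exists (pinvmx (at_rows idfun p)); rewrite meval_minor.
by rewrite mulmxVp // det1 oner_eq0.
Qed.

Lemma minor_indep (p : 'M[k]_(r, N)) C : (minor C).@[mxvec p 0] != 0 ->
  forall g : 'I_c -> k, (forall i b, \sum_l g l * (rho i l 0 b).@[p i] = 0) ->
  forall l, g l = 0.
Proof.
rewrite meval_minor => d0 g h l.
have U : at_rows idfun p *m C \in unitmx by rewrite unitmxE unitfE.
have : \row_l g l *m (at_rows idfun p *m C) = 0.
  rewrite mulmxA (_ : _ *m at_rows _ _ = 0) ?mul0mx //.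
  apply: (can_inj vec_mxK); rewrite linear0; apply/matrixP => i b; rewrite [RHS]mxE.
  rewrite mulmx_sum_row linear_sum summxE -[RHS](h i b); apply: eq_bigr => l' _.
  by rewrite linearZ /= [LHS]mxE meval_rows mxE.
move/(congr1 (mulmxr (invmx (at_rows idfun p *m C)))) => /=.
rewrite mulmxK // mul0mx => /rowP /(_ l).
by rewrite !mxE.
Qed.
End Minors.

Section ArcsToPoints.
Variables (k : closedFieldType) (N r : nat).
Local Notation S := {mpoly k[N]}.
Local Notation SS := {mpoly k[r * N]}.

(** Divisibility by $t^M$. *)
Definition low_zero (M : nat) (f : {poly k}) : Prop := forall n, (n < M)%N -> f`_n = 0.

Lemma low_zero_ideal M : is_ideal setT (low_zero M).
Proof.
apply: is_idealP => [n _|f g hf hg n lt_n|a f hf n lt_n]; first by rewrite coef0.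
  by rewrite coefD hf ?hg ?addr0.
rewrite coefM big1 // => i _; rewrite hf ?mulr0 //.
by apply: leq_ltn_trans lt_n; apply: leq_subr.
Qed.

Definition at_poly (y : 'M[{poly k}]_(r, N)) : SS -> {poly k} := mmap (@polyC k) (mxvec y 0).

Definition set_row (T : Type) (y : 'M[T]_(r, N)) i (z : 'I_N -> T) : 'M[T]_(r, N) :=
  \matrix_(i', a) if i' == i then z a else y i' a.

(* Reading Phi as a polynomial in t with coefficients in the i-th factor. *)
Lemma at_poly_row (Phi : SS) (y : 'M[{poly k}]_(r, N)) i :
  exists D : {poly S}, forall z : 'I_N -> {poly k},
    at_poly (set_row y i z) Phi = \sum_(n < size D) mmap (@polyC k) z D`_n * 'X^n.
Proof.
pose Y : 'M[{poly S}]_(r, N) :=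
  set_row (map_mx (map_poly (@mpolyC N k)) y) i (fun a => ('X_a)%:P).
exists (mmap (@polyC S \o @mpolyC N k) (mxvec Y 0) Phi) => z.
have [f fE] : exists f : {rmorphism S -> {poly k}}, forall F, f F = mmap (@polyC k) z F.
  by exists (mmap (@polyC k) z).
pose psi : {rmorphism {poly S} -> {poly k}} := horner_morph (fun F => mulrC 'X (f F)).
have psiE D : psi D = \sum_(n < size D) mmap (@polyC k) z D`_n * 'X^n.
  rewrite /psi /= /horner_morph horner_coef.
  rewrite (big_ord_widen (size D) (fun n => (map_poly f D)`_n * 'X^n)) ?size_poly //.
  rewrite big_mkcond; apply: eq_bigr => n _; rewrite coef_map /= fE; case: ltnP => // le_n.
  by rewrite -fE -coef_map nth_default // mul0r.
rewrite -psiE /at_poly; move: Phi; apply: mpoly_ring_ind => [c|x|F G hF hG|F G hF hG].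
- by rewrite !mmapC /= /psi /= /horner_morph map_polyC hornerC /= fE mmapC.
- rewrite !mmapX !mmap1U; case/mxvec_indexP: x => i' a; rewrite !mxvecE !mxE.
  case: eqP => _.
    by rewrite /psi /= /horner_morph map_polyC hornerC /= fE mmapX mmap1U.
  rewrite /psi /= /horner_morph -map_poly_comp.
  rewrite (eq_map_poly (g := @polyC k)); last by move=> c; rewrite /= fE mmapC.
  elim/poly_ind: (y i' a) => [|p c {1}->]; first by rewrite rmorph0 horner0.
  by rewrite rmorphD rmorphM /= map_polyX map_polyC /= hornerMXaddC.
- by rewrite !raddfD /= hF hG.
- by rewrite !rmorphM /= hF hG.
Qed.

Variables (P : set S) (h : S).
Hypotheses (pP : is_prime setT P) (Ph : ~ P h).

(** The arcs are replaced one at a time by constants. With the others fixed, [Phi] is $\sum_n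
    D_nt^n$; were all $D_n$ with $n<M$ in [P], it would vanish modulo $t^M$ on the given arc. For
    some such $D_n$, a zero of [P] outside $hD_n=0$ is the new constant. *)
Lemma arcs_to_points M (Phi : SS) (y : 'M[{poly k}]_(r, N)) :
  (forall i F, P F -> low_zero M (mmap (@polyC k) (y i) F)) ->
  ~ low_zero M (at_poly y Phi) ->
  exists p : 'M[k]_(r, N),
    [/\ forall i F, P F -> F.@[p i] = 0, forall i, h.@[p i] != 0
      & Phi.@[mxvec p 0] != 0].
Proof.
move=> yP nlow.
have {nlow} [y' [_ nlow all_const]] : exists y' : 'M[{poly k}]_(r, N),
  [/\ forall i F, P F -> low_zero M (mmap (@polyC k) (y' i) F),
      ~ low_zero M (at_poly y' Phi)
    & forall i, i \in enum 'I_r -> exists p : 'I_N -> k,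
      [/\ forall F, P F -> F.@[p] = 0, h.@[p] != 0 & forall a, y' i a = (p a)%:P]].
  elim: (enum 'I_r) => [|i s [y1 [y1P nlow1 y1s]]]; first by exists y.
  have [D DE] := at_poly_row Phi y1 i.
  have [n lt_n Dn] : exists2 n, (n < M)%N & ~ P D`_n.
    apply: contrapT => hn; apply: nlow1.
    have -> : y1 = set_row y1 i (y1 i).
      by apply/matrixP => i' a; rewrite mxE; case: eqP => [->|].
    rewrite DE; apply: (ideal_sum _ (low_zero_ideal M)) => n _.
    have [lt_n|le_n] := ltnP n M.
      apply: (idealMl _ (low_zero_ideal M)); apply: y1P; apply: contrapT => nD.
      by apply: hn; exists n.
    move=> e lt_e; rewrite coefMXn ifT //; exact: leq_trans lt_e le_n.
  have [p pP0] : exists2 p : 'I_N -> k, forall g, P g -> g.@[p] = 0 & (h * D`_n).@[p] != 0.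
    by apply: prime_zero => // /(primeM pP)[].
  rewrite mevalM mulf_eq0 negb_or => /andP[hp Dp].
  have constE F : mmap (@polyC k) (fun a => (p a)%:P) F = (F.@[p])%:P.
    move: F; apply: mpoly_ring_ind => [c|a|F G hF hG|F G hF hG].
    - by rewrite mmapC mevalC.
    - by rewrite mmapX mmap1U mevalXU.
    - by rewrite raddfD /= hF hG mevalD polyCD.
    - by rewrite rmorphM /= hF hG mevalM polyCM.
  have rowE i' F : mmap (@polyC k) (set_row y1 i (fun a => (p a)%:P) i') F
      = if i' == i then (F.@[p])%:P else mmap (@polyC k) (y1 i') F.
    by rewrite -constE /mmap; case: (eqVneq i' i) => ne; apply: eq_bigr => m _; congr (_ * _);
      apply: eq_bigr => a _; rewrite mxE ?ne ?eqxx // (negPf ne).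
  exists (set_row y1 i (fun a => (p a)%:P)); split=> [i' F PF|low|i'].
  - rewrite rowE; case: eqP => _; last exact: y1P.
    by rewrite pP0 // => e _; rewrite coef0.
  - case/eqP: Dp; have := low n lt_n; rewrite DE.
    under eq_bigr do rewrite constE.
    rewrite coef_sum; have [lt_D|le_D] := ltnP n (size D); last first.
      by move=> _; rewrite nth_default ?meval0.
    rewrite (bigD1 (Ordinal lt_D)) //= coefCM coefXn eqxx mulr1 big1 ?addr0 // => e ne.
    by rewrite coefCM coefXn eq_sym (_ : (_ == n) = false) ?mulr0 //; apply/negbTE.
  - rewrite inE; case: (eqVneq i' i) => [-> _|ne /= /y1s[p' [h1 h2 h3]]].
      by exists p; split=> // a; rewrite mxE eqxx.
    by exists p'; split=> // a; rewrite mxE (negPf ne).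
have /choice[p pP'] : forall i, exists p : 'I_N -> k,
      [/\ forall F, P F -> F.@[p] = 0, h.@[p] != 0 & forall a, y' i a = (p a)%:P].
  by move=> i; have := all_const i; rewrite mem_enum; apply.
have mE i F : F.@[(\matrix_(i, a) p i a) i] = F.@[p i].
  by apply: meval_eq => a; rewrite mxE.
exists (\matrix_(i, a) p i a); split=> [i F PF|i|].
- by rewrite mE; have [h0 _ _] := pP' i; apply: h0.
- by rewrite mE; have [] := pP' i.
- apply: contra_notN nlow => /eqP Phi0; rewrite /at_poly.
  suff -> : mmap (@polyC k) (mxvec y' 0) Phi = (Phi.@[mxvec (\matrix_(i, a) p i a) 0])%:P.
    by rewrite Phi0 => n _; rewrite coef0.
  clear Phi0; move: Phi; apply: mpoly_ring_ind => [c|x|F G hF hG|F G hF hG].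
  + by rewrite mmapC mevalC.
  + rewrite mmapX mmap1U mevalXU; case/mxvec_indexP: x => i a; rewrite !mxvecE mxE.
    by have [_ _ ->] := pP' i.
  + by rewrite raddfD /= hF hG mevalD polyCD.
  + by rewrite rmorphM /= hF hG mevalM polyCM.
Qed.
End ArcsToPoints.

(** * Formal arcs along a derivation *)

Section Derivations.
Variables (k : fieldType) (N : nat).
Local Notation S := {mpoly k[N]}.
Implicit Types (F G : S) (th : 'I_N -> S).

Definition der th F : S := \sum_i F^`M(i) * th i.

Lemma derD th F G : der th (F + G) = der th F + der th G.
Proof. by rewrite /der -big_split; apply: eq_bigr => i _; rewrite mderivD mulrDl. Qed.

Lemma derC th c : der th c%:MP = 0.
Proof. by rewrite /der big1 // => i _; rewrite mderivC mul0r. Qed.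

Lemma derM th F G : der th (F * G) = der th F * G + F * der th G.
Proof.
rewrite /der mulr_suml mulr_sumr -big_split; apply: eq_bigr => i _.
by rewrite mderivM /=; ring.
Qed.

Lemma derZ th c F : der th (c%:MP * F) = c%:MP * der th F.
Proof. by rewrite derM derC mul0r add0r. Qed.

Lemma der0 th : der th 0 = 0. Proof. by rewrite -mpolyC0 derC. Qed.

Lemma der_sum th m (F : 'I_m -> S) : der th (\sum_l F l) = \sum_l der th (F l).
Proof. by apply: (big_morph (der th) (derD th) (der0 th)). Qed.

Lemma der_eval th F (p : 'I_N -> k) :
  (der th F).@[p] = (grad F p *m \col_i (th i).@[p]) 0 0.
Proof.
by rewrite rmorph_sum mxE; apply: eq_bigr => i _; rewrite rmorphM /= !mxE.
Qed.
End Derivations.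

Section Arcs.
Variables (k : closedFieldType) (N : nat).
Hypothesis char0 : forall n, n.+1%:R != 0 :> k.
Local Notation S := {mpoly k[N]}.
Variables (th : 'I_N -> S) (q : 'I_N -> k).
Implicit Types F G : S.

(** The coefficient of $t^n$ in $\exp(t\theta)F$ at [q]. *)
Definition taylor_coef n F : k := (iter n (der th) F).@[q] / n`!%:R.

Lemma taylor_coefS n F : n.+1%:R * taylor_coef n.+1 F = taylor_coef n (der th F).
Proof.
rewrite /taylor_coef iterSr factS natrM invfM mulrCA; congr (_ * _).
by rewrite mulrA mulfV ?mul1r.
Qed.

Lemma taylor_coefD n F G : taylor_coef n (F + G) = taylor_coef n F + taylor_coef n G.
Proof.
rewrite /taylor_coef -mulrDl -mevalD; congr (_.@[_] / _).
by elim: n => //= n ->; rewrite derD.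
Qed.

Lemma taylor_coefC n c : taylor_coef n c%:MP = if n is 0 then c else 0.
Proof.
case: n => [|n]; first by rewrite /taylor_coef /= mevalC divr1.
rewrite /taylor_coef iterSr derC (_ : iter n _ 0 = 0) ?meval0 ?mul0r //.
by elim: n => //= n ->; rewrite der0.
Qed.

(** The map $\exp(t\theta)$ is multiplicative; hence evaluating [F] at the truncated series of the
    coordinates gives the series of [F] below degree [M]. *)
Lemma taylor_coefM n F G :
  taylor_coef n (F * G) = \sum_(i < n.+1) taylor_coef i F * taylor_coef (n - i) G.
Proof.
elim: n F G => [|n IH] F G.
  by rewrite big_ord1 /taylor_coef /= !divr1 mevalM.
apply: (mulfI (char0 n)); rewrite taylor_coefS derM taylor_coefD !IH mulr_sumr.
rewrite [RHS](eq_bigr (fun i : 'I_n.+2 =>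
    (i%:R * taylor_coef i F) * taylor_coef (n.+1 - i) G
    + taylor_coef i F * ((n.+1 - i)%:R * taylor_coef (n.+1 - i) G))); last first.
  move=> i _; have -> : n.+1%:R = i%:R + (n.+1 - i)%:R :> k.
    by rewrite -natrD subnKC // leq_ord.
  by rewrite mulrDl; congr (_ + _); [rewrite mulrA | rewrite mulrCA].
rewrite big_split /=; congr (_ + _).
  rewrite [RHS]big_ord_recl mulr0n !mul0r add0r; apply: eq_bigr => i _.
  by rewrite -taylor_coefS subSS.
rewrite [RHS]big_ord_recr /= subnn mulr0n mul0r mulr0 addr0; apply: eq_bigr => i _.
by rewrite -taylor_coefS -subSn // -ltnS.
Qed.

Variable M : nat.
Hypothesis M_gt0 : (0 < M)%N.

Definition arc (a : 'I_N) : {poly k} := \poly_(n < M) taylor_coef n 'X_a.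

Lemma arc_eval F n : (n < M)%N -> (mmap (@polyC k) arc F)`_n = taylor_coef n F.
Proof.
move: F n; apply: mpoly_ring_ind => [c|a|F G hF hG|F G hF hG] n lt_n.
- by rewrite mmapC coefC taylor_coefC; case: n lt_n.
- by rewrite mmapX mmap1U coef_poly lt_n.
- by rewrite raddfD coefD hF // hG // taylor_coefD.
- rewrite rmorphM coefM taylor_coefM; apply: eq_bigr => i _.
  by rewrite hF ?hG // (leq_ltn_trans _ lt_n) ?leq_subr // -ltnS.
Qed.

Lemma arc0 F : (mmap (@polyC k) arc F)`_0 = F.@[q].
Proof. by rewrite arc_eval // /taylor_coef divr1. Qed.

Lemma arc_in (P : set S) F : (forall G, P G -> P (der th G)) ->
  (forall G, P G -> G.@[q] = 0) -> P F -> low_zero M (mmap (@polyC k) arc F).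
Proof.
move=> dP qP PF n lt_n; rewrite arc_eval // /taylor_coef qP ?mul0r //.
by elim: (n) => //= n' IH; apply: dP.
Qed.
End Arcs.

(** * Jets at general points of the divisor *)

Lemma det_congr (R : comNzRingType) (J : set R) m (A B : 'M[R]_m) : is_ideal setT J ->
  (forall i l, J (A i l - B i l)) -> J (\det A - \det B).
Proof.
move=> hJ h; apply: (big_ind2 (fun x y => J (x - y))) => [|x y x' y' Jx Jy|s _].
- by rewrite subrr; apply: ideal0.
- by rewrite opprD addrACA; apply: idealD.
- rewrite -mulrBr; apply: (idealM _ hJ).
  apply: (big_ind2 (fun x y => J (x - y))) => [|x y x' y' Jx Jy|i _] //.
    by rewrite subrr; apply: ideal0.
  have -> : x * x' - y * y' = (x - y) * x' + y * (x' - y') by ring.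
  by apply: (idealD hJ); [apply: idealMl | apply: idealM].
Qed.

Section GeneralPoints.
Variables (k : closedFieldType) (n : nat).
Hypothesis char0 : forall n, n.+1%:R != 0 :> k.
Local Notation N := n.+1.
Local Notation S := {mpoly k[N]}.
Variables (P : set S) (Delta h : S) (R : 'M[S]_N).
Hypotheses (pP : is_prime setT P) (Ph : ~ P h).
Hypothesis derR : forall F c, P F -> P (der (fun i => R i c) F).
Hypothesis RE : forall p w, tangent P p w ->
  forall i, \sum_c (R i c).@[p] * w c 0 = Delta.@[p] * w i 0.

Let iP := prime_is_ideal pP.

(** The constant vector [w] turned by [R] into a vector field tangent to [P]; at a point where [w]
    is tangent, its value is [Delta] times [w]. *)
Definition field_along (w : 'cV[k]_N) i : S := \sum_c (w c 0)%:MP * R i c.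

Lemma der_field_along w F :
  der (field_along w) F = \sum_c (w c 0)%:MP * der (fun i => R i c) F.
Proof.
rewrite /der; under [RHS]eq_bigr do rewrite mulr_sumr.
rewrite exchange_big; apply: eq_bigr => i _ /=.
by rewrite mulr_sumr; apply: eq_bigr => c _; rewrite mulrCA.
Qed.

Lemma der_field_along_in w F : P F -> P (der (field_along w) F).
Proof.
move=> PF; rewrite der_field_along; apply: (ideal_sum _ iP) => c _.
by apply: (idealM _ iP); apply: derR.
Qed.

Lemma der_along_eval p w F : tangent P p w ->
  (der (field_along w) F).@[p] = Delta.@[p] * (grad F p *m w) 0 0.
Proof.
move=> tw; rewrite rmorph_sum mxE mulr_sumr; apply: eq_bigr => i _.
rewrite rmorphM /= mulrCA mxE; congr (_ * _); rewrite -(RE tw) rmorph_sum.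
by apply: eq_bigr => c _; rewrite rmorphM /= mevalC mulrC.
Qed.

Lemma jet_der p c F : (forall G, P G -> G.@[p] = 0) -> jet_in P p F ->
  (der (fun i => R i c) F).@[p] = 0.
Proof.
move=> pP0 [_ jF]; rewrite der_eval jF ?mxE // => G PG.
by apply/matrixP => x y; rewrite !ord1 -der_eval [RHS]mxE; apply: pP0; apply: derR.
Qed.

Section Rows.
Variables (s u : S) (w : 'cV[k]_N).
Local Notation th := (field_along w).
Local Notation om := (der th u).
Local Notation dR c := (der (fun i => R i c)).

(* om * R_c - (R_c u) * th is tangent to H and kills u, so that the rows of
   F = u G / s are divisible by u; the quotient is divided_row G. *)
Definition jet_row (F : S) : 'rV[S]_(1 + (1 + N)) :=
  row_mx (s * F)%:M (row_mx (u * der th (s * F))%:M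
    (\row_c (om * dR c (s * F) - dR c u * der th (s * F)))).

Definition divided_row (G : S) : 'rV[S]_(1 + (1 + N)) :=
  row_mx G%:M (row_mx (om * G + u * der th G)%:M
    (\row_c (om * dR c G - dR c u * der th G))).

Lemma jet_row_lin m (c : 'I_m -> k) (F : 'I_m -> S) b :
  jet_row (\sum_l (c l)%:MP * F l) 0 b = \sum_l (c l)%:MP * jet_row (F l) 0 b.
Proof.
have E th' : der th' (s * \sum_l (c l)%:MP * F l) = \sum_l (c l)%:MP * der th' (s * F l).
  rewrite mulr_sumr der_sum; apply: eq_bigr => l _.
  by rewrite mulrCA derZ.
rewrite /jet_row !E mxE; under [RHS]eq_bigr do rewrite mxE.
case: splitP => x _.
  rewrite ord1 mxE eqxx mulr1n mulr_sumr; apply: eq_bigr => l _.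
  by rewrite mxE eqxx mulr1n mulrCA.
rewrite mxE; under [RHS]eq_bigr do rewrite mxE.
case: splitP => y _.
  rewrite ord1 mxE eqxx mulr1n mulr_sumr; apply: eq_bigr => l _.
  by rewrite mxE eqxx mulr1n mulrCA.
rewrite mxE E !mulr_sumr -sumrB; apply: eq_bigr => l _.
by rewrite mxE; ring.
Qed.

Lemma divided_row_lin m (c : 'I_m -> k) (F : 'I_m -> S) b :
  divided_row (\sum_l (c l)%:MP * F l) 0 b = \sum_l (c l)%:MP * divided_row (F l) 0 b.
Proof.
have E th' : der th' (\sum_l (c l)%:MP * F l) = \sum_l (c l)%:MP * der th' (F l).
  by rewrite der_sum; apply: eq_bigr => l _; rewrite derZ.
rewrite /divided_row !E mxE; under [RHS]eq_bigr do rewrite mxE.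
case: splitP => x _.
  rewrite ord1 mxE eqxx mulr1n; apply: eq_bigr => l _.
  by rewrite mxE eqxx mulr1n.
rewrite mxE; under [RHS]eq_bigr do rewrite mxE.
case: splitP => y _.
  rewrite ord1 mxE eqxx mulr1n !mulr_sumr -big_split; apply: eq_bigr => l _.
  by rewrite mxE eqxx mulr1n /=; ring.
rewrite mxE E !mulr_sumr -sumrB; apply: eq_bigr => l _.
by rewrite mxE; ring.
Qed.

Lemma meval_lin m (c : 'I_m -> k) (F : 'I_m -> S) p :
  (\sum_l (c l)%:MP * F l).@[p] = \sum_l c l * (F l).@[p].
Proof. by rewrite rmorph_sum; apply: eq_bigr => l _; rewrite rmorphM /= mevalC. Qed.

Lemma jet_row_lin_eval m (c : 'I_m -> k) (F : 'I_m -> S) b p :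
  (jet_row (\sum_l (c l)%:MP * F l) 0 b).@[p] = \sum_l c l * (jet_row (F l) 0 b).@[p].
Proof. by rewrite jet_row_lin meval_lin. Qed.

Lemma divided_row_lin_eval m (c : 'I_m -> k) (F : 'I_m -> S) b p :
  (divided_row (\sum_l (c l)%:MP * F l) 0 b).@[p] = \sum_l c l * (divided_row (F l) 0 b).@[p].
Proof. by rewrite divided_row_lin meval_lin. Qed.

(** Modulo [P], [s * F] may be replaced by [u * G]. In the last block the two terms containing
    [om * G] cancel and the rest is divisible by [u]. *)
Lemma jet_row_divided F G b : P (s * F - u * G) ->
  P (jet_row F 0 b - u * divided_row G 0 b).
Proof.
move=> Px; set x := s * F - u * G in Px.
have E : s * F = u * G + x by rewrite /x addrC subrK.
have Pth : P (der th x) by apply: der_field_along_in.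
have Ed th' : der th' (s * F) = der th' u * G + u * der th' G + der th' x.
  by rewrite E derD derM.
rewrite /jet_row /divided_row !mxE; case: splitP => y _.
  by rewrite ord1 !mxE eqxx !mulr1n.
rewrite !mxE; case: splitP => z _.
  rewrite ord1 !mxE eqxx !mulr1n Ed.
  have -> : u * (om * G + u * der th G + der th x) - u * (om * G + u * der th G)
     = u * der th x by ring.
  exact: idealM.
rewrite !mxE !Ed; set a := der th u; set d := der _ u.
have -> : a * (d * G + u * dR z G + dR z x) - d * (a * G + u * der th G + der th x)
    - u * (a * dR z G - d * der th G) = a * dR z x - d * der th x by ring.
by apply: (idealB iP); apply: (idealM _ iP) => //; apply: derR.
Qed.

Lemma jet_row_eval p F b : (forall G, P G -> G.@[p] = 0) -> jet_in P p F ->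
  (jet_row F 0 b).@[p] = 0.
Proof.
move=> pP0 jF; have jE := jet_ideal P p.
have jsF : jet_in P p (s * F) by apply: (idealM _ jE).
have th0 : (der th (s * F)).@[p] = 0.
  rewrite der_field_along rmorph_sum big1 // => c _.
  by rewrite rmorphM /= jet_der ?mulr0.
rewrite mxE; case: splitP => y _; first by rewrite ord1 mxE eqxx mulr1n; case: jsF.
rewrite mxE; case: splitP => z _; first by rewrite ord1 mxE eqxx mulr1n mevalM th0 mulr0.
by rewrite mxE mevalB !mevalM th0 jet_der // !mulr0 subrr.
Qed.
End Rows.

Variables (r : nat) (q : 'M[k]_(r, N)) (s u : 'I_r -> S) (w : 'I_r -> 'cV[k]_N).
Hypothesis qP : forall i F, P F -> F.@[q i] = 0.
Hypotheses (Dq : forall i, Delta.@[q i] != 0) (sq : forall i, (s i).@[q i] != 0)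
  (uq : forall i, (u i).@[q i] = 0).
Hypotheses (tw : forall i, tangent P (q i) (w i))
  (uw : forall i, (grad (u i) (q i) *m w i) 0 0 != 0).
Variables (al be : nat) (a : 'I_al -> S) (b : 'I_be -> S) (g : 'I_r -> 'I_be -> S).
Hypothesis bg : forall i l, P (s i * b l - u i * g i l).
Hypothesis indep_a : forall c : 'I_al -> k,
  (forall i, (\sum_l (c l)%:MP * a l).@[q i] = 0) -> forall l, c l = 0.
Hypothesis indep_b : forall c : 'I_be -> k,
  (forall i, (\sum_l (c l)%:MP * g i l).@[q i] = 0 /\
     forall v, tangent P (q i) v -> grad (u i) (q i) *m v = 0 ->
       grad (\sum_l (c l)%:MP * g i l) (q i) *m v = 0) ->
  forall l, c l = 0.

Local Notation B := (1 + (1 + N))%N.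
Let fam (l : 'I_(al + be)) : S := match split l with inl x => a x | inr y => b y end.
Let rho i l : 'rV[S]_B := jet_row (s i) (u i) (w i) (fam l).
(** The minor has order [be] in $t$, so it survives modulo $t^M$; precision at least $2$ is used to
    read the slope of [u] along the arc. *)
Let M := be.+2.
Let y : 'M[{poly k}]_(r, N) := \matrix_(i, c) arc (field_along (w i)) (q i) M c.
Let om i : k := (der (field_along (w i)) (u i)).@[q i].

Let at_arc i F : {poly k} := mmap (@polyC k) (y i) F.

Let at_arcE i F : at_arc i F = mmap (@polyC k) (arc (field_along (w i)) (q i) M) F.
Proof.
by rewrite /at_arc /mmap; apply: eq_bigr => m _; congr (_ * _); apply: eq_bigr => c _; rewrite mxE.
Qed.

Let at_arc0 i F : (at_arc i F)`_0 = F.@[q i].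
Proof. by rewrite at_arcE arc0. Qed.

Let at_arcP i F : P F -> low_zero M (at_arc i F).
Proof. by move=> PF; rewrite at_arcE; exact: (arc_in char0 (@der_field_along_in (w i)) (@qP i) PF). Qed.

Let om_neq0 i : om i != 0.
Proof. by rewrite /om (der_along_eval _ (tw i)) mulf_neq0. Qed.

Let u_div i : exists u1 : {poly k}, at_arc i (u i) = 'X * u1 /\ u1`_0 = om i.
Proof.
have u0 : (at_arc i (u i)).[0] = 0 by rewrite horner_coef0 at_arc0 uq.
have [u1 E] : exists u1, at_arc i (u i) = u1 * ('X - 0%:P) by apply/factor_theorem/eqP.
exists u1; rewrite E subr0 mulrC; split=> //.
have <- : (at_arc i (u i))`_1 = u1`_0 by rewrite E subr0 coefMX.
rewrite at_arcE arc_eval // /taylor_coef /= divr1 //.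
Qed.

Lemma jets_at_general_points : exists p : 'M[k]_(r, N),
  [/\ forall i F, P F -> F.@[p i] = 0, forall i, h.@[p i] != 0
    & forall (c : 'I_al -> k) (d : 'I_be -> k),
      (forall i, jet_in P (p i) (\sum_l (c l)%:MP * a l + \sum_l (d l)%:MP * b l)) ->
      (forall l, c l = 0) /\ forall l, d l = 0].
Proof.
have /choice[u1 u1P] := u_div.
pose Ta : 'M[{poly k}]_(al, r * B) := \matrix_l mxvec (\matrix_i
  map_mx (at_arc i) (jet_row (s i) (u i) (w i) (a l))).
pose Tb : 'M[{poly k}]_(be, r * B) := \matrix_l mxvec (\matrix_i
  (u1 i *: map_mx (at_arc i) (divided_row (u i) (w i) (g i l)))).
(* The rows at $t=0$, once those of the sections [b] have been divided by $t$. *)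
have [T0 T0E] : exists T0 : 'M[k]_(al + be, r * B),
  T0 = map_mx (horner_eval 0) (col_mx Ta Tb) by eexists.
have T0a l i x : vec_mx (row (lshift be l) T0) i x = (jet_row (s i) (u i) (w i) (a l) 0 x).@[q i].
  rewrite T0E -map_row rowKu rowK map_mxvec mxvecK !mxE /horner_eval horner_coef0.
  exact: at_arc0.
have T0b l i x : vec_mx (row (rshift al l) T0) i x
    = om i * (divided_row (u i) (w i) (g i l) 0 x).@[q i].
  rewrite T0E -map_row rowKd rowK map_mxvec mxvecK !mxE /horner_eval hornerM !horner_coef0.
  by rewrite (u1P i).2; congr (_ * _); apply: at_arc0.
have rf : row_free T0.
  rewrite -kermx_eq0; apply/rowV0P => v /sub_kermxP v0.
  pose ca l := v 0 (lshift be l); pose cb l := v 0 (rshift al l).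
  pose A := \sum_l (ca l)%:MP * a l; pose G i := \sum_l (cb l)%:MP * g i l.
  have E i x : (jet_row (s i) (u i) (w i) A 0 x).@[q i]
      + om i * (divided_row (u i) (w i) (G i) 0 x).@[q i] = 0.
    have := congr1 (fun X : 'rV_(r * B) => vec_mx X i x) v0.
    rewrite mulmx_sum_row linear_sum linear0 summxE [RHS]mxE big_split_ord /= => E0.
    apply: etrans E0; congr (_ + _).
      apply: etrans (jet_row_lin_eval (s i) (u i) (w i) ca a x (q i)) _.
      by apply: eq_bigr => l _; rewrite linearZ /= [RHS]mxE T0a.
    apply: etrans (congr1 ( *%R (om i)) (divided_row_lin_eval (u i) (w i) cb (g i) x (q i))) _.
    by rewrite mulr_sumr; apply: eq_bigr => l _; rewrite linearZ /= [RHS]mxE T0b mulrCA.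
  (* In the second entry the factor [u i] vanishes at [q i], which isolates [om i ^+ 2] times the
     value of [G i]. *)
  have G0 i : (G i).@[q i] = 0.
    have := E i (rshift 1 (lshift N ord0)).
    rewrite !row_mxEr !row_mxEl !mxE eqxx !mulr1n mevalM mevalD !mevalM uq !mul0r add0r addr0.
    rewrite -/(om i) => /eqP; rewrite !mulf_eq0 !(negPf (om_neq0 i)) /=.
    by move/eqP.
  have A0 i : A.@[q i] = 0.
    have := E i (lshift (1 + N) ord0).
    rewrite !row_mxEl !mxE eqxx !mulr1n mevalM G0 mulr0 addr0 => /eqP.
    by rewrite mulf_eq0 (negPf (sq i)) => /eqP.
  have ca0 := indep_a A0.
  have A00 : A = 0 by rewrite /A big1 // => l _; rewrite ca0 mpolyC0 mul0r.
  (* As [A] is zero, the last block makes the derivatives of [G i] along the columns of [R]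
     proportional to those of [u i]; a tangent direction killing [u i] therefore kills [G i]. *)
  have cb0 : forall l, cb l = 0.
    apply: indep_b => i; split=> [|v' tv uv]; first exact: G0.
    have Ec c : (der (fun i => R i c) (G i)).@[q i] * om i
        = (der (fun i => R i c) (u i)).@[q i] * (der (field_along (w i)) (G i)).@[q i].
      have := E i (rshift 1 (rshift 1 c)).
      have -> : jet_row (s i) (u i) (w i) A 0 (rshift 1 (rshift 1 c)) = 0.
        by rewrite !row_mxEr mxE A00 mulr0 !der0 !mulr0 subrr.
      rewrite meval0 add0r !row_mxEr mxE mevalB !mevalM -/(om i) => /eqP.
      by rewrite mulf_eq0 (negPf (om_neq0 i)) subr_eq0 mulrC => /eqP.
    have := der_along_eval (G i) tv.
    have sumE F : (der (field_along v') F).@[q i]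
       = \sum_c v' c 0 * (der (fun i => R i c) F).@[q i].
      by rewrite der_field_along rmorph_sum; apply: eq_bigr => c _; rewrite rmorphM /= mevalC.
    have z0 : (der (field_along v') (G i)).@[q i] = 0.
      apply: (mulIf (om_neq0 i)); rewrite mul0r sumE mulr_suml.
      under eq_bigr do rewrite -mulrA Ec mulrA.
      by rewrite -mulr_suml -sumE (der_along_eval _ tv) uv mxE mulr0 mul0r.
    rewrite z0 => /esym/eqP; rewrite mulf_eq0 (negPf (Dq i)) => /eqP z.
    by apply/matrixP => x1 x2; rewrite !ord1 z mxE.
  apply/rowP => l; rewrite [RHS]mxE -[l]splitK; case: (split l) => l' /=.
    exact: ca0.
  exact: cb0.
pose C := pinvmx T0.
have [p [pP0 hp Cp]] : exists p : 'M[k]_(r, N),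
    [/\ forall i F, P F -> F.@[p i] = 0, forall i, h.@[p i] != 0
      & (minor rho C).@[mxvec p 0] != 0].
  apply: (arcs_to_points pP Ph (M := M) (y := y)) => [i F|low]; first exact: at_arcP.
  have iM := @low_zero_ideal k M.
  pose D := col_mx Ta ('X *: Tb) *m map_mx (@polyC k) C.
  have lowD : low_zero M (\det D).
    have -> : \det D = \det (at_rows rho (@polyC k) y *m map_mx (@polyC k) C)
       - (\det (at_rows rho (@polyC k) y *m map_mx (@polyC k) C) - \det D).
      by rewrite opprB addrC subrK.
    apply: (idealB iM); first by move: low; rewrite /at_poly minor_eval.
    apply: (det_congr iM) => l l'; 
    rewrite /D !mxE -sumrB; apply: (ideal_sum _ iM) => x _; rewrite -mulrBl.
    apply: (idealMl _ iM); case/mxvec_indexP: x => i x.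
    have -> : at_rows rho (@polyC k) y l (mxvec_index i x) = at_arc i (rho i l 0 x).
      by rewrite mxE mxvecE !mxE.
    rewrite -[l]splitK; case: (split l) => l1 /=.
      rewrite col_mxEu (_ : Ta _ _ = at_arc i (jet_row (s i) (u i) (w i) (a l1) 0 x)).
        by rewrite /rho /fam (unsplitK (inl l1)) subrr; apply: (ideal0 iM).
      by rewrite mxE mxvecE !mxE.
    rewrite col_mxEd [('X *: Tb) _ _]mxE.
    rewrite (_ : Tb _ _ = u1 i * at_arc i (divided_row (u i) (w i) (g i l1) 0 x)); last first.
      by rewrite mxE mxvecE !mxE.
    rewrite /rho /fam (unsplitK (inr l1)) mulrA -(u1P i).1.
    have := at_arcP i (jet_row_divided (w i) x (bg i l1)).
    by rewrite /at_arc rmorphB rmorphM.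
  (* Each of the last [be] rows of [D] contributes a factor ['X]; the coefficient of degree [be] is
     the determinant at $t=0$, which is $1$. *)
  have : ('X^be * \det (col_mx Ta Tb *m map_mx (@polyC k) C))`_be = 0.
    have <- : \det D = 'X^be * \det (col_mx Ta Tb *m map_mx (@polyC k) C).
      have -> : D = block_mx 1%:M 0 0 'X%:M *m (col_mx Ta Tb *m map_mx (@polyC k) C).
        by rewrite mulmxA mul_block_col mul1mx !mul0mx addr0 add0r mul_scalar_mx.
      by rewrite det_mulmx det_lblock det1 mul1r det_scalar.
    by apply: lowD; rewrite /M ltnS leqnSn.
  rewrite coefXnM ltnn subnn -horner_coef0 -[_.[0]]/(horner_eval 0 _) -det_map_mx map_mxM.
  have -> : map_mx (horner_eval 0) (map_mx (@polyC k) C) = C.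
    by apply/matrixP => l l'; rewrite !mxE /horner_eval hornerC.
  rewrite -T0E mulmxVp // det1 => /eqP; by rewrite oner_eq0.
exists p; split=> // c d jcd.
have fam0 := minor_indep Cp.
pose e l := match split l with inl x => c x | inr y => d y end.
have e0 l : e l = 0.
  apply: fam0 => i x.
  have := jet_row_eval (s i) (u i) (w i) x (pP0 i) (jcd i).
  have -> : \sum_l (c l)%:MP * a l + \sum_l (d l)%:MP * b l = \sum_l (e l)%:MP * fam l.
    rewrite big_split_ord /=; apply: (congr2 +%R).
      by apply: eq_bigr => l' _; rewrite /e /fam (unsplitK (inl l')).
    by apply: eq_bigr => l' _; rewrite /e /fam (unsplitK (inr l')).
  by move=> E0; rewrite -[RHS]E0; apply: esym; apply: jet_row_lin_eval.
split=> l.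
  by have := e0 (unsplit (inl l)); rewrite /e unsplitK.
by have := e0 (unsplit (inr l)); rewrite /e unsplitK.
Qed.
End GeneralPoints.

(** * The divisors along E *)

Section Divisors.
Variables (k : closedFieldType) (n : nat).
Local Notation S := {mpoly k[n.+1]}.
Local Notation I := 'I_n.+1.
Variables IX IH IH' : set S.
Hypotheses (hX : homog_ideal IX) (hH : homog_ideal IH) (hH' : homog_ideal IH').
Hypotheses (cartH : cartier_divisor IX IH) (cartH' : cartier_divisor IX IH').
Local Notation IE := (idsum IH IH').
Local Notation P := (saturation IH).
Hypotheses (pP : is_prime setT P) (pP' : is_prime setT (saturation IH')).

Let iX : is_ideal setT IX. Proof. by case: hX. Qed.
Let iH : is_ideal setT IH. Proof. by case: hH. Qed.
Let iH' : is_ideal setT IH'. Proof. by case: hH'. Qed.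
Let XH : closed_sub IX IH. Proof. by case: cartH. Qed.
Let XH' : closed_sub IX IH'. Proof. by case: cartH'. Qed.

Lemma sat_closed (J J' : set S) : is_ideal setT J' -> J `<=` saturation J' -> saturation J `<=` saturation J'.
Proof. by move=> hJ' sJ f /(satS sJ); apply: sat_sat. Qed.

Lemma chart_of_prime (J : set S) : is_ideal setT J -> is_prime setT (saturation J) ->
  exists j : I, ~ saturation J 'X_j.
Proof.
move=> hJ pJ; apply: contrapT => h; have [_ n1 _] := pJ; apply: n1.
apply: (sat_sat hJ); exists 1%N => i; rewrite expr1 mulr1; apply: contrapT => ni.
by apply: h; exists i.
Qed.

(** Otherwise $H\subset H'$, and local equations at a point of $H$ satisfy $u'=ut$ up to units. By
    primality [u] or [t] vanishes on $H'$. In the first case the divisors coincide; in the second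
    [t] is a multiple of [u'], and [u] would be a unit at a point of $H$. *)
Lemma proper_intersection : ~ same_scheme IH IH' -> exists2 y, IH' y & ~ P y.
Proof.
move=> neq; apply: contrapT => h; apply: neq.
have {h} H'P : IH' `<=` P.
  by move=> f Hf; apply: contrapT => nf; apply: h; exists f.
have P'P := sat_closed iH H'P.
have [j nj] := chart_of_prime iH pP.
have [v vP vj] := prime_zero pP nj; rewrite mevalXU in vj.
have pX : point_of IX v.
  by split=> [|f Xf]; [exists j | apply: vP; apply: XH; apply: sub_sat].
have nv : nonzero v by exists j.
have [u [du [Hu hu div nzd]]] := cartier_local hX hH cartH pX.
have [u' [du' eq_u']] := cartier_local hX hH' cartH' pX; have [Hu' hu' div' nzd'] := eq_u'.
have v' f : saturation IH' f -> f.@[v] = 0 by move=> /P'P /vP.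
have iP' := sat_ideal iH'.
have [m Hm] : P u' by apply: H'P.
have Xm a : ('X_j ^+ a : S).@[v] != 0 by rewrite rmorphXn /= mevalXU expf_neq0.
have [s [ds [t [dt [hs s0 ht _ Xst]]]]] := div _ _ (Hm j) (dhomogM (homog_varX k j m) hu').
have P'ut : saturation IH' (u * t).
  have -> : u * t = s * ('X_j ^+ m * u') - (s * ('X_j ^+ m * u') - u * t) by ring.
  apply: (idealB iP'); last by apply: XH'; apply: sub_sat.
  by apply: (idealM _ iP'); apply: (idealM _ iP'); apply: sub_sat.
have [P'u|P't] := primeM pP' P'ut.
  apply/seteqP; split=> // f; apply: (sat_closed iH') => {}f Hf.
  have : loc (idsum [set u * a | a in setT] IX) v f.
    exact: (local_division hX hH (And4 Hu hu div nzd) Hf).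
  move=> [s' [d' [_ s0' [_ [x [[a _ <-] Xx E]]]]]].
  have : saturation IH' (s' * f).
    rewrite E; apply: (idealD iP'); first exact: idealMl.
    by apply: XH'; apply: sub_sat.
  by case/(primeM pP') => // /v' /eqP; rewrite (negPf s0').
exfalso; have [m' Hm'] := P't.
have [s2 [ds2 [t2 [dt2 [hs2 s20 ht2 _ Xst2]]]]] :=
  div' _ _ (Hm' j) (dhomogM (homog_varX k j m') ht).
pose W := s2 * 'X_j ^+ m' * s * 'X_j ^+ m.
have : loc IX v (u' * (W - u * t2)).
  apply: loc_in.
  have -> : u' * (W - u * t2) = s2 * 'X_j ^+ m' * (s * ('X_j ^+ m * u') - u * t)
     + u * (s2 * ('X_j ^+ m' * t) - u' * t2) by rewrite /W; ring.
  by apply: (idealD iX); apply: (idealM _ iX).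
move=> /nzd'[s3 [d3 [_ s30 /pX.2 /eqP]]].
rewrite mevalM mulf_eq0 (negPf s30) /= mevalB !mevalM.
have -> : u.@[v] = 0 by apply: vP; apply: sub_sat.
rewrite mul0r subr0 => /eqP W0.
have : W.@[v] != 0 by rewrite /W !mevalM !mulf_neq0.
by rewrite /W !mevalM W0 eqxx.
Qed.

Lemma tangent_sat (J : set S) v w : point_of J v -> tangent (saturation J) v w <-> tangent J v w.
Proof.
move=> pv; split=> t f; first by move=> Jf; apply: t; exists 0%N => i; rewrite mul1r.
by move=> /(jet_sat pv)[_]; apply.
Qed.

(** At a point of $E$, an element of [IH'] is locally a multiple of [u] modulo [IX], so on tangent
    vectors of $H$ its gradient is a multiple of that of [u]. *)
Lemma tangent_cut q u du w : point_of IE q -> local_equation IX IH' q u du ->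
  tangent P q w -> grad u q *m w = 0 -> tangent IE q w.
Proof.
move=> pq eq_u tw uw.
have pqH : point_of IH q.
  by split; [case: pq | move=> f Hf; apply: pq.2; apply: idsuml].
move=> _ [f [f' [Hf Hf' ->]]]; rewrite gradD mulmxDl (tangent_sat w pqH).1 // add0r.
have [s [d [_ s0 [_ [x [[a _ <-] Xx E]]]]]] := local_division hX hH' eq_u Hf'.
have z' g : IH' g -> g.@[q] = 0 by move=> Hg; apply: pq.2; apply: idsumr.
have := congr1 (fun F => grad F q *m w) E; rewrite gradD !gradM !mulmxDl.
have [Hu _ _ _] := eq_u; rewrite (z' _ Hf') (z' _ Hu) !scale0r !mul0mx !add0r.
rewrite addr0 -!scalemxAl uw scaler0 add0r.
rewrite (tw x) => [/eqP|]; last by apply: XH; apply: sub_sat.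
by rewrite scaler_eq0 (negPf s0) => /eqP.
Qed.

Lemma equal_tangent_jets (J J' : set S) v f : (forall w, tangent J v w -> tangent J' v w) ->
  jet_in J' v f -> jet_in J v f.
Proof. by move=> h [f0 jf]; split=> // w /h; apply: jf. Qed.
End Divisors.

(** * Ranks of the evaluation maps *)

Section ChartSections.
Variables (k : closedFieldType) (n : nat).
Local Notation S := {mpoly k[n.+1]}.
Local Notation I := 'I_n.+1.
Variable j : I.
Local Notation ratio F e := (tofrac F / tofrac (mons k [:: j]) ^+ e : fracmod k n.+1).

Lemma sec_of_sat (J : set S) F e : is_ideal setT J -> F \is e.+1.-homog ->
  saturation J F -> sec [:: j] J (ratio F e).
Proof.
move=> hJ hF sF; apply: (sec_sat (J := saturation J) hJ (fun x => id)).
by exists e, F; rewrite /= muln1.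
Qed.

Lemma sec_cleared (J : set S) F e : is_ideal setT J -> sec [:: j] J (ratio F e) ->
  exists b, J ('X_j ^+ b * F).
Proof.
move=> hJ [b [a [Ja ha E]]]; exists b.
have := sec_eq E; rewrite {1}/mons big_seq1 mulrC => ->.
exact: idealMl.
Qed.

(** Numerators are taken in one degree, and every larger degree is allowed so that two families can
    share it. *)
Lemma chart_family (J J0 : set S) c (f : 'I_c -> {ffun I -> fracmod k n.+1}) :
  is_ideal setT J -> (forall l, Z0 (fun ls => sec ls J) (fun ls => sec ls J0) (f l)) ->
  exists e0, forall e, (e0 <= e)%N ->
  exists a : 'I_c -> S, [/\ forall l, J (a l), forall l, a l \is e.+1.-homog
    & forall g : 'I_c -> k, (\sum_l g l *: f l) j = ratio (\sum_l (g l)%:MP * a l) e].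
Proof.
move=> hJ Jf; have [|e0 aP0] := sec_family (ls := [:: j]) (v := fun l => f l j) hJ.
  by move=> l; have [h _] := Jf l; apply: h.
exists e0 => e /aP0[a aP]; exists a; split=> [l|l|g].
- by have [] := aP l.
- by have [_] := aP l; rewrite /= muln1.
- rewrite -sum_scale_tofrac sum_ffunE; apply: eq_bigr => l _.
  by have [_ _ <-] := aP l; rewrite !ffunE.
Qed.
End ChartSections.

Section Ranks.
Variables (k : closedFieldType) (n : nat).
Hypothesis char0 : forall n, n.+1%:R != 0 :> k.
Local Notation S := {mpoly k[n.+1]}.
Local Notation I := 'I_n.+1.
Variables IX IH IH' IW : set S.
Hypotheses (hX : homog_ideal IX) (hH : homog_ideal IH) (hH' : homog_ideal IH')
  (hW : homog_ideal IW).
Hypotheses (cartH : cartier_divisor IX IH) (cartH' : cartier_divisor IX IH').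
Hypothesis XW : closed_sub IX IW.
Local Notation IE := (idsum IH IH').
Local Notation P := (saturation IH).
Local Notation Q := (saturation IE).
Hypothesis pP : is_prime setT P.

Let iX : is_ideal setT IX. Proof. by case: hX. Qed.
Let iH : is_ideal setT IH. Proof. by case: hH. Qed.
Let iH' : is_ideal setT IH'. Proof. by case: hH'. Qed.
Let iW : is_ideal setT IW. Proof. by case: hW. Qed.
Let XH : closed_sub IX IH. Proof. by case: cartH. Qed.
Let XH' : closed_sub IX IH'. Proof. by case: cartH'. Qed.
Let iP : is_ideal setT P. Proof. exact: sat_ideal. Qed.
Let XP : IX `<=` P. Proof. by move=> f Xf; apply: XH; apply: sub_sat. Qed.

Variables (j : I) (m : nat) (Delta psi : S) (R : 'M[S]_n.+1) (T : {set I}).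
Hypothesis P_chart : ~ P (Delta * 'X_j).
Hypothesis derR : forall F c, P F -> P (\sum_i F^`M(i) * R i c).
Hypothesis RE : forall p w, tangent P p w ->
  forall i, \sum_c (R i c).@[p] * w c 0 = Delta.@[p] * w i 0.
Hypothesis tanK : forall p : I -> k, (forall g, P g -> g.@[p] = 0) -> Delta.@[p] != 0 ->
  exists K : 'M[k]_(n.+1, m.+1), \rank K = m.+1 /\
    forall w, tangent P p w <-> exists z, w = K *m z.
Hypotheses (cardT : #|T| = m) (tanT : forall p : I -> k, psi.@[p] != 0 ->
  forall w : 'cV_n.+1, tangent Q p w -> (forall i, i \in T -> w i 0 = 0) -> w = 0).

Let zeroP q : point_of IH q -> forall g, P g -> g.@[q] = 0.
Proof. by move=> pq g; apply: sat_eval. Qed.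

Let onH q : point_of IE q -> point_of IH q.
Proof. by move=> [nq h]; split=> // f Hf; apply: h; apply: idsuml. Qed.

(** If the gradient of [u] vanished on the tangent space of $H$, of dimension [m.+1], all of it
    would be tangent to $E$; but where [psi] does not vanish, a tangent vector of $E$ is determined
    by [m] coordinates. *)
Lemma frame_point q u du : point_of IE q -> Delta.@[q] != 0 -> psi.@[q] != 0 ->
  local_equation IX IH' q u du ->
  (exists2 w, tangent P q w & (grad u q *m w) 0 0 != 0) /\
  exists K : 'M[k]_(n.+1, m), \rank K = m /\ forall z, tangent IE q (K *m z).
Proof.
move=> pq Dq psiq eq_u; have pqH := onH pq.
have [K [rK KP]] := tanK (zeroP pqH) Dq.
have cut z : grad u q *m K *m z = 0 -> tangent IE q (K *m z).
  move=> uz; apply: (tangent_cut hX hH hH' cartH pq eq_u); first by apply/KP; exists z.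
  by rewrite mulmxA.
have Kinj z : K *m z = 0 -> z = 0.
  move=> Kz; apply: trmx_inj; have rf : row_free K^T by rewrite /row_free mxrank_tr rK.
  by apply: (row_free_inj rf); rewrite -trmx_mul Kz !trmx0 mul0mx.
have phi0 : grad u q *m K != 0.
  apply/eqP => phi0.
  pose ET : 'M[k]_(#|T|, n.+1) := \matrix_(a, i) (i == enum_val a)%:R.
  have : kermx (ET *m K)^T != 0.
    rewrite -mxrank_eq0 mxrank_ker mxrank_tr subn_eq0 -ltnNge ltnS.
    by rewrite (leq_trans (rank_leq_row _)) // cardT.
  case/rowV0Pn => v /sub_kermxP vE v0; case/eqP: v0; apply: trmx_inj; rewrite trmx0.
  apply: Kinj; apply: (tanT psiq).
    by apply/(tangent_sat _ pq); apply: cut; rewrite phi0 mul0mx.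
  have E : ET *m (K *m v^T) = 0.
    by apply: trmx_inj; rewrite mulmxA trmx_mul trmxK vE trmx0.
  move=> i iT; have := congr1 (fun X : 'cV_ _ => X (enum_rank_in iT i) 0) E.
  rewrite [LHS]mxE [RHS]mxE (bigD1 i) //= mxE enum_rankK_in // eqxx mul1r big1 ?addr0 // => l li.
  by rewrite mxE enum_rankK_in // (negPf li) mul0r.
split.
  have [l ul] : exists l, (grad u q *m K) 0 l != 0.
    apply: contrapT => h; case/eqP: phi0; apply/rowP => l; rewrite [RHS]mxE.
    by apply/eqP; apply: contrapT => /negP ne; apply: h; exists l.
  exists (K *m delta_mx l 0); first by apply/KP; exists (delta_mx l 0).
  by rewrite mulmxA -colE mxE.
have [|K1 [rK1 K1P]] := @kernel_basis _ _ _ m (grad u q *m K).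
  by rewrite rank_rV phi0.
exists (K *m K1); split.
  by rewrite -mxrank_tr trmx_mul mxrankMfree ?mxrank_tr // /row_free mxrank_tr rK.
by move=> z; rewrite -mulmxA; apply: cut; apply/K1P; exists z.
Qed.

Local Notation X := (fun ls : seq I => sec ls IX).
Local Notation W := (fun ls : seq I => sec ls (whole IX IW)).
Local Notation L Z := (fun ls : seq I => sec ls (twoH IX IH IW Z)).

Variable r : nat.

(** Families of points of $H$, repetitions allowed, at which the chart of [j] and the frame [R] can
    be used. *)
Definition valid (Z : 'M[k]_(r, n.+1)) : Prop :=
  [/\ points_on IH Z, forall i, Z i j != 0 & forall i, Delta.@[Z i] != 0].

Let iWh : is_ideal setT (whole IX IW). Proof. exact: whole_ideal. Qed.
Let iL (Z : 'M[k]_(r, n.+1)) : is_ideal setT (twoH IX IH IW Z).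
Proof. exact: twoH_ideal. Qed.
Let pX : psh X. Proof. exact: psh_sec. Qed.
Let pW : psh W. Proof. exact: psh_sec. Qed.
Let pL (Z : 'M[k]_(r, n.+1)) : psh (L Z). Proof. exact: psh_sec. Qed.
Let XL (Z : 'M[k]_(r, n.+1)) : sub_psh X (L Z).
Proof.
move=> i ls; apply: secS; apply: idsumr; apply: is_ideal_setI => //.
exact: double_points_ideal.
Qed.

Lemma skyscraper_valid Z : valid Z ->
  exists2 dW, (dW <= r * m.+1)%N & skyscraper j W (L Z) dW.
Proof.
move=> [ZH Zj ZD]; apply: skyscraper_twoH => // i.
have [K [_ KP]] := tanK (zeroP (ZH i)) (ZD i); exists K => w tw.
by apply/KP/(tangent_sat _ (ZH i)).
Qed.

Lemma rank_exists Z : valid Z ->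
  exists2 w, (w <= r * m.+1)%N & has_qdim (Z0 W X) (C0 (L Z)) w.
Proof.
move=> /skyscraper_valid[dW le_d sky].
have [rho [z [E q _ _]]] := sky_H1 pX (pL Z) pW (@XL Z) sky.
by exists rho => //; apply: leq_trans le_d; rewrite -E leq_addr.
Qed.

Section Family.
Variables (Z : 'M[k]_(r, n.+1)) (c e : nat) (f : 'I_c -> {ffun I -> fracmod k n.+1})
  (a : 'I_c -> S).
Hypotheses (vZ : valid Z) (Wf : forall l, Z0 W X (f l)) (Wa : forall l, whole IX IW (a l))
  (ha : forall l, a l \is e.+1.-homog).
Hypothesis fa : forall g : 'I_c -> k,
  (\sum_l g l *: f l) j = (tofrac (\sum_l (g l)%:MP * a l) / tofrac (mons k [:: j]) ^+ e).

(** Vanishing on the double points is tested on the single chart of [j], which contains all the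
    points. *)
Lemma jets_of_family (g : 'I_c -> k) : C0 (L Z) (\sum_l g l *: f l) <->
  forall i, jet_in P (Z i) (\sum_l (g l)%:MP * a l).
Proof.
have [ZH Zj ZD] := vZ; split=> [/(_ j)|jZ].
  rewrite /= fa => /(sec_cleared (iL Z))[b Lb] i.
  apply: (equal_tangent_jets (J' := IH)); first by move=> w /(tangent_sat _ (ZH i)).
  apply: (jet_cancel (s := 'X_j ^+ b)); first by rewrite rmorphXn /= mevalXU expf_neq0.
  exact: (twoH_jet hX XH ZH i Lb).
have [dW _ [_ descW _ _]] := skyscraper_valid vZ.
apply: (Z0_at_chart (pL Z) (@XL Z) descW).
  by apply: subsp_lc => //; apply: subsp_Z0.
rewrite fa; apply: sec_of_sat => //; first exact: homog_sum.
apply: (sat_twoH hX hH hW ZH (homog_sum g ha)).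
  apply: (whole_sat hX hW XW); apply: (ideal_sum _ iWh) => l _.
  exact: (idealM _ iWh).
move=> i; apply: equal_tangent_jets (jZ i) => w.
by move=> /(tangent_sat _ (ZH i)).
Qed.

(** The value and the derivatives along the columns of [R], which span the tangent space of $H$
    where [Delta] does not vanish: jets in a form polynomial in the point. *)
Let rho (i : 'I_r) (l : 'I_c) : 'rV[S]_(1 + n.+1) :=
  row_mx (a l)%:M (\row_b der (fun i => R i b) (a l)).

Lemma rho_lin i g b : \sum_l g l * (rho i l 0 b).@[Z i] = 0 <->
  match split b with
  | inl _ => (\sum_l (g l)%:MP * a l).@[Z i] = 0
  | inr b' => (der (fun i => R i b') (\sum_l (g l)%:MP * a l)).@[Z i] = 0
  end.
Proof.
rewrite -meval_lin /rho; under eq_bigr do rewrite mxE.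
case: splitP => [y _|y _].
  by rewrite (ord1 y); under eq_bigr do rewrite mxE eqxx mulr1n.
under eq_bigr do rewrite mxE -derZ.
by rewrite der_sum; split.
Qed.

Lemma rho_jets (g : 'I_c -> k) : (forall i b, \sum_l g l * (rho i l 0 b).@[Z i] = 0) <->
  forall i, jet_in P (Z i) (\sum_l (g l)%:MP * a l).
Proof.
have [ZH _ ZD] := vZ; split=> h i; last first.
  move=> b; apply/rho_lin; case: split => b'; first by case: (h i).
  exact: (jet_der derR b' (zeroP (ZH i)) (h i)).
split; first by have /rho_lin := h i (lshift n.+1 ord0); rewrite (unsplitK (inl _)).
move=> w tw; apply/matrixP => x y; rewrite !ord1 [RHS]mxE.
have := der_along_eval RE (\sum_l (g l)%:MP * a l) tw.
rewrite der_field_along rmorph_sum big1 => [/esym/eqP|b _].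
  by rewrite mulf_eq0 (negPf (ZD i)) => /eqP.
have /rho_lin := h i (rshift 1 b); rewrite (unsplitK (inr _)) => h0.
by rewrite rmorphM /= h0 mulr0.
Qed.

Lemma exists_family_minor : indep (C0 (L Z)) f ->
  exists Phi : {mpoly k[r * n.+1]}, Phi.@[mxvec Z 0] != 0 /\
    exists C, Phi = minor rho C.
Proof.
move=> If; have [|C hC] := @exists_minor _ _ _ _ _ rho Z; last first.
  by exists (minor rho C); split=> //; exists C.
by move=> g /rho_jets /jets_of_family /If.
Qed.

Lemma family_minor_indep C : (minor rho C).@[mxvec Z 0] != 0 -> indep (C0 (L Z)) f.
Proof. by move=> d0 g h; apply: (minor_indep d0); apply/rho_jets/jets_of_family. Qed.
End Family.

(** [kappa] is the largest rank over valid families, and [Phi] a minor for sections realising it at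
    [Z1]; where [Phi] does not vanish these sections stay independent. This is the open condition of
    maximal rank on $\widetilde{Z}$. *)
Lemma maximal_rank : exists kappa Z1 (Phi : {mpoly k[r * n.+1]}),
  [/\ valid Z1, Phi.@[mxvec Z1 0] != 0,
    forall Z w, valid Z -> has_qdim (Z0 W X) (C0 (L Z)) w -> (w <= kappa)%N
  & forall Z w, valid Z -> Phi.@[mxvec Z 0] != 0 ->
      has_qdim (Z0 W X) (C0 (L Z)) w -> (kappa <= w)%N].
Proof.
have sL (Z : 'M[k]_(r, n.+1)) : subsp (C0 (L Z)) by exact: (subsp_C0 (pL Z)).
have [v vP] : exists2 v : I -> k, forall g, P g -> g.@[v] = 0 & (Delta * 'X_j).@[v] != 0.
  exact: prime_zero.
rewrite mevalM mevalXU mulf_eq0 negb_or => /andP[Dv vj].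
pose Zv : 'M[k]_(r, n.+1) := \matrix_(i, l) v l.
have Zvi i F : F.@[Zv i] = F.@[v] by apply: meval_eq => l; rewrite mxE.
have vZv : valid Zv.
  split=> i; last by rewrite Zvi.
    split; first by exists j; rewrite mxE.
    by move=> f Hf; rewrite Zvi; apply: vP; apply: sub_sat.
  by rewrite mxE.
pose good c := `[< exists2 Z, valid Z & has_qdim (Z0 W X) (C0 (L Z)) c >].
have ex_good : exists c, good c.
  by have [w _ q] := rank_exists vZv; exists w; apply/asboolP; exists Zv.
have bound c : good c -> (c <= r * m.+1)%N.
  move=> /asboolP[Z vZ q]; have [w le_w q'] := rank_exists vZ.
  by rewrite (qdim_uniq (sL Z) q q').
case: (ex_maxnP ex_good bound) => kappa /asboolP[Z1 vZ1 [f [Wf _ If]]] kmax.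
have [e /(_ e (leqnn e))[a [Wa ha fa]]] := chart_family j iWh Wf.
have [Phi [Phi1 [C EC]]] := exists_family_minor vZ1 Wf Wa ha fa If.
exists kappa, Z1, Phi; split=> // Z w vZ.
  by move=> q; apply: kmax; apply/asboolP; exists Z.
rewrite EC => /(family_minor_indep vZ Wf Wa ha fa) IZ q.
exact: (qdim_indep (sL Z) Wf IZ q).
Qed.

Section AtDoublePoints.
Variable D : 'M[k]_(r, n.+1).
Hypotheses (DE : points_on IE D) (Dj : forall i, D i j != 0)
  (DD : forall i, Delta.@[D i] != 0) (Dpsi : forall i, psi.@[D i] != 0).
Hypotheses (dD : distinct_points D) (WD : disjoint_from IW D).

Local Notation A := (fun ls : seq I => sec ls (vanishing IX IH' IW)).
Local Notation R1 := (fun ls : seq I => sec ls (resid IX IH IH' IW D)).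
Local Notation TT := (fun ls : seq I => sec ls (restricted IH' IW)).
Local Notation R2 := (fun ls : seq I => sec ls (trace IH' IW D)).
Local Notation H := (fun ls : seq I => sec ls IH').

Let eqD : exists u du, forall i, local_equation IX IH' (D i) (u i) (du i).
Proof.
have /choice[u /choice[du uP]] : forall i, exists u du, local_equation IX IH' (D i) u du.
  by move=> i; apply: (cartier_local hX hH' cartH'); exact: (on_divisor hX hH' XH DE Dj i).
by exists u, du.
Qed.

Lemma skyscraper_A : exists2 dA, (r * m <= dA)%N & skyscraper j A R1 dA.
Proof.
have [u [du uP]] := eqD.
apply: (skyscraper_resid hX hH hH' hW XH XW cartH' DE Dj dD WD) => i.
exact: (frame_point (DE i) (DD i) (Dpsi i) (uP i)).2.
Qed.

Lemma whole_restricted : whole IX IW `<=` saturation (restricted IH' IW).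
Proof.
have iR := restricted_ideal hH' hW.
apply: idsum_sub; first exact: sat_ideal.
  by move=> f Wf; apply: (sub_sat iR); apply: idsuml => //; apply: idsuml.
move=> f Xf; have : saturation IH' f by apply: XH'; apply: sub_sat.
by apply: satS; apply: idsumr; apply: is_ideal_idsum.
Qed.

Lemma restricted_sub : sub_psh W TT.
Proof.
move=> i ls; apply: sec_sat whole_restricted; exact: restricted_ideal.
Qed.

(** Sections of $I_W$ independent on the points [D] are joined with sections vanishing on $H'$ and
    independent on the residual double points; [jets_at_general_points] makes them independent
    together on the double points of some [Z]. *)
Lemma rank_at_general a t : has_qdim (Z0 A X) (C0 R1) a -> has_qdim (Z0 W X) (C0 R2) t ->
  exists2 Z, valid Z & forall w, has_qdim (Z0 W X) (C0 (L Z)) w -> (a + t <= w)%N.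
Proof.
move=> [fb [Afb _ Ib]] [fa [Wfa _ Ia]]; have [u [du uP]] := eqD.
have iV : is_ideal setT (vanishing IX IH' IW) by exact: vanishing_ideal.
have iR1 : is_ideal setT (resid IX IH IH' IW D) by exact: resid_ideal.
have iT : is_ideal setT (restricted IH' IW) by exact: restricted_ideal.
have iR2 : is_ideal setT (trace IH' IW D) by exact: trace_ideal.
have pA : psh A by exact: psh_sec.
have pR1 : psh R1 by exact: psh_sec.
have pTT : psh TT by exact: psh_sec.
have pR2 : psh R2 by exact: psh_sec.
have pH : psh H by exact: psh_sec.
have [ea /(_ _ (leq_addr _ _)) paP] := chart_family j iWh Wfa.
have [eb /(_ _ (leq_addl ea _))[pb [Vpb hpb fbE]]] := chart_family j iV Afb.
have {paP} [pa [Wpa hpa faE]] := paP eb.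
set e := (ea + eb)%N in pa Wpa hpa faE pb Vpb hpb fbE.
have /choice[s /choice[ds /choice[dg /choice[g gP]]]] : forall i, exists s ds dg (g : 'I_a -> S),
    [/\ s \is ds.-homog, s.@[D i] != 0, forall l, g l \is dg.-homog
      & forall l, IX (s * pb l - u i * g l)].
  by move=> i; apply: (common_local_division iX (uP i)) hpb => l; case: (Vpb l).
have /choice[w wP] : forall i, exists w, tangent P (D i) w /\ (grad (u i) (D i) *m w) 0 0 != 0.
  by move=> i; have [[w tw uw] _] := frame_point (DE i) (DD i) (Dpsi i) (uP i); exists w.
have u0 i : (u i).@[D i] = 0.
  by have [Hu _ _ _] := uP i; apply: (DE i).2; apply: idsumr.
have indep_a (c : 'I_t -> k) : (forall i, (\sum_l (c l)%:MP * pa l).@[D i] = 0) ->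
    forall l, c l = 0.
  move=> c0; apply: Ia.
  have [dT _ [_ descT _ _]] := skyscraper_trace hH hH' hW DE Dj dD WD.
  have HR2 : sub_psh H R2.
    by move=> i ls; apply: secS; apply: idsumr; apply: is_ideal_setI; [apply: is_ideal_idsum | apply: simple_points_ideal].
  have XHs : sub_psh X H.
    by move=> i ls; apply: sec_sat => // f Xf; apply: XH'; apply: sub_sat.
  apply: (Z0_at_chart pR2 HR2 descT).
    apply: (Z0S restricted_sub XHs); apply: subsp_lc => //.
    exact: subsp_Z0.
  have hF := homog_sum c hpa.
  rewrite faE; apply: (sec_of_sat j iR2 hF).
  have [b Fb] : saturation (restricted IH' IW) (\sum_l (c l)%:MP * pa l).
    by apply: whole_restricted; apply: (ideal_sum _ iWh) => l _; apply: (idealM _ iWh).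
  exists b => i; apply: restricted_simple => //.
  apply: (homog_simple (dhomogM (homog_varX k i b) hF)) => i'.
  by rewrite mevalM c0 mulr0.
(* The tangent vectors of $E$ are tangent to $H$ and killed by the gradient of [u i]; so such a
   combination has quotients with zero jets along $E$ and lies in the residual subsheaf. *)
have indep_b (c : 'I_a -> k) : (forall i, (\sum_l (c l)%:MP * g i l).@[D i] = 0 /\
     forall v, tangent P (D i) v -> grad (u i) (D i) *m v = 0 ->
       grad (\sum_l (c l)%:MP * g i l) (D i) *m v = 0) -> forall l, c l = 0.
  move=> jc; apply: Ib.
  have [dA _ [_ descA _ _]] := skyscraper_A.
  have XR1 : sub_psh X R1.
    move=> i ls; apply: secS; apply: idsumr; apply: is_ideal_idmul.
    by apply: is_ideal_setI; [apply: is_ideal_colon | apply: double_points_ideal; apply: is_ideal_idsum].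
  apply: (Z0_at_chart pR1 XR1 descA).
    by apply: subsp_lc => //; apply: subsp_Z0.
  rewrite fbE; have hF := homog_sum c hpb; apply: (sec_of_sat j iR1 hF).
  apply: (sat_resid hX hH hH' hW XW cartH' DE Dj dD hF).
    by apply: (ideal_sum _ iV) => l _; apply: (idealM _ iV).
  move=> i; have [hs s0 hg Xg] := gP i.
  exists (u i), (du i), (s i), (ds i), (\sum_l (c l)%:MP * g i l), (dg i); split=> //.
  - exact: homog_sum.
  - rewrite !mulr_sumr -sumrB; apply: (ideal_sum _ iX) => l _.
    have -> : s i * ((c l)%:MP * pb l) - u i * ((c l)%:MP * g i l)
       = (c l)%:MP * (s i * pb l - u i * g i l) by ring.
    exact: (idealM _ iX).
  - have [z0 z1] := jc i; split=> // v tv; apply: z1.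
      by apply/(tangent_sat _ (onH (DE i))) => f Hf; apply: tv; apply: idsuml.
    by apply: tv; apply: idsumr => //; have [] := uP i.
have [Z [ZP Zh Zi]] : exists Z : 'M[k]_(r, n.+1),
  [/\ forall i F, P F -> F.@[Z i] = 0, forall i, (Delta * 'X_j).@[Z i] != 0
    & forall (c : 'I_t -> k) (d : 'I_a -> k),
      (forall i, jet_in P (Z i) (\sum_l (c l)%:MP * pa l + \sum_l (d l)%:MP * pb l)) ->
      (forall l, c l = 0) /\ forall l, d l = 0].
  have qP i F : P F -> F.@[D i] = 0 by apply: (zeroP (onH (DE i))).
  have s0 i : (s i).@[D i] != 0 by have [] := gP i.
  have tw i : tangent P (D i) (w i) by have [] := wP i.
  have uw i : (grad (u i) (D i) *m w i) 0 0 != 0 by have [] := wP i.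
  have bg i l : P (s i * pb l - u i * g i l) by apply: XP; have [] := gP i.
  exact: (jets_at_general_points char0 pP P_chart derR RE qP DD s0 u0 tw uw bg indep_a indep_b).
have vZ : valid Z.
  split=> i; last by have := Zh i; rewrite mevalM mulf_eq0 negb_or => /andP[].
    split; last by move=> f Hf; apply: ZP; apply: sub_sat.
    by exists j; have := Zh i; rewrite mevalM mevalXU mulf_eq0 negb_or => /andP[].
  by have := Zh i; rewrite mevalM mevalXU mulf_eq0 negb_or => /andP[].
exists Z => // x qx.
have sL : subsp (C0 (L Z)) by exact: (subsp_C0 (pL Z)).
pose f (l : 'I_(t + a)) := match split l with inl y => fa y | inr y => fb y end.
have sAW : sub_psh A W by move=> i ls; apply: secS => y [].
have AW : Z0 A X `<=` Z0 W X by exact: (Z0S sAW (fun _ _ _ h => h)).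
have Wf l : Z0 W X (f l).
  by rewrite /f; case: split => y; [apply: Wfa | apply: AW; apply: Afb].
rewrite addnC; apply: (qdim_indep sL Wf _ qx) => c.
pose pj (l : 'I_(t + a)) := match split l with inl y => pa y | inr y => pb y end.
have Wpj l : whole IX IW (pj l).
  by rewrite /pj; case: split => y; [apply: Wpa | case: (Vpb y)].
have hpj l : pj l \is e.+1.-homog.
  by rewrite /pj; case: split => y; [apply: hpa | apply: hpb].
have pjE (d : 'I_(t + a) -> k) : \sum_l (d l)%:MP * pj l
    = \sum_l (d (lshift a l))%:MP * pa l + \sum_l (d (rshift t l))%:MP * pb l.
  rewrite big_split_ord /=; apply: (congr2 +%R); apply: eq_bigr => l _.
    by rewrite /pj (unsplitK (inl l)).
  by rewrite /pj (unsplitK (inr l)).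
have fE (d : 'I_(t + a) -> k) : (\sum_l d l *: f l) j =
    (tofrac (\sum_l (d l)%:MP * pj l) / tofrac (mons k [:: j]) ^+ e).
  rewrite pjE rmorphD mulrDl big_split_ord ffunE; apply: (congr2 +%R).
    rewrite -(faE (fun l => d (lshift a l))); congr (_ _ j); apply: eq_bigr => l _.
    by rewrite /f (unsplitK (inl l)).
  rewrite -(fbE (fun l => d (rshift t l))); congr (_ _ j); apply: eq_bigr => l _.
  by rewrite /f (unsplitK (inr l)).
move=> /(jets_of_family vZ Wf Wpj hpj fE); rewrite pjE => /Zi[c1 c2] l.
by rewrite -[l]splitK; case: (split l) => y; [apply: c1 | apply: c2].
Qed.

Lemma horace_inequality Z i : valid Z ->
  (forall a t, has_qdim (Z0 A X) (C0 R1) a -> has_qdim (Z0 W X) (C0 R2) t ->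
     exists2 w, (a + t <= w)%N & has_qdim (Z0 W X) (C0 (L Z)) w) ->
  (i <= 1)%N ->
  dim_le (h_ideal IX (IW `&` double_points IH Z) i)
    (dim_add (h_ideal IX (idmul (colon IW IH' `&` double_points IE D) IH') i)
       (h_ideal IH' (idsum IW IH' `&` simple_points D) i)).
Proof.
move=> vZ rank_bound.
have iD : is_ideal setT (double_points IE D) by apply: double_points_ideal; apply: is_ideal_idsum.
have iC : is_ideal setT (colon IW IH' `&` double_points IE D).
  by apply: is_ideal_setI => //; apply: is_ideal_colon.
have i1 : is_ideal setT (idmul (colon IW IH' `&` double_points IE D) IH').
  exact: is_ideal_idmul.
have i2 : is_ideal setT (idsum IW IH' `&` simple_points D).
  by apply: is_ideal_setI; [apply: is_ideal_idsum | apply: simple_points_ideal].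
have iZ : is_ideal setT (IW `&` double_points IH Z).
  by apply: is_ideal_setI => //; apply: double_points_ideal.
have pA : psh A by apply: psh_sec; exact: vanishing_ideal.
have pR1 : psh R1 by apply: psh_sec; exact: resid_ideal.
have pTT : psh TT by apply: psh_sec; exact: restricted_ideal.
have pR2 : psh R2 by apply: psh_sec; exact: trace_ideal.
have pH : psh H by exact: psh_sec.
have XR1 : sub_psh X R1 by move=> a ls; apply: secS; apply: idsumr.
have HR2 : sub_psh H R2 by move=> a ls; apply: secS; apply: idsumr.
have AW : sub_psh A W by move=> a ls; apply: secS => y [].
have AH : sub_psh A H by move=> a ls; apply: secS => y [].
have WHA a ls x : W (a :: ls) x -> H (a :: ls) x -> A (a :: ls) x.
  by move=> h1 h2; apply: sec_cap => //; split.
have TWH a : TT [:: a] `<=` subspD (W [:: a]) (H [:: a]).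
  have sH : subsp (H [:: a]) by exact: sec_subsp.
  move=> x /(sec_idsum (homog_idsum hW hH') hH')[y [z [hy hz ->]]].
  have [y' [z' [hy' hz' ->]]] := sec_idsum hW hH' hy.
  exists y', (z' + z); rewrite addrA; split=> //; last exact: subsp_add.
  by apply: secS hy'; apply: idsuml.
have [dW le_W skyW] := skyscraper_valid vZ.
have [dA le_A skyA] := skyscraper_A.
have [dT le_T skyT] := skyscraper_trace hH hH' hW DE Dj dD WD.
(* The length at each point of $\widetilde{Z}$ is at most [m.+1], against at least [m] for the
   residual double point and $1$ for the trace point. *)
have count : (dW <= dA + dT)%N.
  by apply: (leq_trans le_W); rewrite mulnS addnC leq_add.
case: i => [|[|//]] _; apply: dim_le_h_ideal => [d d'|x y].
- move=> /(has_dim_H0 _ _ _) q /(has_dim_H0 _ _ _).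
  exact: (qdim_uniq (subsp_C0 pX) q).
- move=> /(has_dim_H0 _ _ _) qx /(has_dim_H0 _ _ _) qy.
  have [d le_d qd] := horace_H0 pX (pL Z) pW pR1 pA pR2 pTT pH (@XL Z) XR1 HR2 AW AH
    restricted_sub WHA skyW skyA skyT count rank_bound qx qy.
  by exists d => //; apply/(has_dim_H0 _ _ _).
- move=> /(has_dim_H1 _ _ _) q /(has_dim_H1 _ _ _).
  exact: (qdim_uniq (subsp_B1 (pL Z) pX) q).
- move=> /(has_dim_H1 _ _ _) qx /(has_dim_H1 _ _ _) qy.
  have [d le_d qd] := horace_H1 pX (pL Z) pW pR1 pA pR2 pTT pH (@XL Z) XR1 HR2 AW AH
    restricted_sub WHA TWH skyW skyA skyT count rank_bound qx qy.
  by exists d => //; apply/(has_dim_H1 _ _ _).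
Qed.
End AtDoublePoints.
End Ranks.

(** * Open conditions on families of points *)

Section Scaling.
Variables (k : closedFieldType) (n : nat).
Local Notation S := {mpoly k[n.+1]}.
Local Notation I := 'I_n.+1.
Implicit Types v w : I -> k.

Lemma same_point_sym v w : same_point v w -> same_point w v.
Proof.
move=> [c [c0 E]]; exists c^-1; split=> [|i]; first by rewrite invr_eq0.
by rewrite E mulKf.
Qed.

Lemma same_point_trans v w x : same_point v w -> same_point w x -> same_point v x.
Proof.
move=> [c [c0 E]] [d [d0 F]]; exists (c * d); split=> [|i]; first by rewrite mulf_neq0.
by rewrite E F mulrA.
Qed.

Lemma same_point_ideal v w : same_point v w -> point_ideal v = point_ideal w.
Proof.
have sub x y : same_point x y -> point_ideal y `<=` point_ideal x.
  move=> [c [c0 E]] f fy t; rewrite -[RHS](fy (t * c)); apply: meval_eq => i.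
  by rewrite E mulrA.
by move=> h; apply/seteqP; split; apply: sub => //; apply: same_point_sym.
Qed.

Lemma same_point_of (J : set S) v w : homog_ideal J -> same_point v w ->
  point_of J w -> point_of J v.
Proof.
move=> [_ hJ] [c [c0 E]] [[i wi] hw]; split; first by exists i; rewrite E mulf_neq0.
move=> f Jf; rewrite (meval_eq (v2 := fun i => c * w i)) //.
rewrite (pihomog_partitionE (mf := mdeg) (leqnn (msize f))) rmorph_sum big1 //= => d _.
by rewrite (eval_homog w c (pihomogP _ _ _)) hw ?mulr0 //; apply: hJ.
Qed.

Variable p : nat.
Implicit Types M D : 'M[k]_(p, n.+1).

Lemma double_points_scale J M D : (forall i, same_point (M i) (D i)) ->
  double_points J M = double_points J D.
Proof.
move=> h; apply/seteqP; split=> f fM i; have := fM i.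
  by rewrite (same_point_ideal (h i)).
by rewrite (same_point_ideal (h i)).
Qed.

Lemma simple_points_scale M D : (forall i, same_point (M i) (D i)) ->
  simple_points M = simple_points D.
Proof.
move=> h; apply/seteqP; split=> f fM i; have := fM i.
  by rewrite (same_point_ideal (h i)).
by rewrite (same_point_ideal (h i)).
Qed.

End Scaling.

Section OpenSets.
Variables (k : closedFieldType) (n p : nat).
Local Notation N := n.+1.

Lemma meval_subst a b (Y : 'M[{mpoly k[b * N]}]_(a, N)) (Phi : {mpoly k[a * N]})
    (V : 'I_(b * N) -> k) :
  (mmap (@mpolyC (b * N) k) (mxvec Y 0) Phi).@[V] = Phi.@[mxvec (map_mx (meval V) Y) 0].
Proof.
move: Phi; apply: mpoly_ring_ind => [c|x|F G hF hG|F G hF hG].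
- by rewrite mmapC !mevalC.
- rewrite mmapX mmap1U mevalXU; case/mxvec_indexP: x => i l.
  by rewrite !mxvecE mxE.
- by rewrite raddfD /= !mevalD hF hG.
- by rewrite rmorphM /= !mevalM hF hG.
Qed.

Lemma meval_factor i (F : {mpoly k[N]}) (M : 'M[k]_(p, N)) :
  (factor i F).@[mxvec M 0] = F.@[M i].
Proof. exact: (mmap_factor idfun M i F). Qed.

(** The locus where [f] does not vanish need not be stable under rescaling of the rows. Its
    saturation under rescaling is, and remains open as a union of loci of the same kind. *)
Definition scaled_open (f : {mpoly k[p * N]}) : set 'M[k]_(p, N) :=
  [set M | exists2 c : 'rV[k]_p, (forall i, c 0 i != 0) & f.@[mxvec (diag_mx c *m M) 0] != 0].

Lemma scaled_open_open f : zariski_open (scaled_open f).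
Proof.
split.
  move=> c M c0 [d d0 fd]; exists (\row_i (d 0 i / c 0 i)).
    by move=> i; rewrite mxE mulf_neq0 ?invr_eq0.
  rewrite mulmxA mulmx_diag (_ : \row_i _ = d) //.
  by apply/rowP => i; rewrite !mxE divfK.
exists [set g | exists2 c : 'rV[k]_p, (forall i, c 0 i != 0) &
  forall M, g.@[mxvec M 0] = f.@[mxvec (diag_mx c *m M) 0]] => M; split; last first.
  by move=> [g [[c c0 gE] gM]]; exists c => //; rewrite -gE.
move=> [c c0 fc].
pose Y : 'M[{mpoly k[p * N]}]_(p, N) := \matrix_(i, a) ((c 0 i)%:MP * 'X_(mxvec_index i a)).
have E D : (mmap (@mpolyC (p * N) k) (mxvec Y 0) f).@[mxvec D 0] = f.@[mxvec (diag_mx c *m D) 0].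
  rewrite meval_subst; congr (f.@[mxvec _ 0]); apply/matrixP => i a.
  by rewrite mul_diag_mx !mxE mevalM mevalC mevalXU mxvecE.
by exists (mmap (@mpolyC (p * N) k) (mxvec Y 0) f); rewrite E; split=> //; exists c.
Qed.
End OpenSets.

Theorem lemma3 (k : closedFieldType) (k_char0 : [pchar k] =i pred0) (n : nat)
    (IX IH IH' IW : set {mpoly k[n.+1]})
    (hX : homog_ideal IX) (hH : homog_ideal IH) (hH' : homog_ideal IH')
    (hW : homog_ideal IW)
    (X_integral : integral_scheme IX)
    (H_cartier : cartier_divisor IX IH) (H_integral : integral_scheme IH)
    (H'_cartier : cartier_divisor IX IH') (H'_integral : integral_scheme IH')
    (H_neq : ~ same_scheme IH IH')
    (E_integral : integral_scheme (idsum IH IH'))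
    (W_sub : closed_sub IX IW) (W_dim0 : zero_dimensional IW)
    (W_regular : forall v, point_of IW v -> regular_at IX v)
    (r : nat) :
  for_general (idsum IH IH') IH (fun S Z : 'M[k]_(r, n.+1) =>
    distinct_points S -> distinct_points Z ->
    disjoint_from IW S -> disjoint_from IW Z ->
    forall i : nat, (i <= 1)%N ->
      dim_le
        (h_ideal IX (IW `&` double_points IH Z) i)
        (dim_add
           (h_ideal IX
              (idmul (colon IW IH' `&` double_points (idsum IH IH') S) IH') i)
           (h_ideal IH' (idsum IW IH' `&` simple_points S) i))).
Proof.
have char0 m : m.+1%:R != 0 :> k by rewrite (pcharf0P _).1.
have hE := homog_idsum hH hH'; have [iE _] := hE.
have [iH _] := hH; have [iH' _] := hH'; have [iX _] := hX.
set P := saturation IH; set Q := saturation (idsum IH IH').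
have pP : is_prime setT P := H_integral; have pQ : is_prime setT Q := E_integral.
have PQ : P `<=` Q by apply: satS; apply: idsuml.
have XH : closed_sub IX IH by case: H_cartier.
have [y Hy nPy] := proper_intersection hX hH hH' H_cartier H'_cartier pP H'_integral H_neq.
have Qy : Q y by apply: sub_sat => //; apply: idsumr.
have [j Qj] := chart_of_prime iE pQ.
have onX v : point_of (idsum IH IH') v -> point_of IX v.
  move=> pv; apply: (point_sat iX XH); split; first by case: pv.
  by move=> f Hf; apply: pv.2; apply: idsuml.
have [m [Delta [psi [R [[QD Qpsi] derR RE tanK [T cardT tanT]]]]]] :
  exists (m : nat) (Delta psi : {mpoly k[n.+1]}) (R : 'M[{mpoly k[n.+1]}]_n.+1),
  [/\ ~ Q Delta /\ ~ Q psi,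
    forall F c, P F -> P (\sum_i F^`M(i) * R i c),
    forall p w, tangent P p w -> forall i, \sum_c (R i c).@[p] * w c 0 = Delta.@[p] * w i 0,
    forall p : 'I_n.+1 -> k, (forall g, P g -> g.@[p] = 0) -> Delta.@[p] != 0 ->
      exists K : 'M[k]_(n.+1, m.+1), \rank K = m.+1 /\
        forall w, tangent P p w <-> exists z, w = K *m z
  & exists2 T : {set 'I_n.+1}, #|T| = m & forall p : 'I_n.+1 -> k, psi.@[p] != 0 ->
      forall w : 'cV_n.+1, tangent Q p w -> (forall i, i \in T -> w i 0 = 0) -> w = 0].
  (* At a point of $E$ in the chart of [j], the local equation of $H'$ provides the function that
     cuts tangent vectors of $H$ down to those of $E$. *)
  apply: (tangent_frame char0 pP pQ PQ Qy nPy Qj) => q qQ.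
  rewrite mevalXU => qj.
  have pq : point_of (idsum IH IH') q.
    by split=> [|f Ef]; [exists j | apply: qQ; apply: sub_sat].
  have [u [du eq_u]] := cartier_local hX hH' H'_cartier (onX _ pq).
  exists u => w tw uw; apply/(tangent_sat _ pq).
  exact: (tangent_cut hX hH hH' H_cartier pq eq_u tw uw).
have P_chart : ~ P (Delta * 'X_j) by move=> /PQ /(primeM pQ)[].
have [kappa [Z1 [Phi [vZ1 Phi1 kmax kopen]]]] := maximal_rank char0 hX hH hW H_cartier W_sub
  pP P_chart derR RE tanK r.
pose Y : 'M[{mpoly k[(r + r) * n.+1]}]_(r, n.+1) := \matrix_(i, a) 'X_(mxvec_index (rshift r i) a).
(* Both families lie in the chart of [j] and off [Delta = 0], the first one also off [psi = 0], and
   the second has maximal rank. *)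
pose f : {mpoly k[(r + r) * n.+1]} :=
  \prod_(i < r) factor (lshift r i) (Delta * 'X_j * psi) *
  \prod_(i < r) factor (rshift r i) (Delta * 'X_j) *
  mmap (@mpolyC _ k) (mxvec Y 0) Phi.
have fE D Z : f.@[mxvec (col_mx D Z) 0] =
    \prod_(i < r) (Delta * 'X_j * psi).@[D i] * \prod_(i < r) (Delta * 'X_j).@[Z i]
    * Phi.@[mxvec Z 0].
  have El i F : F.@[col_mx D Z (lshift r i)] = F.@[D i].
    by apply: meval_eq => a; rewrite col_mxEu.
  have Er i F : F.@[col_mx D Z (rshift r i)] = F.@[Z i].
    by apply: meval_eq => a; rewrite col_mxEd.
  rewrite /f !mevalM !rmorph_prod meval_subst; congr (_ * _ * _).
  - by apply: eq_bigr => i _; exact: etrans (meval_factor _ _ _) (El _ _).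
  - by apply: eq_bigr => i _; exact: etrans (meval_factor _ _ _) (Er _ _).
  - congr (Phi.@[mxvec _ 0]); apply/matrixP => i a.
    by rewrite !mxE mevalXU mxvecE col_mxEd.
exists (scaled_open f); split; first exact: scaled_open_open.
  have [v vQ] : exists2 v : 'I_n.+1 -> k, forall g, Q g -> g.@[v] = 0 & (Delta * 'X_j * psi).@[v] != 0.
    by apply: prime_zero => // /(primeM pQ)[/(primeM pQ)[]|].
  move=> fv; pose D : 'M[k]_(r, n.+1) := \matrix_(i, a) v a.
  have DE i F : F.@[D i] = F.@[v] by apply: meval_eq => a; rewrite mxE.
  have [Z1H Z1j Z1D] := vZ1.
  exists D, Z1; split=> //.
    move=> i; split; last by move=> F EF; rewrite DE; apply: vQ; apply: sub_sat.
    exists j; rewrite mxE; apply: contraNneq fv => vj.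
    by rewrite !mevalM mevalXU vj mulr0 mul0r.
  exists (const_mx 1); first by move=> i; rewrite mxE oner_eq0.
  rewrite diag_const_mx mul1mx fE !mulf_neq0 //.
    by apply/prodf_neq0 => i _; rewrite DE.
  by apply/prodf_neq0 => i _; rewrite mevalM mevalXU mulf_neq0.
move=> D0 Z0' DE0 ZH0 [c c0 fc] dD0 _ WD0 _ i le_i.
(* Rescaled representatives at which [f] itself does not vanish; they define the same schemes. *)
pose D := usubmx (diag_mx c *m col_mx D0 Z0'); pose Z := dsubmx (diag_mx c *m col_mx D0 Z0').
have sD l : same_point (D l) (D0 l).
  exists (c 0 (lshift r l)); split=> // a.
  by rewrite mxE mul_diag_mx mxE col_mxEu.
have sZ l : same_point (Z l) (Z0' l).
  exists (c 0 (rshift r l)); split=> // a.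
  by rewrite mxE mul_diag_mx mxE col_mxEd.
move: fc; rewrite -[diag_mx c *m _]vsubmxK -/D -/Z fE !mulf_eq0 !negb_or => /andP[/andP[fD fZ] PhiZ].
have fDl l : [/\ D l j != 0, Delta.@[D l] != 0 & psi.@[D l] != 0].
  move/prodf_neq0/(_ l isT): fD; rewrite !mevalM mevalXU !mulf_eq0 !negb_or.
  by case/andP => /andP[].
have fZl l : Z l j != 0 /\ Delta.@[Z l] != 0.
  move/prodf_neq0/(_ l isT): fZ; rewrite !mevalM mevalXU !mulf_eq0 !negb_or.
  by case/andP.
rewrite -(double_points_scale _ sD) -(simple_points_scale sD) -(double_points_scale _ sZ).
have vZ : valid IH j Delta Z.
  split=> l; try by case: (fZl l).
  exact: (same_point_of hH (sZ l) (ZH0 l)).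
have DE : points_on (idsum IH IH') D by move=> l; exact: (same_point_of hE (sD l) (DE0 l)).
have Dj l : D l j != 0 by case: (fDl l).
have DD l : Delta.@[D l] != 0 by case: (fDl l).
have Dpsi l : psi.@[D l] != 0 by case: (fDl l).
have dD : distinct_points D.
  move=> l l' ne h; apply: (dD0 l l' ne).
  exact: (same_point_trans (same_point_sym (sD l)) (same_point_trans h (sD l'))).
have WD : disjoint_from IW D.
  by move=> l h; apply: (WD0 l); exact: (same_point_of hW (same_point_sym (sD l)) h).
apply: (horace_inequality char0 hX hH hH' hW H_cartier H'_cartier W_sub tanK cardT tanT
  DE Dj DD Dpsi dD WD vZ _ le_i) => a t qa qt.
have [Z' vZ' rk] := rank_at_general char0 hX hH hH' hW H_cartier H'_cartier W_sub pP P_chart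
  derR RE tanK cardT tanT DE Dj DD Dpsi dD WD qa qt.
have [w' _ qw'] := rank_exists char0 hX hH hW H_cartier W_sub tanK vZ'.
have [w _ qw] := rank_exists char0 hX hH hW H_cartier W_sub tanK vZ.
(* The family [Z'] attached to the given $\widetilde{S}$ shows that [kappa] is large enough, and [Z]
   attains [kappa] because [Phi] does not vanish at it. *)
exists w => //; apply: leq_trans (rk _ qw') _.
exact: leq_trans (kmax _ _ vZ' qw') (kopen _ _ vZ PhiZ qw).
Qed.
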